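(* Let $\Omega \subset \mathbb{C}^d$ be a bounded convex domain with $C^{1,\alpha}$ boundary (for some $\alpha\in(0,1]$), let $o\in\Omega$, and let $(p_n)_{n}$, $(q_m)_{m}$ be sequences in $\Omega$ such that $p_n \to x \in \partial\Omega$ and $q_m \to y\in\partial\Omega$. (1) If $x=y$, then $\lim_{n,m\to\infty} (p_n|q_m)_o=\infty$. (2) If $\limsup_{n,m\to\infty} (p_n|q_m)_o=\infty$, then $T_x^{\mathbb{C}}\partial\Omega = T_y^{\mathbb{C}}\partial\Omega$.
   Context: $K_\Omega$ is the Kobayashi distance on $\Omega$, i.e. the integrated form of the infinitesimal Kobayashi metric $k_\Omega(x;v)=\inf\{|\xi| : f:\Delta\to\Omega \text{ holomorphic}, f(0)=x, df_0(\xi)=v\}$, where $\Delta$ is the unit disk (so $K_\Delta(\zeta_1,\zeta_2)=\tanh^{-1}\left|\frac{\zeta_1-\zeta_2}{1-\zeta_1\bar\zeta_2}\right|$). The Gromov product is $(p|q)_o=\frac12\big(K_\Omega(p,o)+K_\Omega(o,q)-K_\Omega(p,q)\big)$. The limit and limsup are joint in $n,m\to\infty$. $T_x^{\mathbb{C}}\partial\Omega$ is the complex affine hyperplane through $x$ tangent to $\partial\Omega$ at $x$. *)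

(* Defs.v *)
From HB Require Import structures.
From mathcomp Require Import all_boot all_order all_algebra.
From mathcomp Require Import complex.
From mathcomp Require Import all_classical all_reals all_analysis.

Set Implicit Arguments.
Unset Strict Implicit.
Unset Printing Implicit Defensive.

Import Order.TTheory GRing.Theory Num.Theory.
Import numFieldNormedType.Exports.

Local Open Scope classical_set_scope.
Local Open Scope ring_scope.

(* The generic instances on numFieldType are not found on the concrete type
   R[i]; with this one, 'rV[R[i]]_d is a normed module over R[i] (for the sup
   norm) and differentiable means complex differentiable. *)
HB.instance Definition _ (R : rcfType) := NormedModule.copy R[i] R[i]^o.

(* The identification of C^d with R^(2d), through which real differentiation
   of curves and of defining functions is expressed. *)
Definition toR {R : realType} {d : nat} (z : 'rV[R[i]]_d) : 'rV[R]_(d + d) :=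
  row_mx (map_mx (@complex.Re R) z) (map_mx (@complex.Im R) z).

Definition toC {R : realType} {d : nat} (u : 'rV[R]_(d + d)) : 'rV[R[i]]_d :=
  \row_j (u 0 (lshift d j) +i* u 0 (rshift d j))%C.

Lemma toRK (R : realType) (d : nat) : cancel (@toR R d) (@toC R d).
Proof.
move=> z; apply/rowP => j; rewrite mxE /toR row_mxEl row_mxEr !mxE.
by case: (z 0 j).
Qed.

Lemma toCK (R : realType) (d : nat) : cancel (@toC R d) (@toR R d).
Proof.
move=> u; rewrite -[RHS]hsubmxK; congr row_mx; apply/rowP => j;
  by rewrite !mxE.
Qed.

Section Kobayashi.
Context {R : realType} {d : nat}.
Local Notation Cd := 'rV[R[i]]_d.
Implicit Types (Omega : set Cd) (x y z w v : Cd).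

Definition domain Omega : Prop :=
  [/\ open Omega, Omega !=set0 & connected Omega].

Definition bdry Omega : set Cd := closure Omega `\` interior Omega.

Definition unit_disk : set R[i] := [set zeta | `|zeta| < 1].

Definition holomorphic_disk Omega (f : R[i] -> Cd) : Prop :=
  forall zeta, unit_disk zeta -> differentiable f zeta /\ Omega (f zeta).

(* The norm of R[i] takes its (real) values in R[i], whence the Re. *)
Definition kobayashi_metric Omega x v : R :=
  inf [set complex.Re `|xi| | xi in [set xi : R[i] | exists f : R[i] -> Cd,
    [/\ holomorphic_disk Omega f, f 0 = x & 'd f 0 xi = v]]].

Definition C1_on (n : nat) (c : R -> 'rV[R]_n) (a b : R) : Prop :=
  exists c' : R -> 'rV[R]_n,
    {within `[a, b], continuous c'} /\
    forall t, a < t < b -> is_derive t 1 c (c' t).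

(* The sequence s lists the right end points of the subintervals of a
   subdivision of [0, 1]. *)
Definition piecewise_C1 (n : nat) (c : R -> 'rV[R]_n) : Prop :=
  {within `[0, 1], continuous c} /\
  exists s : seq R,
    [/\ path <%R 0 s, last 0 s = 1 &
        forall i, (i < size s)%N ->
          C1_on c (nth 0 (0 :: s) i) (nth 0 s i)].

Definition curve_between Omega z w (c : R -> Cd) : Prop :=
  [/\ piecewise_C1 (toR \o c), forall t, 0 <= t <= 1 -> Omega (c t),
      c 0 = z & c 1 = w].

Definition velocity (c : R -> Cd) (t : R) : Cd := toC (derive1 (toR \o c) t).

(* The velocity is unspecified at the finitely many break points of c, which
   do not affect the integral. *)
Definition kobayashi_length Omega (c : R -> Cd) : \bar R :=
  (\int[@lebesgue_measure R]_(t in `[0%R, 1%R])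
    (kobayashi_metric Omega (c t) (velocity c t))%:E)%E.

Definition kobayashi_dist Omega z w : R :=
  fine (ereal_inf [set kobayashi_length Omega c | c in curve_between Omega z w]).

Definition gromov_product Omega (o z w : Cd) : R :=
  2^-1 * (kobayashi_dist Omega z o + kobayashi_dist Omega o w
          - kobayashi_dist Omega z w).

(* rho is a C^1 local defining function of Omega on the open set U. *)
Definition C1_defining Omega (U : set 'rV[R]_(d + d))
    (rho : 'rV[R]_(d + d) -> R) : Prop :=
  [/\ open U,
      forall u, U u -> differentiable rho u,
      forall h u, U u -> {for u, continuous (fun u' => 'd rho u' h)},
      forall u, U u -> exists h, 'd rho u h != 0 &
      forall u, U u -> (Omega (toC u) <-> rho u < 0)].

Definition C1alpha_boundary (alpha : R) Omega : Prop :=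
  forall x, bdry Omega x ->
  exists (U : set 'rV[R]_(d + d)) (rho : 'rV[R]_(d + d) -> R) (M : R),
    [/\ U (toR x), C1_defining Omega U rho &
        forall u u' h, U u -> U u' ->
          `|'d rho u h - 'd rho u' h| <= M * `|u - u'| `^ alpha * `|h|].

(* The kernel of the differential at x of a local defining function does not
   depend on the choice of the defining function. *)
Definition real_tangent Omega x : set Cd :=
  [set v | exists (U : set 'rV[R]_(d + d)) (rho : 'rV[R]_(d + d) -> R),
    [/\ U (toR x), C1_defining Omega U rho & 'd rho (toR x) (toR v) = 0]].

(* x + (T_x /\ i T_x), where T_x is the real tangent space at x. *)
Definition complex_tangent Omega x : set Cd :=
  [set z | real_tangent Omega x (z - x) /\
           real_tangent Omega x ('i%C *: (z - x))].

End Kobayashi.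

(* Main.v *)
(* Write delta p for - rho p, rho being a local defining function of class C^(1,alpha).
   A functional L with positive real part on Omega gives |dL(v)| / (2 Re L(x)) <= k(x; v).
   With L vanishing on the supporting complex hyperplane at a boundary point close to p,
   this yields K(p, o) >= - 1/2 ln (delta p) - C near x. Integrating the disks that the
   Hoelder condition fits between p and p + t n gives
   K(p, q) <= - 1/2 ln (delta p) - 1/2 ln (delta q) + ln (2 t) + C for every small t and
   all p, q close enough to x; so (p|q)_o >= - 1/2 ln (2 t) - C', and t is arbitrary.

   Let the complex tangent hyperplanes at x and y be distinct. A common point of them in
   the closure of Omega would be a boundary point, at which both are the complex tangent
   hyperplane; so there is none, and by compactness the two functionals are never
   simultaneously small on Omega. A curve from p to q then has to leave the set where the
   first is small and to enter that where the second is, and adding the two costs gives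
   K(p, q) >= - 1/2 ln (delta p) - 1/2 ln (delta q) - C. With the upper bounds for K(p, o)
   and K(o, q), the Gromov product is bounded near (x, y). *)

Require Import Defs.
From HB Require Import structures.
From mathcomp Require Import all_boot all_order all_algebra.
From mathcomp Require Import complex.
From mathcomp Require Import all_classical all_reals all_analysis.
From mathcomp Require Import measurable_realfun.
From mathcomp Require Import ring lra.

Set Implicit Arguments.
Unset Strict Implicit.
Unset Printing Implicit Defensive.

Import Order.TTheory GRing.Theory Num.Theory.
Import numFieldNormedType.Exports.

Local Open Scope classical_set_scope.
Local Open Scope ring_scope.

Import ComplexField.Normc.
Local Notation Re := (@complex.Re _).
Local Notation Im := (@complex.Im _).

(** * Complex analysis without contour integrals *)

(** Closeness to the hyperplane L = 0 is measured by |L|, not by Re L: two boundary points may share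
    the real tangent hyperplane and have distinct complex ones. As |dL| / (2 Re L) >= |dL| / (2
    |L|), the metric dominates half of |d ln L|; this is the 1/2 of all the estimates.

    The lower bound takes L at a boundary point moving with p: p may approach x tangentially, and
    the functional at x is then not controlled by delta p. Uniformity comes from the moving
    functional being close to the one at x.

    In the upper bound, the disk at height s is nearly a half-plane and gives 1 / (2 s) + O(s^(alpha
    - 1)). Since alpha > 0 the error is integrable, so the coefficient of ln (delta p) is exactly
    1/2 and the logarithms cancel in the Gromov product.

    The two costs add up without a factor because each logarithm is cut off away from its own
    hyperplane, so that at most one of them varies at a time. Since the metric along a curve is not
    known to be measurable, lengths are compared with integrals of continuous functions that have
    primitives. *)

Section MeanValue.
Variable R : realType.
Implicit Types (f df : R -> R) (a b M : R).

Lemma derive_within_continuous f df a b :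
  (forall x, a <= x <= b -> is_derive x 1 f (df x)) ->
  {within `[a, b], continuous f}.
Proof.
move=> fd; apply: derivable_within_continuous => x; rewrite in_itv /= => xab.
by have [] := fd _ xab.
Qed.

Lemma derive_bound f df a b M : a <= b ->
  (forall x, a <= x <= b -> is_derive x 1 f (df x)) ->
  (forall x, a <= x <= b -> `|df x| <= M) -> `|f b - f a| <= M * (b - a).
Proof.
move=> ab fd dfM.
have fd' x : x \in `]a, b[ -> is_derive x 1 f (df x).
  by rewrite in_itv /= => /andP[ax xb]; apply: fd; rewrite !ltW.
have [c] := MVT_segment ab fd' (derive_within_continuous fd).
rewrite in_itv /= => cab ->.
by rewrite normrM (ger0_norm (_ : 0 <= b - a)) ?subr_ge0// ler_wpM2r ?subr_ge0// dfM.
Qed.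

Lemma derive_ge0_le f df a b : a <= b ->
  (forall x, a <= x <= b -> is_derive x 1 f (df x)) ->
  (forall x, a <= x <= b -> 0 <= df x) -> f a <= f b.
Proof.
move=> ab fd df0.
have fd' x : x \in `]a, b[ -> is_derive x 1 f (df x).
  by rewrite in_itv /= => /andP[ax xb]; apply: fd; rewrite !ltW.
have [c] := MVT_segment ab fd' (derive_within_continuous fd).
rewrite in_itv /= => cab e.
by rewrite -subr_ge0 e mulr_ge0 ?subr_ge0// df0.
Qed.

End MeanValue.

(** * Goursat's theorem on rectangles *)

Section Goursat.
Context {R : realType}.
Variables U V FU FV : R -> R -> R.

(* The real part of the integral of (U + iV) dw / i along the boundary of the
   rectangle, FU and FV being primitives of U in the second and of V in the
   first variable. *)
Let bdint a b c d :=
  (FU b d - FU b c) - (FU a d - FU a c) + (FV c b - FV c a) - (FV d b - FV d a).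

(** Complex differentiability of U + iV at s0 + i t0 with derivative p + iq, in real coordinates and
    at a single scale e. *)
Definition CR_at (s0 t0 e p q s t : R) :=
  `|U s t - U s0 t0 - (p * (s - s0) - q * (t - t0))| <= e * (`|s - s0| + `|t - t0|) /\
  `|V s t - V s0 t0 - (q * (s - s0) + p * (t - t0))| <= e * (`|s - s0| + `|t - t0|).

(** [PU] and [PV] integrate the first-order Taylor polynomial, whose boundary integral vanishes.
    Only the remainder is left, which is at most e times the half-perimeter. *)
Let bdint_small (a b c d s0 t0 p q e : R) : 0 <= e ->
  a <= s0 <= b -> c <= t0 <= d ->
  (forall s t : R, a <= s <= b -> c <= t <= d -> is_derive t 1 (FU s) (U s t)) ->
  (forall s t : R, a <= s <= b -> c <= t <= d -> is_derive s 1 (FV t) (V s t)) ->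
  (forall s t, a <= s <= b -> c <= t <= d -> CR_at s0 t0 e p q s t) ->
  `|bdint a b c d| <= 2 * e * ((b - a) + (d - c)) ^+ 2.
Proof.
move=> e0 sab tcd fu fv cr.
have ab : a <= b by case/andP: sab => /le_trans; apply.
have cd : c <= d by case/andP: tcd => /le_trans; apply.
set K := (b - a) + (d - c).
have errb s t : a <= s <= b -> c <= t <= d ->
    e * (`|s - s0| + `|t - t0|) <= e * K.
  move=> sab' tcd'; apply: ler_wpM2l => //; rewrite /K; apply: lerD; rewrite ler_norml; lra.
pose PU s t := (U s0 t0 + p * (s - s0)) * t - q * ((t - t0) ^+ 2 / 2).
pose PV t s := (V s0 t0 + p * (t - t0)) * s + q * ((s - s0) ^+ 2 / 2).
have hU s : a <= s <= b ->
    `|(FU s d - PU s d) - (FU s c - PU s c)| <= e * K * (d - c).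
  move=> hs; apply: (@derive_bound _ (fun t => FU s t - PU s t)
     (fun t => U s t - (U s0 t0 + p * (s - s0) - q * (t - t0)))) => // t ht.
    have := fu _ _ hs ht => h; apply: is_derive_eq; rewrite /GRing.scale /=.
    by field.
  have [h _] := cr _ _ hs ht.
  by apply: le_trans (errb _ _ hs ht); move: h; congr (`|_| <= _); ring.
have hV t : c <= t <= d ->
    `|(FV t b - PV t b) - (FV t a - PV t a)| <= e * K * (b - a).
  move=> ht; apply: (@derive_bound _ (fun s => FV t s - PV t s)
     (fun s => V s t - (V s0 t0 + p * (t - t0) + q * (s - s0)))) => // s hs.
    have := fv _ _ hs ht => h; apply: is_derive_eq; rewrite /GRing.scale /=.
    by field.
  have [_ h] := cr _ _ hs ht.
  by apply: le_trans (errb _ _ hs ht); move: h; congr (`|_| <= _); ring.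
have := hU a; rewrite lexx ab => /(_ isT) ha.
have := hU b; rewrite lexx ab => /(_ isT) hb.
have := hV c; rewrite lexx cd => /(_ isT) hc.
have := hV d; rewrite lexx cd => /(_ isT) hd.
have -> : bdint a b c d =
  ((FU b d - PU b d) - (FU b c - PU b c)) - ((FU a d - PU a d) - (FU a c - PU a c))
  + ((FV c b - PV c b) - (FV c a - PV c a)) - ((FV d b - PV d b) - (FV d a - PV d a)).
  by rewrite /bdint /PU /PV; field.
move: ha hb hc hd.
set X1 := (_ - _); set X2 := (X in `|X| <= _ -> _); set X3 := (X in `|X| <= _ -> _).
set X4 := (X in `|X| <= _ -> _) => ha hb hc hd.
apply: le_trans (ler_normB _ _) _.
apply: le_trans (lerD (ler_normD _ _) (lexx _)) _.
apply: le_trans (lerD (lerD (ler_normB _ _) (lexx _)) (lexx _)) _.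
by apply: le_trans (lerD (lerD (lerD hb ha) hc) hd) _; rewrite /K; lra.
Qed.

(** The inner sides cancel, so the four quarters add up to the whole and one of them carries at
    least a quarter of it. The two booleans select it. *)
Let bdint_quarter (a w c h : R) : exists ij : bool * bool,
  `|bdint a (a + w) c (c + h)| / 4 <=
  `|bdint (a + ij.1%:R * (w / 2)) (a + ij.1%:R * (w / 2) + w / 2)
          (c + ij.2%:R * (h / 2)) (c + ij.2%:R * (h / 2) + h / 2)|.
Proof.
pose B i j := bdint (a + i%:R * (w / 2)) (a + i%:R * (w / 2) + w / 2)
          (c + j%:R * (h / 2)) (c + j%:R * (h / 2) + h / 2).
have aE : a + 1 * (w / 2) + w / 2 = a + w by field.
have cE : c + 1 * (h / 2) + h / 2 = c + h by field.
have BE : bdint a (a + w) c (c + h) = B 0 0 + B 0 1 + (B 1 0 + B 1 1).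
  rewrite /B /= aE cE !mul0r !addr0 !mul1r /bdint; ring.
apply: contrapT => /forallNP nB.
have {}nB (i j : bool) : `|B i j| < `|bdint a (a + w) c (c + h)| / 4.
  have := nB (i, j); move/negP; rewrite -ltNge /B /=.
  by case: i; case: j.
have := nB false false; have := nB false true.
have := nB true false; have := nB true true => /= h1 h2 h3 h4.
have : `|bdint a (a + w) c (c + h)| <= `|B 0 0| + `|B 0 1| + (`|B 1 0| + `|B 1 1|).
  by rewrite BE (le_trans (ler_normD _ _))// lerD// ler_normD.
move: h1 h2 h3 h4; rewrite /= => h1 h2 h3 h4; lra.
Qed.

(** Goursat's bisection: the integral around the n-th rectangle is at least 4^-n times the whole in
    modulus, while differentiability at the common point of the rectangles bounds it by an
    arbitrarily small multiple of 4^-n. *)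
Lemma goursat_rectangle (a b c d : R) : a <= b -> c <= d ->
  (forall s t : R, a <= s <= b -> c <= t <= d -> is_derive t 1 (FU s) (U s t)) ->
  (forall s t : R, a <= s <= b -> c <= t <= d -> is_derive s 1 (FV t) (V s t)) ->
  (forall s0 t0, a <= s0 <= b -> c <= t0 <= d -> exists p q : R,
    forall e, 0 < e -> exists2 dl : R, 0 < dl & forall s t,
    a <= s <= b -> c <= t <= d -> `|s - s0| < dl -> `|t - t0| < dl ->
    CR_at s0 t0 e p q s t) ->
  (FU b d - FU b c) - (FU a d - FU a c) + (FV c b - FV c a) - (FV d b - FV d a) = 0.
Proof.
move=> ab cd fu fv cr; rewrite -/(bdint a b c d).
have half (i : bool) (x y : R) : 0 <= y ->
    x <= x + i%:R * (y / 2) /\ x + i%:R * (y / 2) + y / 2 <= x + y.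
  by move=> y0; case: i => /=; split; lra.
have gap (x y s s0 e : R) : x <= s -> s <= x + y -> x <= s0 -> s0 <= x + y ->
    y < e -> `|s - s0| < e.
  by move=> *; rewrite ltr_norml; lra.
set w := b - a; set h := d - c.
have w0 : 0 <= w by rewrite subr_ge0.
have h0 : 0 <= h by rewrite subr_ge0.
pose next (n : nat) (x : R * R) :=
  let ij := projT1 (cid (bdint_quarter x.1 (w / 2 ^+ n) x.2 (h / 2 ^+ n))) in
  (x.1 + ij.1%:R * (w / 2 ^+ n / 2), x.2 + ij.2%:R * (h / 2 ^+ n / 2)).
pose corner := fix F n := if n is m.+1 then next m (F m) else (a, c).
pose W n := w / 2 ^+ n; pose H n := h / 2 ^+ n.
have WS n : W n.+1 = W n / 2 by rewrite /W exprS; field; rewrite expf_neq0.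
have HS n : H n.+1 = H n / 2 by rewrite /H exprS; field; rewrite expf_neq0.
have W0 n : 0 <= W n by rewrite divr_ge0// exprn_ge0.
have H0 n : 0 <= H n by rewrite divr_ge0// exprn_ge0.
pose I n := bdint (corner n).1 ((corner n).1 + W n) (corner n).2 ((corner n).2 + H n).
have IS n : `|I n| / 4 <= `|I n.+1|.
  rewrite /I WS HS /= /next.
  by case: cid => -[i j] /=.
have Ilow n : `|bdint a b c d| / 4 ^+ n <= `|I n|.
  elim: n => [|n IHn].
    by rewrite expr0 divr1 /I /= /W /H expr0 !divr1 /w /h !(addrC _ (_ - _)) !subrK.
  apply: le_trans (IS n); rewrite exprS invfM mulrA mulrAC.
  by rewrite ler_pM2r// invr_gt0.
have step n : [/\ (corner n).1 <= (corner n.+1).1,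
    (corner n.+1).1 + W n.+1 <= (corner n).1 + W n,
    (corner n).2 <= (corner n.+1).2 &
    (corner n.+1).2 + H n.+1 <= (corner n).2 + H n].
  rewrite WS HS /= /next; case: cid => -[i j] /= _.
  rewrite -/(W n) -/(H n); have [i1 i2] := half i (corner n).1 _ (W0 n).
  by have [j1 j2] := half j (corner n).2 _ (H0 n); split.
have mon k n : [/\ (corner n).1 <= (corner (k + n)%N).1,
    (corner (k + n)%N).1 + W (k + n)%N <= (corner n).1 + W n,
    (corner n).2 <= (corner (k + n)%N).2 &
    (corner (k + n)%N).2 + H (k + n)%N <= (corner n).2 + H n].
  elim: k => [|k [h1 h2 h3 h4]]; first by rewrite add0n; split.
  have [g1 g2 g3 g4] := step (k + n)%N; rewrite addSn.
  by split; [exact: le_trans g1|exact: le_trans h2|exact: le_trans g3|exact: le_trans h4].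
(* Every left end lies below every right end, so the supremum of the left ends belongs to all the
   intervals. *)
have cross m n : (corner m).1 <= (corner n).1 + W n /\ (corner m).2 <= (corner n).2 + H n.
  have [mn|nm] := leqP m n.
    have [h1 _ h3 _] := mon (n - m)%N m; rewrite subnK// in h1 h3.
    by split; [apply: le_trans h1 _|apply: le_trans h3 _]; rewrite lerDl.
  have [_ h2 _ h4] := mon (m - n)%N n; rewrite subnK ?(ltnW nm)// in h2 h4.
  by split; [apply: le_trans h2|apply: le_trans h4]; rewrite lerDl.
pose X := [set (corner n).1 | n in [set: nat]].
pose Y := [set (corner n).2 | n in [set: nat]].
have X0 : X !=set0 by exists a, 0%N.
have Y0 : Y !=set0 by exists c, 0%N.
pose s0 := sup X; pose t0 := sup Y.
have s0n n : (corner n).1 <= s0 <= (corner n).1 + W n.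
  apply/andP; split.
    apply: ub_le_sup; last by exists n.
    by exists ((corner 0%N).1 + W 0%N) => _ [m _ <-]; have [] := cross m 0%N.
  by apply: ge_sup => // _ [m _ <-]; have [] := cross m n.
have t0n n : (corner n).2 <= t0 <= (corner n).2 + H n.
  apply/andP; split.
    apply: ub_le_sup; last by exists n.
    by exists ((corner 0%N).2 + H 0%N) => _ [m _ <-]; have [] := cross m 0%N.
  by apply: ge_sup => // _ [m _ <-]; have [] := cross m n.
have sub n : [/\ a <= (corner n).1, (corner n).1 + W n <= b, c <= (corner n).2 &
    (corner n).2 + H n <= d].
  have [] := mon n 0%N; rewrite addn0 /= /W /H expr0 !divr1 /w /h => h1 h2 h3 h4.
  by split => //; lra.
have hs0 : a <= s0 <= b.
  by have := s0n 0%N; have [] := sub 0%N; lra.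
have ht0 : c <= t0 <= d.
  by have := t0n 0%N; have [] := sub 0%N; lra.
have [p [q crpq]] := cr _ _ hs0 ht0.
have small e : 0 < e -> `|bdint a b c d| <= 2 * e * (w + h) ^+ 2.
  move=> e0; have [dl dl0 crdl] := crpq _ e0.
  have [n hn] : exists n, W n + H n < dl.
    have : (w + h) / 2 ^+ n @[n --> \oo] --> 0.
      rewrite -[X in _ --> X](mulr0 (w + h)); apply: cvgMr.
      have -> : (fun n => (2 ^+ n)^-1) = (fun n => 2^-1 ^+ n) :> (nat -> R).
        by apply/funext => n; rewrite exprVn.
      by apply: cvg_expr; rewrite ger0_norm ?invr_ge0// invf_lt1// ltr1n.
    move/cvgrPdist_lt/(_ _ dl0) => [n _ /(_ n (leqnn n))] /=.
    rewrite sub0r normrN ger0_norm; last by apply: divr_ge0; [exact: addr_ge0|exact: exprn_ge0].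
    by rewrite mulrDl => ?; exists n.
  have [sub1 sub2 sub3 sub4] := sub n.
  have : `|I n| <= 2 * e *
      ((corner n).1 + W n - (corner n).1 + ((corner n).2 + H n - (corner n).2)) ^+ 2.
    apply: (@bdint_small _ _ _ _ s0 t0 p q) => //.
    - exact: ltW.
    - move=> s t /andP[s1 s2] /andP[t1 t2]; apply: fu.
        by rewrite (le_trans sub1 s1) (le_trans s2 sub2).
      by rewrite (le_trans sub3 t1) (le_trans t2 sub4).
    - move=> s t /andP[s1 s2] /andP[t1 t2]; apply: fv.
        by rewrite (le_trans sub1 s1) (le_trans s2 sub2).
      by rewrite (le_trans sub3 t1) (le_trans t2 sub4).
    move=> s t /andP[s1 s2] /andP[t1 t2]; have /andP[s3 s4] := s0n n; have /andP[t3 t4] := t0n n.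
    have Wn := W0 n; have Hn := H0 n; apply: crdl.
    - by rewrite (le_trans sub1 s1) (le_trans s2 sub2).
    - by rewrite (le_trans sub3 t1) (le_trans t2 sub4).
    - by apply: (gap _ _ _ _ _ s1 s2 s3 s4 (le_lt_trans _ hn)); rewrite lerDl.
    by apply: (gap _ _ _ _ _ t1 t2 t3 t4 (le_lt_trans _ hn)); rewrite lerDr.
  move=> In; have := le_trans (Ilow n) In.
  rewrite ler_pdivrMr ?exprn_gt0// => /le_trans; apply.
  rewrite le_eqVlt; apply/orP; left; apply/eqP.
  rewrite /W /H (_ : 4 ^+ n = 2 ^+ n * 2 ^+ n); last by rewrite -exprMn; congr (_ ^+ _); ring.
  by field; rewrite expf_neq0.
apply/eqP; rewrite -normr_le0; apply/ler_addgt0Pr => e e0; rewrite add0r.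
pose K := 2 * (w + h) ^+ 2 + 1.
have K0 : 0 < K by rewrite ltr_wpDl// mulr_ge0// exprn_ge0// addr_ge0.
apply: le_trans (small (e / K) _) _; first by rewrite divr_gt0.
rewrite -[X in _ <= X](divfK (lt0r_neq0 K0)) mulrAC mulrC ler_wpM2l ?divr_ge0 ?(ltW e0) ?(ltW K0)//.
by rewrite /K; lra.
Qed.

End Goursat.

Section Modulus.
Context {R : realType}.
Implicit Types z w : R[i].

Lemma normc_ge0 z : 0 <= normc z.
Proof. by case: z => a b; exact: sqrtr_ge0. Qed.

Lemma normc_Re z : `|Re z| <= normc z.
Proof.
by case: z => a b /=; rewrite -[leLHS]sqrtr_sqr ler_wsqrtr// lerDl sqr_ge0.
Qed.

Lemma normc_Im z : `|Im z| <= normc z.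
Proof.
by case: z => a b /=; rewrite -[leLHS]sqrtr_sqr ler_wsqrtr// lerDr sqr_ge0.
Qed.

Lemma normc_le_ReIm z : normc z <= `|Re z| + `|Im z|.
Proof.
case: z => a b /=; rewrite -[leRHS]ger0_norm ?addr_ge0// -sqrtr_sqr ler_wsqrtr//.
rewrite sqrrD !real_normK ?num_real// -addrA [_ *+ 2 + _]addrC addrA lerDl.
by rewrite mulrn_wge0// mulr_ge0.
Qed.

Lemma normc_real (x : R) : normc x%:C%C = `|x|.
Proof. by rewrite /= expr0n addr0 sqrtr_sqr. Qed.

Lemma normcB z w : normc (z - w) <= normc z + normc w.
Proof. by rewrite -(normcN w); exact: le_normcD. Qed.

Lemma normc_eq0 z : (normc z == 0) = (z == 0).
Proof.
apply/idP/idP => [/eqP/eq0_normc ->//|/eqP ->].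
by rewrite normc0.
Qed.

Lemma normc_gt0 z : (0 < normc z) = (z != 0).
Proof. by rewrite lt_neqAle eq_sym normc_ge0 andbT normc_eq0. Qed.

Lemma normc_sqrE z : normc z ^+ 2 = Re z ^+ 2 + Im z ^+ 2.
Proof. by case: z => a b /=; rewrite sqr_sqrtr// addr_ge0 ?sqr_ge0. Qed.

Lemma ReMc z w : Re (z * w) = Re z * Re w - Im z * Im w.
Proof. by case: z; case: w. Qed.

Lemma ImMc z w : Im (z * w) = Re z * Im w + Im z * Re w.
Proof. by case: z; case: w. Qed.

Lemma ReDc z w : Re (z + w) = Re z + Re w.
Proof. by case: z; case: w. Qed.

Lemma ImDc z w : Im (z + w) = Im z + Im w.
Proof. by case: z; case: w. Qed.

Lemma ReNc z : Re (- z) = - Re z.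
Proof. by case: z. Qed.

Lemma ImNc z : Im (- z) = - Im z.
Proof. by case: z. Qed.

End Modulus.

Section ComplexDerivative.
Context {R : realType}.
Implicit Types (g h : R[i] -> R[i]) (z D : R[i]).

(** Stated with the real-valued [normc], so that all estimates are between real numbers. *)
Definition cderiv g z D := forall e : R, 0 < e -> exists2 dl : R, 0 < dl &
  forall w, normc (w - z) < dl -> normc (g w - g z - D * (w - z)) <= e * normc (w - z).

Lemma cderiv_lip g z D : cderiv g z D -> exists2 dl : R, 0 < dl &
  forall w, normc (w - z) < dl -> normc (g w - g z) <= (normc D + 1) * normc (w - z).
Proof.
move=> /(_ 1 ltr01)[dl dl0 gD]; exists dl => // w /gD; rewrite mul1r => gw.
have -> : g w - g z = (g w - g z - D * (w - z)) + D * (w - z) by ring.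
apply: le_trans (le_normcD _ _) _; rewrite normcM mulrDl mul1r addrC; exact: lerD.
Qed.

Lemma cderiv_cst (c : R[i]) z : cderiv (fun=> c) z 0.
Proof.
move=> e e0; exists 1 => // w _; rewrite mul0r !subrr normc0.
by rewrite mulr_ge0 ?normc_ge0// ltW.
Qed.

Lemma cderiv_id z : cderiv id z 1.
Proof.
move=> e e0; exists 1 => // w _; rewrite mul1r subrr normc0.
by rewrite mulr_ge0 ?normc_ge0// ltW.
Qed.

Lemma cderivD g h z D D' : cderiv g z D -> cderiv h z D' ->
  cderiv (fun w => g w + h w) z (D + D').
Proof.
move=> gD hD e e0; have e2 : 0 < e / 2 by rewrite divr_gt0.
have [d1 d10 g1] := gD _ e2; have [d2 d20 h1] := hD _ e2.
exists (Num.min d1 d2); first by rewrite lt_min d10.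
move=> w; rewrite lt_min => /andP[/g1 gw /h1 hw].
have -> : g w + h w - (g z + h z) - (D + D') * (w - z) =
  (g w - g z - D * (w - z)) + (h w - h z - D' * (w - z)) by ring.
by apply: le_trans (le_normcD _ _) _; lra.
Qed.

Lemma cderivM g h z D D' : cderiv g z D -> cderiv h z D' ->
  cderiv (fun w => g w * h w) z (D * h z + g z * D').
Proof.
move=> gD hD e e0.
have [d3 d30 g2] := cderiv_lip gD; have [d4 d40 h2] := cderiv_lip hD.
pose K := normc (h z) + normc (g z) + (normc D + 1) * (normc D' + 1) + 1.
have KD : 0 <= (normc D + 1) * (normc D' + 1).
  by rewrite mulr_ge0// addr_ge0// normc_ge0.
have K0 : 0 < K by rewrite /K; have := normc_ge0 (h z); have := normc_ge0 (g z); lra.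
have eK : 0 < e / K by rewrite divr_gt0.
have [d1 d10 g1] := gD _ eK; have [d2 d20 h1] := hD _ eK.
exists (Num.min (Num.min d1 d2) (Num.min (Num.min d3 d4) (e / K))).
  by rewrite !lt_min d10 d20 d30 d40.
move=> w; rewrite !lt_min => /andP[/andP[/g1 gw /h1 hw] /andP[/andP[/g2 gw' /h2 hw'] wK]].
set N := normc (w - z) in gw hw gw' hw' wK *.
have N0 : 0 <= N := normc_ge0 _.
have -> : g w * h w - g z * h z - (D * h z + g z * D') * (w - z) =
  (g w - g z - D * (w - z)) * h z + g z * (h w - h z - D' * (w - z))
  + (g w - g z) * (h w - h z) by ring.
apply: le_trans (le_normcD _ _) _.
apply: le_trans (lerD (le_normcD _ _) (lexx _)) _; rewrite !normcM.
have t1 : normc (g w - g z - D * (w - z)) * normc (h z) <= e / K * N * normc (h z).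
  by rewrite ler_wpM2r ?normc_ge0.
have t2 : normc (g z) * normc (h w - h z - D' * (w - z)) <= normc (g z) * (e / K * N).
  by rewrite ler_wpM2l ?normc_ge0.
have t3 : normc (g w - g z) * normc (h w - h z) <=
    (normc D + 1) * N * ((normc D' + 1) * (e / K)).
  apply: ler_pM; rewrite ?normc_ge0//; apply: le_trans hw' _.
  by rewrite ler_wpM2l ?(ltW wK)// addr_ge0// normc_ge0.
apply: le_trans (lerD (lerD t1 t2) t3) _.
have -> : e / K * N * normc (h z) + normc (g z) * (e / K * N) +
   (normc D + 1) * N * ((normc D' + 1) * (e / K)) = e / K * N * (K - 1).
  by rewrite /K; ring.
have -> : e * N = e / K * N * K by field; rewrite gt_eqF.
by apply: ler_wpM2l; [rewrite mulr_ge0 // ltW|lra].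
Qed.

Lemma cderiv_comp g h z D D' : cderiv h z D' -> cderiv g (h z) D ->
  cderiv (fun w => g (h w)) z (D * D').
Proof.
move=> hD gD e e0.
have [d1 d10 h1] := cderiv_lip hD.
pose K := normc D' + 1; have K0 : 0 < K by rewrite ltr_wpDl// normc_ge0.
pose K' := normc D + 1; have K'0 : 0 < K' by rewrite ltr_wpDl// normc_ge0.
have [d2 d20 g2] := gD (e / (2 * K)) (divr_gt0 e0 (mulr_gt0 (ltr0Sn R 1) K0)).
have [d3 d30 h3] := hD (e / (2 * K')) (divr_gt0 e0 (mulr_gt0 (ltr0Sn R 1) K'0)).
exists (Num.min (Num.min d1 d3) (d2 / K)).
  by rewrite !lt_min d10 d30 divr_gt0.
move=> w; rewrite !lt_min => /andP[/andP[/h1 hw /h3 hw3]]; rewrite ltr_pdivlMr// mulrC => wK.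
set N := normc (w - z) in hw hw3 wK *.
have N0 : 0 <= N := normc_ge0 _.
have hwd : normc (h w - h z) < d2 by apply: le_lt_trans wK.
have -> : g (h w) - g (h z) - D * D' * (w - z) =
  (g (h w) - g (h z) - D * (h w - h z)) + D * (h w - h z - D' * (w - z)) by ring.
apply: le_trans (le_normcD _ _) _; rewrite normcM.
have t1 := g2 _ hwd.
have t2 : e / (2 * K) * normc (h w - h z) <= e / 2 * N.
  have -> : e / 2 * N = e / (2 * K) * (K * N) by field; rewrite gt_eqF.
  by rewrite ler_wpM2l// divr_ge0 ?(ltW e0)// mulr_ge0// ltW.
have t3 : normc D * normc (h w - h z - D' * (w - z)) <= e / 2 * N.
  have -> : e / 2 * N = K' * (e / (2 * K') * N) by field; rewrite gt_eqF.
  by apply: ler_pM; rewrite ?normc_ge0// lerDl.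
by lra.
Qed.

End ComplexDerivative.

Section ComplexExponential.
Context {R : realType}.
Implicit Types w z : R[i].

Definition cexp w : R[i] := (expR (Re w) * cos (Im w) +i* (expR (Re w) * sin (Im w)))%C.

Lemma cexpD z w : cexp (z + w) = cexp z * cexp w.
Proof.
apply/eqP; rewrite eq_complex ReMc ImMc /= ReDc ImDc expRD cosD sinD.
by apply/andP; split; apply/eqP; ring.
Qed.

Lemma cexp0 : cexp 0 = 1.
Proof. by rewrite /cexp /= expR0 cos0 sin0 mulr1 mulr0. Qed.

Lemma cexpN w : cexp (- w) = (cexp w)^-1.
Proof.
have h : cexp w * cexp (- w) = 1 by rewrite -cexpD subrr cexp0.
have w0 : cexp w != 0.
  by apply/eqP => w0; move/eqP: h; rewrite w0 mul0r eq_sym oner_eq0.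
by apply: (mulfI w0); rewrite h divff.
Qed.

Lemma normc_cexp w : normc (cexp w) = expR (Re w).
Proof.
by rewrite /= !exprMn -mulrDr cos2Dsin2 mulr1 sqrtr_sqr ger0_norm ?expR_ge0.
Qed.

Let is_derive_eps (f : R -> R) (x df : R) : is_derive x 1 f df ->
  forall e : R, 0 < e -> exists2 dl : R, 0 < dl &
  forall h, `|h| < dl -> `|f (x + h) - f x - df * h| <= e * `|h|.
Proof.
move=> [dfx dfE] e e0.
have : h^-1 *: (f (h *: 1 + x) - f x) @[h --> 0^'] --> df.
  by rewrite -dfE; exact: dfx.
move/cvgrPdist_le => /(_ _ e0)/nbhs_ballP[dl /= dl0 hd].
exists dl => // h hdl; have [->|h0] := eqVneq h 0.
  by rewrite addr0 subrr mulr0 subr0 !normr0 mulr0.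
have := hd h; rewrite -ball_normE /ball_ /= sub0r normrN => /(_ hdl h0).
rewrite /GRing.scale /= mulr1 [h + x]addrC => {}hd.
have -> : f (x + h) - f x - df * h = - ((df - h^-1 * (f (x + h) - f x)) * h).
  by field.
by rewrite normrN normrM ler_wpM2r.
Qed.

Let cderiv_cexp0 : cderiv cexp 0 1.
Proof.
move=> e e0.
(* The remainders below add up to 9 f |w|; f <= 1 keeps the exponential factor below 3. *)
have [f [e8 fe f1]] : exists f : R, [/\ 0 < f, f <= e / 10 & f <= 1].
  exists (Num.min (e / 10) 1); split; first by rewrite lt_min divr_gt0//= ltr01.
    by rewrite ge_min lexx.
  by rewrite ge_min lexx orbT.
have [d1 d10 h1] := is_derive_eps (is_derive_expR (0 : R)) e8.
have [d2 d20 h2] := is_derive_eps (is_derive_cos (0 : R)) e8.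
have [d3 d30 h3] := is_derive_eps (is_derive_sin (0 : R)) e8.
exists (Num.min (Num.min d1 d2) (Num.min d3 f)).
  by rewrite !lt_min d10 d20 d30 e8.
move=> w; rewrite subr0 mul1r !lt_min => /andP[/andP[w1 w2] /andP[w3 wf]].
have N0 := normc_ge0 w; set N := normc w in w1 w2 w3 wf N0 *.
have rN : `|Re w| <= N := normc_Re w; have iN : `|Im w| <= N := normc_Im w.
have {}h1 := h1 _ (le_lt_trans rN w1).
have {}h2 := h2 _ (le_lt_trans iN w2).
have {}h3 := h3 _ (le_lt_trans iN w3).
move: h1 h2 h3; rewrite !add0r expR0 cos0 sin0 oppr0 mul0r !subr0 !addr0 !mul1r => h1 h2 h3.
set a := Re w in rN h1; set b := Im w in iN h2 h3.
set E := expR a in h1; set C := cos b in h2; set S := sin b in h3.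
have fN : f * N <= e / 10 * N by rewrite ler_wpM2r.
have k1 : `|E - 1 - a| <= f * N by apply: le_trans h1 _; rewrite ler_wpM2l// ltW.
have k2 : `|C - 1| <= f * N by apply: le_trans h2 _; rewrite ler_wpM2l// ltW.
have k3 : `|S - b| <= f * N by apply: le_trans h3 _; rewrite ler_wpM2l// ltW.
have fN1 : f * N <= N by rewrite ler_piMl.
have kE : `|E - 1| <= 2 * N.
  have -> : E - 1 = (E - 1 - a) + a by ring.
  by apply: le_trans (ler_normD _ _) _; lra.
have N1 : N <= 1 by rewrite (le_trans (ltW wf)).
have E3 : `|E| <= 3.
  have -> : E = (E - 1) + 1 by ring.
  by apply: le_trans (ler_normD _ _) _; rewrite normr1; lra.
apply: le_trans (normc_le_ReIm _) _.
rewrite !ReDc !ImDc !ReNc !ImNc cexp0 /= -/a -/b -/E -/C -/S oppr0 addr0.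
have -> : E * C - 1 - a = (E - 1 - a) + E * (C - 1) by ring.
have -> : E * S - b = E * (S - b) + (E - 1) * b by ring.
apply: le_trans (lerD (ler_normD _ _) (ler_normD _ _)) _; rewrite !normrM.
have t1 : `|E| * `|C - 1| <= 3 * (f * N) by apply: ler_pM.
have t2 : `|E| * `|S - b| <= 3 * (f * N) by apply: ler_pM.
have t3 : `|E - 1| * `|b| <= 2 * N * f.
  by apply: ler_pM => //; apply: le_trans iN (ltW wf).
by have := mulr_ge0 (ltW e0) N0; lra.
Qed.

Lemma cderiv_cexp z : cderiv cexp z (cexp z).
Proof.
have h1 : cderiv (fun w => w + (- z)) z (1 + 0).
  exact: cderivD (@cderiv_id _ _) (@cderiv_cst _ _ _).
have h2 : cderiv cexp (z - z) 1 by rewrite subrr; exact: cderiv_cexp0.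
have := cderivM (cderiv_cst (cexp z) z) (cderiv_comp h1 h2).
rewrite mul0r add0r addr0 mulr1 mulr1.
congr (cderiv _ _ _); apply/funext => w.
by rewrite -cexpD addrCA subrr addr0.
Qed.

End ComplexExponential.

(** The margin m makes a and b interior points, so that the two-sided derivative exists there
    too. *)
Lemma primitive_exists {R : realType} (f : R -> R) (a b m : R) : 0 < m ->
  (forall x, a - m <= x <= b + m -> {for x, continuous f}) ->
  exists F : R -> R, forall x, a <= x <= b -> is_derive x 1 F (f x).
Proof.
move=> m0 cf; exists (fun x => \int[lebesgue_measure]_(t in `[a - m, x]) f t) => x xab.
have fi : lebesgue_measure.-integrable `[a - m, b + m] (EFin \o f).
  apply: continuous_compact_integrable; first exact: segment_compact.
  apply/continuous_in_subspaceT => z; rewrite inE /= in_itv /= => zab.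
  exact: cf.
have [] := @continuous_FTC1_closed _ f (a - m) x (b + m) _ fi.
- by lra.
- by lra.
- by apply: cf; lra.
by move=> d e; apply: DeriveDef; [exact: d|rewrite -derive1E; exact: e].
Qed.

Lemma primitive_unique {R : realType} (f F1 F2 : R -> R) (a b : R) : a <= b ->
  (forall x, a <= x <= b -> is_derive x 1 F1 (f x)) ->
  (forall x, a <= x <= b -> is_derive x 1 F2 (f x)) -> F1 b - F1 a = F2 b - F2 a.
Proof.
move=> ab d1 d2; apply/eqP; rewrite -subr_eq0 -normr_le0.
have := @derive_bound _ (fun x => F1 x - F2 x) (fun=> 0) a b 0 ab.
rewrite mul0r; have -> : F1 b - F2 b - (F1 a - F2 a) = F1 b - F1 a - (F2 b - F2 a) by ring.
apply => [x xab|x _]; last by rewrite normr0.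
have h1 := d1 _ xab; have h2 := d2 _ xab; apply: is_derive_eq.
by rewrite subrr.
Qed.

Section CircleMean.
Context {R : realType}.
Implicit Types (G : R[i] -> R[i]) (w : R[i]).

Lemma cderiv_line_continuous G (u v : R[i]) (t : R) :
  (exists D, cderiv G (u + v * t%:C%C) D) ->
  {for t, continuous (fun t : R => Re (G (u + v * t%:C%C)))} /\
  {for t, continuous (fun t : R => Im (G (u + v * t%:C%C)))}.
Proof.
move=> [D GD]; have [dl dl0 gl] := cderiv_lip GD.
pose K := (normc D + 1) * (normc v + 1).
have v1 : 0 < normc v + 1 by rewrite ltr_wpDl// normc_ge0.
have K0 : 0 < K by rewrite mulr_gt0// ltr_wpDl// normc_ge0.
have key (e : R) : 0 < e -> \forall t' \near t,
    normc (G (u + v * t'%:C%C) - G (u + v * t%:C%C)) <= e.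
  move=> e0; near=> t'.
  have tt : normc (u + v * t'%:C%C - (u + v * t%:C%C)) <= (normc v + 1) * `|t' - t|.
    have -> : u + v * t'%:C%C - (u + v * t%:C%C) = v * (t' - t)%:C%C.
      by rewrite rmorphB /=; ring.
    by rewrite normcM normc_real ler_wpM2r// lerDl.
  have t1 : `|t' - t| < dl / (normc v + 1).
    rewrite distrC; near: t'; apply/nbhs_ballP.
    by exists (dl / (normc v + 1)); rewrite /= ?divr_gt0// => z.
  have t2 : `|t' - t| <= e / K.
    rewrite distrC; near: t'; apply/nbhs_ballP.
    by exists (e / K); rewrite /= ?divr_gt0// => z /ltW.
  apply: le_trans (gl _ _) _.
    by apply: le_lt_trans tt _; rewrite mulrC -ltr_pdivlMr.
  apply: le_trans (ler_wpM2l _ tt) _; first by rewrite addr_ge0 ?normc_ge0.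
  by rewrite mulrA -/K mulrC -ler_pdivlMr.
split; apply/cvgrPdist_le => e e0; have := key _ e0; apply: filterS => t' h;
  rewrite distrC; apply: le_trans h.
  by rewrite -ReNc -ReDc normc_Re.
by rewrite -ImNc -ImDc normc_Im.
Unshelve. all: by end_near. Qed.

(** In the coordinate w = ln z vertical segments of length 2 pi are circles. By periodicity the
    horizontal sides of the rectangle cancel in Goursat's theorem, so the integral over a circle
    does not depend on its radius. *)
Lemma circle_mean_const G (a b : R) (Fa Fb : R -> R) : a <= b -> b < 0 ->
  (forall w, Re w < 0 -> exists D, cderiv G w D) ->
  (forall s : R, G (s +i* (pi *+ 2))%C = G (s +i* 0)%C) ->
  (forall t, 0 <= t <= pi *+ 2 -> is_derive t 1 Fa (Re (G (a +i* t)%C))) ->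
  (forall t, 0 <= t <= pi *+ 2 -> is_derive t 1 Fb (Re (G (b +i* t)%C))) ->
  Fb (pi *+ 2) - Fb 0 = Fa (pi *+ 2) - Fa 0.
Proof.
move=> ab b0 hG per hFa hFb.
have pi20 : 0 <= pi *+ 2 :> R by rewrite mulrn_wge0// pi_ge0.
have E1 (s t : R) : (s +i* t)%C = s%:C%C + 'i%C * t%:C%C.
  by apply/eqP; rewrite eq_complex ReDc ImDc ReMc ImMc /=; apply/andP; split; apply/eqP; ring.
have E2 (s t : R) : (s +i* t)%C = 'i%C * t%:C%C + 1 * s%:C%C.
  by rewrite mul1r addrC E1.
have cU (s t : R) : s < 0 -> {for t, continuous (fun t : R => Re (G (s +i* t)%C))}.
  move=> s0; have -> : (fun t => Re (G (s +i* t)%C)) =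
     (fun t => Re (G (s%:C%C + 'i%C * t%:C%C))) by apply/funext => t'; rewrite E1.
  by have [] := @cderiv_line_continuous G s%:C%C 'i%C t; rewrite -?E1//; apply: hG.
have cV (t s : R) : s < 0 -> {for s, continuous (fun s : R => Im (G (s +i* t)%C))}.
  move=> s0; have -> : (fun s => Im (G (s +i* t)%C)) =
     (fun s => Im (G ('i%C * t%:C%C + 1 * s%:C%C))) by apply/funext => t'; rewrite E2.
  by have [] := @cderiv_line_continuous G ('i%C * t%:C%C) 1 s; rewrite -?E2//; apply: hG.
have /choice[FU hFU] : forall s : R, exists F : R -> R, s <= b ->
    forall t, 0 <= t <= pi *+ 2 -> is_derive t 1 F (Re (G (s +i* t)%C)).
  move=> s; have [sb|sb] := leP s b; last by exists id.
  have [F hF] := @primitive_exists _ (fun t => Re (G (s +i* t)%C)) 0 (pi *+ 2) 1 ltr01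
    (fun t _ => @cU s t (le_lt_trans sb b0)).
  by exists F.
have /choice[FV hFV] : forall t : R, exists F : R -> R,
    forall s, a <= s <= b -> is_derive s 1 F (Im (G (s +i* t)%C)).
  move=> t; apply: (@primitive_exists _ _ _ _ (- b / 2)); first by lra.
  by move=> s sab; apply: cV; lra.
have FVp : FV 0 b - FV 0 a = FV (pi *+ 2) b - FV (pi *+ 2) a.
  apply: (@primitive_unique _ (fun s => Im (G (s +i* 0)%C))) => // s sab.
  by rewrite -per; exact: (hFV _ s sab).
rewrite (primitive_unique pi20 hFa (hFU _ ab)) (primitive_unique pi20 hFb (hFU _ (lexx b))).
suff : FU b (pi *+ 2) - FU b 0 - (FU a (pi *+ 2) - FU a 0)
    + (FV 0 b - FV 0 a) - (FV (pi *+ 2) b - FV (pi *+ 2) a) = 0 by move: FVp; lra.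
apply: (@goursat_rectangle _ (fun s t => Re (G (s +i* t)%C))
   (fun s t => Im (G (s +i* t)%C)) FU FV) => //.
- by move=> s t sab tab; apply: hFU => //; case/andP: sab.
- by move=> s t sab tab; apply: hFV.
move=> s0 t0 s0ab _; have [D hD] : exists D, cderiv G (s0 +i* t0)%C D by apply: hG; rewrite /=; lra.
exists (Re D), (Im D) => e e0; have [dl dl0 hdl] := hD _ e0.
exists (dl / 2); first by rewrite divr_gt0.
move=> s t _ _ hs ht.
have dE : (s +i* t)%C - (s0 +i* t0)%C = ((s - s0) +i* (t - t0))%C by [].
have N : normc ((s +i* t)%C - (s0 +i* t0)%C) <= `|s - s0| + `|t - t0|.
  by rewrite dE (le_trans (normc_le_ReIm _)).
have {}hdl := hdl (s +i* t)%C (le_lt_trans N _); rewrite dE in hdl N.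
have {}hdl : normc (G (s +i* t)%C - G (s0 +i* t0)%C - D * ((s - s0) +i* (t - t0))%C) <=
    e * (`|s - s0| + `|t - t0|).
  apply: le_trans (hdl _) _; first by lra.
  by rewrite ler_wpM2l// ltW.
split; apply: le_trans hdl.
  by apply: le_trans (normc_Re _); rewrite !ReDc !ReNc ReMc.
have imE : Im D * (s - s0) + Re D * (t - t0) = Re D * (t - t0) + Im D * (s - s0) by ring.
by rewrite imE; apply: le_trans (normc_Im _); rewrite !ImDc !ImNc ImMc.
Qed.

End CircleMean.

(** * The Schwarz-Pick inequality for maps to the half-plane *)

Section SchwarzPick.
Context {R : realType}.
Variables (g : R[i] -> R[i]) (D0 : R[i]).
Hypothesis hol : forall z, normc z < 1 -> exists D, cderiv g z D.
Hypothesis Re_ge0 : forall z, normc z < 1 -> 0 <= Re (g z).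
Hypothesis gD0 : cderiv g 0 D0.

(** Without its first-order Taylor polynomial g is o(z) at 0, which absorbs the simple pole r / z of
    the kernel in [G]. *)
Let g1 z := g z + (- g 0 + (- D0) * z).

Let g1_hol z : normc z < 1 -> exists D, cderiv g1 z D.
Proof.
move=> /hol[D gD]; eexists; apply: cderivD gD _; apply: cderivD; first exact: cderiv_cst.
by apply: cderivM; [exact: cderiv_cst|exact: cderiv_id].
Qed.

(* On the circle Re w = ln r the second factor is 2 - 2 cos (Im w) >= 0. *)
Let G (r : R) w := g1 (cexp w) * (2 + ((- r%:C%C) * cexp ((-1) * w) + (- r^-1%:C%C) * cexp w)).

Let G_hol r w : Re w < 0 -> exists D, cderiv (G r) w D.
Proof.
move=> w0; have [|D hD] := @g1_hol (cexp w); first by rewrite normc_cexp expR_lt1.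
eexists; apply: cderivM; first exact: (cderiv_comp (@cderiv_cexp _ _) hD).
apply: cderivD; first exact: cderiv_cst.
apply: cderivD; apply: cderivM; [exact: cderiv_cst| |exact: cderiv_cst|exact: cderiv_cexp].
apply: (@cderiv_comp _ cexp (fun w => (-1) * w)); last exact: cderiv_cexp.
by apply: cderivM; [exact: cderiv_cst|exact: cderiv_id].
Qed.

Let G_per r (s : R) : G r (s +i* (pi *+ 2))%C = G r (s +i* 0)%C.
Proof.
have e1 : cexp (s +i* (pi *+ 2))%C = cexp (s +i* 0)%C.
  by rewrite /cexp /= cos2pi sin2pi cos0 sin0.
by rewrite /G !mulN1r !cexpN !e1.
Qed.

Let G_prim r (s : R) : s < 0 -> exists F : R -> R,
  forall t, 0 <= t <= pi *+ 2 -> is_derive t 1 F (Re (G r (s +i* t)%C)).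
Proof.
move=> s0; apply: (@primitive_exists _ _ _ _ 1) => // t _.
have E1 (t' : R) : (s +i* t')%C = s%:C%C + 'i%C * t'%:C%C.
  by apply/eqP; rewrite eq_complex ReDc ImDc ReMc ImMc /=; apply/andP; split; apply/eqP; ring.
have -> : (fun t => Re (G r (s +i* t)%C)) =
   (fun t => Re (G r (s%:C%C + 'i%C * t%:C%C))) by apply/funext => t'; rewrite E1.
by have [] := @cderiv_line_continuous _ (G r) s%:C%C 'i%C t; rewrite -?E1//; apply: G_hol.
Qed.

(** On the circle of radius rho <= r <= 1 the kernel is at most 2 + r / rho + rho / r, and [g1] at
    most e * rho once rho is small. *)
Let G_small (b e : R) : b < 0 -> 0 < e -> exists2 a : R, a <= b &
  forall t, `|Re (G (expR b) (a +i* t)%C)| <= 4 * e.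
Proof.
move=> b0 e0; have [dl dl0 hdl] := gD0 e0.
exists (Num.min b (ln dl - 1)); first by rewrite ge_min lexx.
move=> t; set a := Num.min _ _; set w := (a +i* t)%C.
have ab : a <= b by rewrite ge_min lexx.
have ad : expR a < dl.
  rewrite -[ltRHS]lnK ?posrE// ltr_expR (le_lt_trans (y := ln dl - 1))//.
    by rewrite ge_min lexx orbT.
  by rewrite ltrBlDr ltrDl.
set r := expR b; set rho := expR a.
have r0 : 0 < r by exact: expR_gt0.
have rho0 : 0 < rho by exact: expR_gt0.
have rr : rho <= r by rewrite ler_expR.
have r1 : r <= 1 by rewrite ltW// expR_lt1.
apply: le_trans (normc_Re _) _; rewrite /G normcM.
have n1 : normc (g1 (cexp w)) <= e * rho.
  have := hdl (cexp w); rewrite subr0 normc_cexp => /(_ ad).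
  by congr (normc _ <= _); rewrite /g1; ring.
have n2 : normc (2 + (- r%:C%C * cexp ((-1) * w) + - r^-1%:C%C * cexp w)) <= 2 + (r / rho + rho / r).
  apply: le_trans (le_normcD _ _) _; apply: lerD.
    by have := normc_real (2 : R); rewrite rmorphMn /= => ->; rewrite ger0_norm.
  apply: le_trans (le_normcD _ _) _; rewrite !normcM !normcN !normc_real.
  rewrite mulN1r cexpN normcV !normc_cexp /= -/rho.
  by rewrite !ger0_norm ?(ltW r0)// ?invr_ge0 ?(ltW r0)// [r^-1 * _]mulrC.
apply: le_trans (ler_pM (normc_ge0 _) (normc_ge0 _) n1 n2) _.
have -> : e * rho * (2 + (r / rho + rho / r)) = e * (2 * rho + r + rho * (rho / r)).
  by field; rewrite !gt_eqF.
have : rho * (rho / r) <= rho * 1 by rewrite ler_wpM2l ?(ltW rho0)// ler_pdivrMr// mul1r.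
move=> h; rewrite mulrC ler_wpM2r ?(ltW e0)//; lra.
Qed.

(** On the circle of radius r the kernel 2 - 2 cos t is nonnegative, and the mean of Re g against it
    is 2 Re (g 0) - r Re D0, because [g1] contributes 0. Then r tends to 1. *)
Lemma schwarz_pick_Re : Re D0 <= 2 * Re (g 0).
Proof.
have pi20 : 0 <= pi *+ 2 :> R by rewrite mulrn_wge0// pi_ge0.
suff key (b : R) : b < 0 -> expR b * Re D0 <= 2 * Re (g 0).
  have [D00|D00] := leP (Re D0) 0.
    by apply: le_trans D00 _; rewrite mulr_ge0// Re_ge0// normc0.
  apply/ler_addgt0Pr => e e0.
  (* A radius below 1 which tends to 1 as e tends to 0. *)
  have := key (ln (Re D0 / (Re D0 + e))).
  have De : 0 < Re D0 + e by rewrite addr_gt0.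
  have q0 : 0 < Re D0 / (Re D0 + e) by rewrite divr_gt0.
  rewrite ln_lt0 ?q0 ?ltr_pdivrMr ?mul1r ?ltrDl// lnK ?posrE// => /(_ isT).
  set X := 2 * _; rewrite mulrAC ler_pdivrMr// => h.
  rewrite leNgt; apply/negP => h'.
  suff : X * (Re D0 + e) < Re D0 * Re D0 by rewrite ltNge h.
  nra.
move=> b0; set r := expR b.
have r0 : 0 < r by exact: expR_gt0.
have [Fb hFb] := @G_prim r b b0.
have Fb0 : Fb (pi *+ 2) - Fb 0 = 0.
  apply/eqP; rewrite -normr_le0; apply/ler_addgt0Pr => e e0; rewrite add0r.
  have K0 : 0 < 8 * (pi *+ 2) :> R by rewrite mulr_gt0// mulrn_wgt0// pi_gt0.
  have [a ab ha] := G_small b0 (divr_gt0 e0 K0).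
  have [Fa hFa] := @G_prim r a (le_lt_trans ab b0).
  rewrite (circle_mean_const ab b0 (@G_hol r) (@G_per r) hFa hFb).
  apply: le_trans (derive_bound pi20 hFa (fun t _ => ha t)) _.
  have gen (x : R) : 0 < x -> 4 * (e / (8 * x)) * x = e / 2.
    by move=> x0; field; rewrite gt_eqF.
  have pi2 : 0 < pi *+ 2 :> R by rewrite mulrn_wgt0// pi_gt0.
  by rewrite subr0 (gen _ pi2); lra.
pose A := Re (g 0); pose B1 := Re D0; pose B2 := Im D0.
(* A primitive of the Taylor polynomial's contribution, the real part of g 0 + D0 z on the circle
   |z| = r times 2 - 2 cos t. Adding it to [Fb] restores g in place of [g1]. *)
pose P (t : R) := 2 * A * t - 2 * A * sin t + 2 * r * B1 * sin t + 2 * r * B2 * cos t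
  - r * B1 * (t + sin t * cos t) + r * B2 * sin t ^+ 2.
have PE : P (pi *+ 2) - P 0 = (2 * A - r * B1) * (pi *+ 2).
  by rewrite /P sin2pi cos2pi sin0 cos0; ring.
have : Fb 0 + P 0 <= Fb (pi *+ 2) + P (pi *+ 2).
  apply: (@derive_ge0_le _ (fun t => Fb t + P t)
    (fun t => Re (g (cexp (b +i* t)%C)) * (2 - 2 * cos t))) => // t ht; last first.
    apply: mulr_ge0; last by have := cos_le1 t; lra.
    by apply: Re_ge0; rewrite normc_cexp expR_lt1.
  have h := hFb _ ht; apply: is_derive_eq; rewrite /GRing.scale /=.
  have fE : 2 + ((- r%:C%C) * cexp ((-1) * (b +i* t)%C) + (- r^-1%:C%C) * cexp (b +i* t)%C)
      = (2 - 2 * cos t)%:C%C.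
    rewrite /cexp mulN1r /= cosN sinN expRN -/r.
    apply/eqP; rewrite eq_complex !ReDc !ImDc !ReMc !ImMc !ReNc !ImNc /=.
    by apply/andP; split; apply/eqP; field; rewrite gt_eqF.
  rewrite /G fE ReMc /g1 /= !ReDc !ReNc !ReMc !ReNc !ImNc /= -/r -/A -/B1 -/B2.
  have c2 : sin t * sin t = 1 - cos t * cos t by rewrite -!expr2 sin2cos2.
  ring: c2.
rewrite -subr_ge0.
have -> : Fb (pi *+ 2) + P (pi *+ 2) - (Fb 0 + P 0) =
  (Fb (pi *+ 2) - Fb 0) + (P (pi *+ 2) - P 0) by ring.
rewrite Fb0 add0r PE pmulr_lge0 ?subr_ge0//.
by rewrite mulrn_wgt0// pi_gt0.
Qed.

End SchwarzPick.

(** Precomposition with the rotation u = conj D0 / |D0| makes the derivative at 0 equal to |D0| and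
    reduces to the bound on the real part. *)
Lemma schwarz_pick {R : realType} (g : R[i] -> R[i]) (D0 : R[i]) :
  (forall z, normc z < 1 -> exists D, cderiv g z D) ->
  (forall z, normc z < 1 -> 0 <= Re (g z)) ->
  cderiv g 0 D0 -> normc D0 <= 2 * Re (g 0).
Proof.
move=> hol pos gD0; have [->|D00] := eqVneq D0 0.
  by rewrite normc0 mulr_ge0// pos// normc0.
have nD0 : 0 < normc D0 by rewrite normc_gt0.
pose u := (conjc D0) / (normc D0)%:C%C.
have uD : D0 * u = (normc D0)%:C%C.
  rewrite /u mulrA; have -> : D0 * conjc D0 = (normc D0)%:C%C ^+ 2.
    rewrite -rmorphXn normc_sqrE; apply/eqP; rewrite eq_complex ReMc ImMc.
    by case: (D0) => x y /=; apply/andP; split; apply/eqP; ring.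
  by rewrite expr2 mulfK// eq_complex /= eqxx andbT gt_eqF.
have u1 : normc u = 1.
  apply: (mulfI (lt0r_neq0 nD0)); rewrite -normcM uD mulr1 normc_real ger0_norm//.
  exact: normc_ge0.
have du z : cderiv (fun w => u * w) z (0 * z + u * 1).
  by apply: cderivM; [exact: cderiv_cst|exact: cderiv_id].
have := @schwarz_pick_Re _ (fun w => g (u * w)) (D0 * (0 * 0 + u * 1)).
rewrite !mulr0 add0r mulr1 uD; apply.
- move=> z z1; have [|D hD] := hol (u * z); first by rewrite normcM u1 mul1r.
  by eexists; exact: (cderiv_comp (du z) hD).
- by move=> z z1; apply: pos; rewrite normcM u1 mul1r.
- have := cderiv_comp (du 0) (D := D0) (g := g); rewrite !mulr0 mulr1 add0r uD; exact.
Qed.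

(** * The space C^d and its linear functionals *)

Lemma rV_entry_le {R : realType} {n : nat} (u : 'rV[R]_n) (k : 'I_n) : `|u 0 k| <= `|u|.
Proof.
rewrite [leRHS]/Num.norm /= mx_normrE.
by apply: (le_bigmax _ (fun ij => `|u ij.1 ij.2|) (0, k)).
Qed.

Lemma rV_norm_le {R : realType} {n : nat} (u : 'rV[R]_n) (K : R) : 0 <= K ->
  (forall k, `|u 0 k| <= K) -> `|u| <= K.
Proof.
move=> K0 uK; rewrite [leLHS]/Num.norm /= mx_normrE.
by apply/bigmax_leP; split => // -[i j] _ /=; rewrite (ord1 i).
Qed.

Section RealCoordinates.
Context {R : realType} {d : nat}.
Local Notation Cd := 'rV[R[i]]_d.
Implicit Types (z w : Cd) (u v : 'rV[R]_(d + d)) (c : R[i]) (x : R).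

Lemma toR_Re z j : toR z 0 (lshift d j) = Re (z 0 j).
Proof. by rewrite row_mxEl mxE. Qed.

Lemma toR_Im z j : toR z 0 (rshift d j) = Im (z 0 j).
Proof. by rewrite row_mxEr mxE. Qed.

Lemma toR_ext z u : (forall j, Re (z 0 j) = u 0 (lshift d j)) ->
  (forall j, Im (z 0 j) = u 0 (rshift d j)) -> toR z = u.
Proof.
move=> hr hi; apply/rowP => k; case: (splitP k) => j e.
  by rewrite (_ : k = lshift d j) ?toR_Re ?hr//; apply: val_inj.
by rewrite (_ : k = rshift d j) ?toR_Im ?hi//; apply: val_inj.
Qed.

Lemma toRD z w : toR (z + w) = toR z + toR w.
Proof.
apply: toR_ext => j; rewrite mxE [RHS]mxE.
  by rewrite !toR_Re ReDc.
by rewrite !toR_Im ImDc.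
Qed.

Lemma toRZ x z : toR (x%:C%C *: z) = x *: toR z.
Proof.
apply: toR_ext => j; rewrite mxE [RHS]mxE.
  by rewrite toR_Re ReMc /= mul0r subr0.
by rewrite toR_Im ImMc /= mul0r addr0.
Qed.

Lemma toRN z : toR (- z) = - toR z.
Proof.
have -> : - z = (-1)%:C%C *: z by rewrite rmorphN scaleN1r.
by rewrite toRZ scaleN1r.
Qed.

Lemma toRB z w : toR (z - w) = toR z - toR w.
Proof. by rewrite toRD toRN. Qed.

Lemma toR0 : toR (0 : Cd) = 0.
Proof. by rewrite -(subrr 0) toRB subrr. Qed.

Lemma toCD u v : toC (u + v) = toC u + toC v.
Proof. by rewrite -[RHS]toRK toRD !toCK. Qed.

Lemma toCZ x u : toC (x *: u) = x%:C%C *: toC u.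
Proof. by rewrite -[RHS]toRK toRZ !toCK. Qed.

Lemma toCB u v : toC (u - v) = toC u - toC v.
Proof. by rewrite -[RHS]toRK toRB !toCK. Qed.

(* The real norm on C^d transported from R^(2d); that of 'rV[R[i]]_d has its
   values in R[i]. *)
Definition nrm z : R := `|toR z|.

Lemma nrm_ge0 z : 0 <= nrm z.
Proof. exact: normr_ge0. Qed.

Lemma nrmD z w : nrm (z + w) <= nrm z + nrm w.
Proof. by rewrite /nrm toRD ler_normD. Qed.

Lemma nrmN z : nrm (- z) = nrm z.
Proof. by rewrite /nrm toRN normrN. Qed.

Lemma nrmB z w : nrm (z - w) <= nrm z + nrm w.
Proof. by rewrite -(nrmN w); exact: nrmD. Qed.

Lemma nrm_distC z w : nrm (z - w) = nrm (w - z).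
Proof. by rewrite -nrmN opprB. Qed.

Lemma nrm0 : nrm 0 = 0.
Proof. by rewrite /nrm toR0 normr0. Qed.

Lemma nrmZr x z : nrm (x%:C%C *: z) = `|x| * nrm z.
Proof. by rewrite /nrm toRZ normrZ. Qed.

Lemma nrm_entry z j : normc (z 0 j) <= 2 * nrm z.
Proof.
apply: le_trans (normc_le_ReIm _) _; rewrite -toR_Re -toR_Im.
by have := rV_entry_le (toR z) (lshift d j); have := rV_entry_le (toR z) (rshift d j);
  rewrite /nrm; lra.
Qed.

Lemma nrm_le z (K : R) : 0 <= K -> (forall j, normc (z 0 j) <= K) -> nrm z <= K.
Proof.
move=> K0 zK; apply: rV_norm_le => // k; case: (splitP k) => j e.
  rewrite (_ : k = lshift d j); last exact: val_inj.
  by rewrite toR_Re (le_trans (normc_Re _)).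
rewrite (_ : k = rshift d j); last exact: val_inj.
by rewrite toR_Im (le_trans (normc_Im _)).
Qed.

(** [nrm] is homogeneous for real scalars only; a complex scalar mixes real and imaginary parts,
    whence the factor 2, which recurs in the radii below. *)
Lemma nrmZ c z : nrm (c *: z) <= 2 * normc c * nrm z.
Proof.
apply: nrm_le => [|j]; first by rewrite !mulr_ge0 ?nrm_ge0 ?normc_ge0.
rewrite mxE normcM [2 * _]mulrC -mulrA.
by rewrite ler_wpM2l ?normc_ge0// nrm_entry.
Qed.

Lemma gt0_realC c : 0 < c -> exists2 x, 0 < x & c = x%:C%C.
Proof.
case: c => a b; rewrite ltcE /= => /andP[/eqP -> a0]; exists a => //.
Qed.

Lemma normr_normc c : `|c| = (normc c)%:C%C.
Proof. by []. Qed.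

Lemma cnorm_le z (K : R) : 0 <= K -> (forall j, normc (z 0 j) <= K) -> `|z| <= K%:C%C.
Proof.
move=> K0 zK; have K0' : 0 <= K%:C%C :> R[i] by rewrite ler0c.
move: (K%:C%C) K0' (fun j => etrans (lecR _ _) (zK j)) => k.
move=> /nonnegP[{}k] zk.
rewrite [leLHS]/Num.norm /= mx_normE num_le; apply/bigmax_leP; split.
  by rewrite -num_le /= ge0.
by move=> [i j] _; rewrite -num_le /= (ord1 i) normr_normc; exact: zk.
Qed.

Lemma nrm_le_cnorm z (K : R) : `|z| <= K%:C%C -> nrm z <= K.
Proof.
move=> zK; have K0 : 0 <= K by rewrite -ler0c (le_trans _ zK)// normr_ge0.
apply: nrm_le => // j; rewrite -lecR -normr_normc; apply: le_trans zK.
rewrite [leRHS]/Num.norm /= mx_normE -[leLHS]nngE num_le.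
exact: (le_bigmax _ (fun ij => `|z ij.1 ij.2|%:nng) (0, j)).
Qed.

Lemma nbhs_nrm z (A : set Cd) :
  nbhs z A <-> exists2 e : R, 0 < e & forall w, nrm (w - z) < e -> A w.
Proof.
split => [/nbhs_ballP[c /= /gt0_realC[e e0 ->] zA]|[e e0 zA]].
  exists (e / 2); first by rewrite divr_gt0.
  move=> w wz; apply: zA; rewrite -ball_normE /=.
  apply: (@le_lt_trans _ _ (2 * nrm (w - z))%:C%C); last by rewrite ltcR; lra.
  rewrite -normrN opprB; apply: cnorm_le => [|j]; first by rewrite mulr_ge0// nrm_ge0.
  exact: nrm_entry.
apply/nbhs_ballP; exists (e / 2)%:C%C; first by rewrite /= ltcR divr_gt0.
move=> w; rewrite -ball_normE /= -normrN opprB => /ltW /nrm_le_cnorm wz.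
by apply: zA; lra.
Qed.

Lemma closure_nrm (A : set Cd) z :
  closure A z <-> forall e : R, 0 < e -> exists2 w, A w & nrm (w - z) < e.
Proof.
split => [zA e e0|h B /nbhs_nrm[e e0 zB]].
  have [|w [Aw wz]] := zA [set w | nrm (w - z) < e]; first by apply/nbhs_nrm; exists e.
  by exists w.
by have [w Aw wz] := h _ e0; exists w; split => //; apply: zB.
Qed.

Lemma cvg_nrm (p : nat -> Cd) z : p n @[n --> \oo] --> z ->
  forall e : R, 0 < e -> \forall n \near \oo, nrm (p n - z) < e.
Proof. by move=> pz e e0; apply: (pz [set w | nrm (w - z) < e]); apply/nbhs_nrm; exists e. Qed.

End RealCoordinates.

Section ConvexSegment.
Context {R : realType} {d : nat}.
Variable Omega : set 'rV[R[i]]_d.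

(** The weights in [convex_set] are elements of R[i] between 0 and 1; for the order of R[i] these
    are the real numbers of [0, 1]. *)
Lemma convex_segment (z w : 'rV[R[i]]_d) (t : R) : convex_set Omega ->
  Omega z -> Omega w -> 0 <= t <= 1 -> Omega (z + t%:C%C *: (w - z)).
Proof.
move=> cO Oz Ow /andP[t0 t1].
have c0 : 0 <= t%:C%C :> R[i] by rewrite ler0c.
have c1 : t%:C%C <= 1 :> R[i] by rewrite lecR.
have := cO w z (Itv01 c0 c1); rewrite !inE => /(_ Ow Oz).
congr Omega; rewrite /conv /=.
by apply/rowP => j; rewrite !mxE /unstable.onem; ring.
Qed.

End ConvexSegment.

Section Functionals.
Context {R : realType}.

Definition rlinear {n : nat} (A : 'rV[R]_n -> R) :=
  (forall u v, A (u + v) = A u + A v) /\ (forall (x : R) u, A (x *: u) = x * A u).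

Lemma rlinear_bound {n : nat} (A : 'rV[R]_n -> R) : rlinear A ->
  exists2 K : R, 0 <= K & forall u, `|A u| <= K * `|u|.
Proof.
move=> [AD AZ]; exists (\sum_j `|A (delta_mx 0 j)|); first exact: sumr_ge0.
move=> u; rewrite {1}(row_sum_delta u).
have A0 : A 0 = 0 by rewrite -(scale0r 0) AZ mul0r.
rewrite (big_morph A AD A0); apply: le_trans (ler_norm_sum _ _ _) _.
rewrite mulr_suml; apply: ler_sum => j _.
by rewrite AZ normrM mulrC ler_wpM2l// rV_entry_le.
Qed.

Context {d : nat}.
Local Notation Cd := 'rV[R[i]]_d.

Definition clinear (l : Cd -> R[i]) (K : R) :=
  [/\ forall z w, l (z + w) = l z + l w, forall c z, l (c *: z) = c * l z, 0 <= K &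
      forall z, normc (l z) <= K * nrm z].

Lemma clinearN l K z : clinear l K -> l (- z) = - l z.
Proof. by case=> _ lZ _ _; rewrite -scaleN1r lZ mulN1r. Qed.

Lemma clinearB l K z w : clinear l K -> l (z - w) = l z - l w.
Proof. by move=> lK; case: (lK) => lD _ _ _; rewrite lD (clinearN _ lK). Qed.

(** The C-linear functional whose real part is A. *)
Definition clin (A : 'rV[R]_(d + d) -> R) (z : Cd) : R[i] :=
  (A (toR z) +i* - A (toR ('i%C *: z)))%C.

Lemma clinE A z : rlinear A -> Re (clin A z) = A (toR z).
Proof. by []. Qed.

Lemma clin_clinear A (K : R) : rlinear A -> 0 <= K -> (forall u, `|A u| <= K * `|u|) ->
  clinear (clin A) (3 * K).
Proof.
move=> [AD AZ] K0 AK; split.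
- move=> z w; rewrite /clin scalerDr !toRD !AD opprD.
  by apply/eqP; rewrite eq_complex /= !eqxx.
- move=> c z; case: c => a b.
  have e1 : (a +i* b)%C *: z = a%:C%C *: z + b%:C%C *: ('i%C *: z).
    rewrite scalerA -scalerDl; congr (_ *: _).
    by apply/eqP; rewrite eq_complex /= !mul0r !mulr0 mulr1 subr0 !addr0 !add0r !eqxx.
  have e2 : 'i%C *: ((a +i* b)%C *: z) = a%:C%C *: ('i%C *: z) + (- b)%:C%C *: z.
    rewrite !scalerA -scalerDl; congr (_ *: _).
    by apply/eqP; rewrite eq_complex /=; apply/andP; split; apply/eqP; ring.
  rewrite /clin e2 e1 !toRD !toRZ !AD !AZ.
  by apply/eqP; rewrite eq_complex /=; apply/andP; split; apply/eqP; ring.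
- by rewrite mulr_ge0.
move=> z; apply: le_trans (normc_le_ReIm _) _ => /=; rewrite normrN.
have h1 := AK (toR z); have h2 := AK (toR ('i%C *: z)); rewrite -!/(nrm _) in h1 h2.
have h3 : nrm ('i%C *: z) <= 2 * nrm z.
  apply: le_trans (nrmZ _ _) _.
  by rewrite /= expr0n expr1n /= add0r sqrtr1 mulr1.
have h4 := ler_wpM2l K0 h3; lra.
Qed.

Let derive_normc (f : R[i] -> Cd) (z : R[i]) : differentiable f z ->
  forall e : R, 0 < e -> exists2 dl : R, 0 < dl & forall h : R[i],
  normc h < dl -> nrm (f (h + z) - f z - h *: 'd f z 1) <= 2 * e * normc h.
Proof.
move=> fz e e0.
have dfz : derivable f z 1 by apply/derivable1_diffP.
have : h^-1 *: (f (h *: 1 + z) - f z) @[h --> 0^'] --> 'd f z 1.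
  by rewrite -deriveE//; exact: dfz.
have e0' : 0 < e%:C%C :> R[i] by rewrite ltcR.
move/cvgrPdist_le => /(_ _ e0')/nbhs_ballP[c /= /gt0_realC[dl dl0 ->] hd].
exists dl => // h hdl; have [->|h0] := eqVneq h 0.
  by rewrite add0r subrr scale0r subr0 nrm0 normc0 mulr0.
have := hd h; rewrite -ball_normE /ball_ /= sub0r normrN normr_normc ltcR.
move=> /(_ hdl h0) /nrm_le_cnorm.
rewrite [h *: 1]mulr1 => {}hd.
have -> : f (h + z) - f z - h *: 'd f z 1 =
    - (h *: ('d f z 1 - h^-1 *: (f (h + z) - f z))).
  by rewrite scalerBr scalerA divff// scale1r opprB.
rewrite nrmN; apply: le_trans (nrmZ _ _) _.
have -> : 2 * e * normc h = 2 * normc h * e by ring.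
by rewrite ler_wpM2l// mulr_ge0 ?normc_ge0.
Qed.

Lemma cderiv_clinear (l : Cd -> R[i]) (K : R) (c0 : R[i]) (f : R[i] -> Cd) (z : R[i]) :
  clinear l K -> differentiable f z ->
  cderiv (fun w => l (f w) + c0) z (l ('d f z 1)).
Proof.
move=> lK fz e e0; have [lD lZ K0 lb] := lK.
have K1 : 0 < 2 * (K + 1) by rewrite mulr_gt0// ltr_wpDl.
have [dl dl0 hdl] := derive_normc fz (divr_gt0 e0 K1).
exists dl => // w wz; have := hdl _ wz; rewrite subrK => h.
have -> : l (f w) + c0 - (l (f z) + c0) - l ('d f z 1) * (w - z) =
    l (f w - f z - (w - z) *: 'd f z 1).
  by rewrite !(clinearB _ _ lK) lZ; ring.
apply: le_trans (lb _) _; apply: le_trans (ler_wpM2l K0 h) _.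
have -> : K * (2 * (e / (2 * (K + 1))) * normc (w - z)) =
    K / (K + 1) * (e * normc (w - z)) by field; lra.
rewrite ler_piMl ?mulr_ge0 ?normc_ge0 ?(ltW e0)//.
by rewrite ler_pdivrMr ?mul1r ?lerDl// ltr_wpDl.
Qed.

End Functionals.

Lemma differentiable_affine_line {K : numFieldType} {V : normedModType K}
    (k : K -> K) (a u : V) (z : K) : derivable k z 1 ->
  differentiable (fun z => a + k z *: u) z /\
  forall xi, 'd (fun z => a + k z *: u) z xi = (xi * derive1 k z) *: u.
Proof.
move=> dk; have dk' : differentiable k z by apply/derivable1_diffP.
have dku : differentiable (fun z => k z *: u) z by exact: differentiableZl.
have -> : (fun z => a + k z *: u) = cst a + (fun z => k z *: u) by [].
split; first by apply: differentiableD => //; exact: differentiable_cst.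
by move=> xi; rewrite diffD// diff_cst -[LHS]/(0 + _) add0r diffZl// deriv1E.
Qed.

Lemma diff_scale1 {K : numFieldType} {V : normedModType K} (f : K -> V) (z xi : K) :
  'd f z xi = xi *: 'd f z 1.
Proof. by rewrite -linearZ; congr ('d f z _); rewrite [RHS]mulr1. Qed.

Lemma derive1_idK {K : numFieldType} (z : K) : derive1 (id : K -> K) z = 1.
Proof. by rewrite derive1E derive_id. Qed.

Lemma derivable_idK {K : numFieldType} (z : K) : derivable (id : K -> K) z 1.
Proof. exact: derivable_id. Qed.

(** * Elementary bounds for the Kobayashi metric *)

Section KobayashiMetric.
Context {R : realType} {d : nat}.
Local Notation Cd := 'rV[R[i]]_d.
Variable Omega : set Cd.
Implicit Types (x v : Cd) (f : R[i] -> Cd).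
Local Notation kob := (kobayashi_metric Omega).

Lemma unit_diskE (z : R[i]) : unit_disk z <-> normc z < 1.
Proof. by rewrite /unit_disk /= normr_normc -ltcR. Qed.

Lemma kobayashi_metric_le x v (xi : R[i]) f :
  holomorphic_disk Omega f -> f 0 = x -> 'd f 0 xi = v -> kob x v <= normc xi.
Proof.
move=> hf f0 df; apply: ge_inf; last by exists xi => //; exists f.
by exists 0 => _ [c _ <-]; exact: normc_ge0.
Qed.

Lemma kobayashi_metric_ge0 x v : 0 <= kob x v.
Proof.
rewrite /kobayashi_metric; set S := (X in inf X).
have [S0|S0] := pselect (S !=set0); last first.
  by rewrite (_ : S = set0) ?inf0//; apply/seteqP; split => // c Sc; apply: S0; exists c.
by apply: lb_le_inf => // _ [c _ <-]; exact: normc_ge0.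
Qed.

Lemma kobayashi_metricN x v : kob x (- v) = kob x v.
Proof.
have h w c : (exists f, [/\ holomorphic_disk Omega f, f 0 = x & 'd f 0 c = w]) ->
    exists f, [/\ holomorphic_disk Omega f, f 0 = x & 'd f 0 (- c) = - w].
  by move=> [f [hf f0 fw]]; exists f; split => //; rewrite linearN fw.
rewrite /kobayashi_metric; congr inf; apply/seteqP; split => _ [c /= hc <-].
  by exists (- c); [rewrite /= -[v]opprK; exact: h|rewrite /= normcN].
by exists (- c); [exact: h|rewrite /= normcN].
Qed.

Lemma kobayashi_metric_disk (k : R[i] -> R[i]) (a u : Cd) (xi : R[i]) :
  (forall z, normc z < 1 -> derivable k z 1) ->
  (forall z, normc z < 1 -> Omega (a + k z *: u)) ->
  kob (a + k 0 *: u) ((xi * derive1 k 0) *: u) <= normc xi.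
Proof.
move=> dk Ok.
have n0 : normc (0 : R[i]) < 1 by rewrite normc0.
apply: (@kobayashi_metric_le _ _ _ (fun z => a + k z *: u)).
- move=> z /unit_diskE z1; split; last exact: Ok.
  exact: (differentiable_affine_line a u (dk _ z1)).1.
- by [].
exact: (differentiable_affine_line a u (dk _ n0)).2.
Qed.

Lemma kobayashi_metric_ball x v (r : R) : 0 < r ->
  (forall w, nrm (w - x) < r -> Omega w) -> kob x v <= 2 * nrm v / r.
Proof.
move=> r0 Or.
have [v0|vn0] := eqVneq (nrm v) 0.
  have := @kobayashi_metric_disk id x 0 0; rewrite mul0r !scaler0 addr0 normc0.
  have -> : v = 0.
    by rewrite -[v]toRK (_ : toR v = 0) ?(normr0_eq0 v0)// -toR0 toRK.
  rewrite nrm0 mulr0 mul0r; apply => [z _|z _]; first exact: derivable_idK.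
  by apply: Or; rewrite scaler0 addr0 subrr nrm0.
have v0 : 0 < nrm v by rewrite lt_neqAle eq_sym vn0 nrm_ge0.
(* The 2 compensates for the one in [nrmZ]. *)
pose t := r / (2 * nrm v); have t0 : 0 < t by rewrite divr_gt0// mulr_gt0.
have := @kobayashi_metric_disk id x (t%:C%C *: v) (t^-1%:C%C).
rewrite normc_real scale0r addr0 derive1_idK mulr1 scalerA -rmorphM /= mulVf ?gt_eqF//.
rewrite scale1r ger0_norm ?invr_ge0 ?(ltW t0)// /t invf_div.
apply => [z _|z z1]; first exact: derivable_idK.
apply: Or; rewrite addrAC subrr add0r; apply: le_lt_trans (nrmZ _ _) _.
rewrite nrmZr ger0_norm ?(ltW t0)//.
have -> : 2 * normc z * (t * nrm v) = normc z * r by rewrite /t; field; rewrite gt_eqF.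
by rewrite gtr_pMl.
Qed.

(** For a competing disk f, l \o f + c0 maps the unit disk to the closed right half-plane, and its
    derivative at 0, multiplied by xi, is l v: Schwarz-Pick bounds xi from below. *)
Lemma kobayashi_metric_ge (l : Cd -> R[i]) (K : R) (c0 : R[i]) x v : open Omega ->
  clinear l K -> (forall z, Omega z -> 0 <= Re (l z + c0)) -> Omega x ->
  0 < Re (l x + c0) ->
  normc (l v) / (2 * Re (l x + c0)) <= kob x v.
Proof.
move=> oO lK lpos Ox lx.
have [r r0 xr] : exists2 r : R, 0 < r & forall w, nrm (w - x) < r -> Omega w.
  by apply/nbhs_nrm; exact: open_nbhs_nbhs.
apply: lb_le_inf.
  (* Without competitors the infimum would be 0, so a small affine disk is exhibited. *)
  have [t t0 xt] : exists2 t : R, 0 < t & forall z : R[i], normc z < 1 -> Omega (x + z *: (t%:C%C *: v)).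
    have K0 : 0 < 2 * (nrm v + 1) by rewrite mulr_gt0// ltr_wpDl// nrm_ge0.
    exists (r / (2 * (nrm v + 1))); first by rewrite divr_gt0.
    move=> z z1; apply: xr; rewrite addrAC subrr add0r; apply: le_lt_trans (nrmZ _ _) _.
    rewrite nrmZr ger0_norm ?divr_ge0 ?(ltW r0) ?(ltW K0)//.
    have -> : 2 * normc z * (r / (2 * (nrm v + 1)) * nrm v) =
       normc z * (r * (nrm v / (nrm v + 1))) by have := nrm_ge0 v; move=> ?; field; lra.
    apply: le_lt_trans (_ : normc z * r < r); last by rewrite gtr_pMl.
    rewrite ler_wpM2l ?normc_ge0// ler_piMr ?(ltW r0)// ler_pdivrMr ?ltr_wpDl ?nrm_ge0//.
    by rewrite mul1r lerDl.
  exists (normc (t^-1%:C%C)), (t^-1%:C%C) => //.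
  have dl z := @differentiable_affine_line _ _ id x (t%:C%C *: v) z (@derivable_idK _ z).
  exists (fun z => x + z *: (t%:C%C *: v)); split.
  - by move=> z /unit_diskE z1; split; [exact: (dl z).1|exact: xt].
  - by rewrite scale0r addr0.
  rewrite (dl 0).2 derive1_idK mulr1 scalerA -rmorphM /= mulVf ?gt_eqF//.
  by rewrite scale1r.
move=> _ [xi [f [hf f0 fv]] <-] /=.
have [_ lZ _ _] := lK.
have f01 : unit_disk (0 : R[i]) by apply/unit_diskE; rewrite normc0.
rewrite ler_pdivrMr ?mulr_gt0// -fv diff_scale1 lZ normcM.
rewrite ler_wpM2l ?normc_ge0// -f0.
apply: (@schwarz_pick _ (fun w => l (f w) + c0)).
- by move=> z /unit_diskE/hf[fz _]; eexists; exact: (cderiv_clinear c0 lK fz).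
- by move=> z /unit_diskE/hf[_ Oz]; exact: lpos.
- by apply: (cderiv_clinear c0 lK); have [] := hf _ f01.
Qed.

End KobayashiMetric.

(** * Integrals of functions not known to be measurable *)

(* The integral of a nonnegative function that is not known to be measurable is
   the supremum of the integrals of the simple functions below it. *)
Section LowerIntegral.
Context d (T : measurableType d) (R : realType) (mu : {measure set T -> \bar R}).
Import HBNNSimple.
Local Open Scope ereal_scope.

Lemma lower_integral_le (D : set T) (f g : T -> \bar R) :
  (forall x, D x -> 0 <= f x) -> (forall x, D x -> f x <= g x) ->
  \int[mu]_(x in D) f x <= \int[mu]_(x in D) g x.
Proof.
move=> f0 fg; rewrite !ge0_integralE//; last first.
  by move=> x Dx; exact: le_trans (f0 _ Dx) (fg _ Dx).
apply: le_ereal_sup => _ [h /= hf <-]; exists h => // x; apply: le_trans (hf x) _.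
rewrite /patch; case: ifP => // /set_mem; exact: fg.
Qed.

(** Additivity in the domain survives for lower integrals: a simple function below f on the union
    splits along A and B, and simple functions below f on A and on B add up. The two suprema of the
    second half are taken one after the other, after the case of an infinite value is set apart. *)
Lemma lower_integral_setU (A B : set T) (f : T -> \bar R) :
  measurable A -> measurable B -> [disjoint A & B] -> (forall x, 0 <= f x) ->
  \int[mu]_(x in A `|` B) f x = \int[mu]_(x in A) f x + \int[mu]_(x in B) f x.
Proof.
move=> mA mB AB f0; apply/eqP; rewrite eq_le; apply/andP; split.
  rewrite [leLHS]ge0_integralE//; apply: ge_ereal_sup => _ [h /= hf <-].
  have hE : sintegral mu h = \int[mu]_(x in A `|` B) (h x)%:E.
    rewrite -integralT_nnsfun [RHS]integral_mkcond; apply: eq_integral => x _.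
    rewrite /patch; case: ifPn => // xAB; apply/eqP; rewrite eq_le.
    have := hf x; rewrite /patch (negbTE xAB) => -> /=.
    by rewrite lee_fin; exact: fun_ge0.
  rewrite hE ge0_integral_setU//; last first.
  - by move=> x _; rewrite lee_fin; exact: fun_ge0.
  - apply/measurable_EFinP; exact: measurable_funTS.
  have hl (C : set T) : C `<=` A `|` B ->
      \int[mu]_(x in C) (h x)%:E <= \int[mu]_(x in C) f x.
    move=> CAB; apply: lower_integral_le => x Cx; first by rewrite lee_fin; exact: fun_ge0.
    by have := hf x; rewrite /patch mem_set//; exact: CAB.
  by apply: leeD; apply: hl => x; [left|right].
rewrite [leRHS]ge0_integralE//; set c := ereal_sup _.
have c0 : 0 <= c.
  apply: ereal_sup_ubound; exists nnsfun0; last exact: sintegral0.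
  by move=> x /=; rewrite /patch; case: ifP.
have key (h1 h2 : {nnsfun T >-> R}) : (forall x, (h1 x)%:E <= (f \_ A) x) ->
    (forall x, (h2 x)%:E <= (f \_ B) x) -> sintegral mu h1 + sintegral mu h2 <= c.
  move=> hA hB; rewrite -sintegralD//; apply: ereal_sup_ubound.
  exists (h1 \+ h2)%R => //= x; rewrite EFinD.
  have := hA x; have := hB x; rewrite /patch in_setU.
  case: (boolP (x \in A)) => xA; case: (boolP (x \in B)) => xB /=.
  - by move: AB => /disj_setPLR/(_ _ (set_mem xA)) /(_ (set_mem xB)).
  - by move=> h2x h1x; rewrite -[leRHS]adde0 leeD.
  - by move=> h2x h1x; rewrite -[leRHS]add0e leeD.
  - by move=> h2x h1x; rewrite -[leRHS]add0e leeD.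
have [->|cNy] := eqVneq c +oo; first exact: leey.
have cfin : c \is a fin_num by rewrite ge0_fin_numE// ltey.
have sfin (h1 : {nnsfun T >-> R}) : sintegral mu h1 <= c -> sintegral mu h1 \is a fin_num.
  by move=> h1c; rewrite ge0_fin_numE ?sintegral_ge0// (le_lt_trans h1c)// ltey.
have z0 (D : set T) x : (nnsfun0 x)%:E <= (f \_ D) x :> \bar R.
  by rewrite /patch /=; case: ifP.
have keyA (h1 : {nnsfun T >-> R}) : (forall x, (h1 x)%:E <= (f \_ A) x) ->
    \int[mu]_(x in B) f x <= c - sintegral mu h1.
  move=> hA; rewrite ge0_integralE//; apply: ge_ereal_sup => _ [h2 /= hB <-].
  have hfin : sintegral mu h1 \is a fin_num.
    by apply: sfin; have := key h1 nnsfun0 hA (z0 B); rewrite sintegral0 adde0.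
  by rewrite (leeBrDr _ _ hfin) addeC; exact: key.
have fB : \int[mu]_(x in B) f x \is a fin_num.
  rewrite ge0_fin_numE ?integral_ge0//.
  have /le_lt_trans := keyA nnsfun0 (z0 A); apply.
  by rewrite sintegral0 sube0 ltey.
rewrite -leeBrDr// [leLHS]ge0_integralE//; apply: ge_ereal_sup => _ [h1 /= hA <-].
have hfin : sintegral mu h1 \is a fin_num.
  by apply: sfin; have := key h1 nnsfun0 hA (z0 B); rewrite sintegral0 adde0.
by rewrite (leeBrDr _ _ fB) addeC -(leeBrDr _ _ hfin); exact: keyA.
Qed.

End LowerIntegral.

Section LengthIntegral.
Context {R : realType}.
Local Notation mu := (@lebesgue_measure R).
Implicit Types (k f F : R -> R) (a b : R).
Local Open Scope ereal_scope.

Lemma lower_integral_step (k : R -> \bar R) a b : (forall x, 0 <= k x) -> (0 <= a)%R ->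
  (a < b)%R ->
  \int[mu]_(x in `[0%R, b]) k x = \int[mu]_(x in `[0%R, a]) k x + \int[mu]_(x in `]a, b[) k x.
Proof.
move=> k0 a0 ab.
have -> : `[0%R, b]%classic = `[0%R, a] `|` (`]a, b[ `|` [set b]) :> set R.
  apply/seteqP; split => [x|x] /=; rewrite !in_itv /=.
    move=> /andP[x0 xb]; have [xa|xa] := leP x a; first by left; rewrite x0.
    right; move: xb; rewrite le_eqVlt => /orP[/eqP|] xb; first by right.
    by left.
  case=> [/andP[x0 xa]|[/andP[ax xb]|->]].
  - by rewrite x0 (le_trans xa)// ltW.
  - by rewrite (ltW xb) andbT (le_trans a0)// ltW.
  - by rewrite lexx andbT (le_trans a0)// ltW.
rewrite lower_integral_setU//; last first.
- apply/disj_setPLR => x /=; rewrite !in_itv /= => /andP[x0 xa] [/andP[ax _]|xb].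
    by move: ax; rewrite ltNge xa.
  by move: ab; rewrite ltNge -xb xa.
- exact: measurableU.
rewrite lower_integral_setU//; last first.
  by apply/disj_setPLR => x /=; rewrite !in_itv /= => /andP[_ xb] xE; rewrite xE ltxx in xb.
by rewrite integral_set1 adde0.
Qed.

Let itv_measurable f a b : {within `[a, b], continuous f} -> measurable_fun `]a, b[ f.
Proof.
move=> cf; have m : measurable_fun `[a, b] f.
  by apply: subspace_continuous_measurable_fun; [exact: measurable_itv|exact: cf].
by apply: measurable_funS m; [exact: measurable_itv|exact: subset_itv_oo_cc].
Qed.

Let itv_FTC f F a b : (a < b)%R -> {within `[a, b], continuous f} ->
  {within `[a, b], continuous F} ->
  (forall x, (a < x < b)%R -> is_derive x 1%R F (f x)) ->
  \int[mu]_(x in `]a, b[) (f x)%:E = (F b - F a)%:E.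
Proof.
move=> ab cf cF dF; have := cF => /(continuous_within_itvP _ ab)[_ Fa Fb].
rewrite EFinB -(@continuous_FTC2 _ f F a b)//.
- rewrite -(@integral_itv_bndoo _ a b _ true false)//.
  by apply/measurable_EFinP; exact: itv_measurable.
- by split => // x; rewrite in_itv /= => /dF [].
by move=> x; rewrite in_itv /= => /dF dFx; rewrite derive1E derive_val.
Qed.

Lemma lower_integral_le_primitive k f F a b : (a < b)%R ->
  {within `[a, b], continuous f} -> {within `[a, b], continuous F} ->
  (forall x, (a < x < b)%R -> is_derive x 1%R F (f x)) ->
  (forall x, (a < x < b)%R -> (0 <= k x <= f x)%R) ->
  \int[mu]_(x in `]a, b[) (k x)%:E <= (F b - F a)%:E.
Proof.
move=> ab cf cF dF kf; rewrite -(itv_FTC ab cf cF dF).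
apply: lower_integral_le => x /=; rewrite in_itv /= => /kf /andP[k0 kx];
  by rewrite lee_fin.
Qed.

(** As f may be negative, it is its positive part that is compared with k. *)
Lemma primitive_le_lower_integral k f F a b : (a < b)%R ->
  {within `[a, b], continuous f} -> {within `[a, b], continuous F} ->
  (forall x, (a < x < b)%R -> is_derive x 1%R F (f x)) ->
  (forall x, (a < x < b)%R -> (0 <= k x)%R && (f x <= k x)%R) ->
  (F b - F a)%:E <= \int[mu]_(x in `]a, b[) (k x)%:E.
Proof.
move=> ab cf cF dF kf; rewrite -(itv_FTC ab cf cF dF).
have mf := itv_measurable cf.
rewrite integralE.
apply: (@le_trans _ _ (\int[mu]_(x in `]a, b[) (fun x => (f x)%:E)^\+ x)).
  rewrite leeBlDr// ?leeDl ?integral_ge0//.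
  have : mu.-integrable `]a, b[ (EFin \o f).
    have fi : mu.-integrable `[a, b] (EFin \o f).
      by apply: continuous_compact_integrable => //; exact: segment_compact.
    by apply: integrableS fi; [exact: measurable_itv|exact: measurable_itv|exact: subset_itv_oo_cc].
  by move/integrable_neg_fin_num; apply.
apply: lower_integral_le => x /=; first by move=> _; exact: funepos_ge0.
rewrite in_itv /= => /kf /andP[k0 kx].
by rewrite funeposE ge_max !lee_fin kx.
Qed.

End LengthIntegral.

(** * Lengths and distances *)

Lemma is_derive_affine_line {R : realType} {V : normedModType R} (k : R -> R)
    (k' : R) (a u : V) (t : R) : is_derive t 1 k k' ->
  is_derive t 1 (fun t => a + k t *: u) (k' *: u).
Proof.
move=> [dk <-]; have [dl dE] := differentiable_affine_line a u dk.
apply: DeriveDef; first exact: diff_derivable.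
by rewrite deriveE// dE mul1r derive1E.
Qed.

Section Length.
Context {R : realType} {d : nat}.
Local Notation Cd := 'rV[R[i]]_d.
Variable Omega : set Cd.
Implicit Types (x v z w : Cd) (c : R -> Cd).
Local Notation kob := (kobayashi_metric Omega).
Local Notation mu := (@lebesgue_measure R).

Lemma velocityE c (u : 'rV[R]_(d + d)) (t : R) :
  is_derive t 1 (toR \o c) u -> velocity c t = toC u.
Proof. by move=> h; rewrite /velocity derive1E derive_val. Qed.

Lemma within_continuous_sub (T : topologicalType) (f : R -> T) (a b a' b' : R) :
  a <= a' -> b' <= b -> {within `[a, b], continuous f} -> {within `[a', b'], continuous f}.
Proof.
move=> aa bb; apply: continuous_subspaceW => x /=; rewrite !in_itv /= => /andP[h1 h2].
by rewrite (le_trans aa h1) (le_trans h2 bb).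
Qed.

(** The source of all lower bounds: h will be a difference of cutoff logarithms of squared moduli of
    functionals along c. The proof is by induction on the break points, with the inequality up to
    the current one as invariant. *)
Lemma le_kobayashi_length c (h : R -> R) :
  piecewise_C1 (toR \o c) -> {within `[0, 1], continuous h} ->
  (forall (a b : R) (c' : R -> 'rV[R]_(d + d)), 0 <= a -> a < b -> b <= 1 -> {within `[a, b], continuous c'} ->
     (forall t, a < t < b -> is_derive t 1 (toR \o c) (c' t)) ->
     exists f : R -> R, {within `[a, b], continuous f} /\
       forall t, a < t < b -> is_derive t 1 h (f t) /\ f t <= kob (c t) (toC (c' t))) ->
  ((h 1 - h 0)%:E <= kobayashi_length Omega c)%E.
Proof.
move=> [cc [s [ps ls hs]]] ch key.
pose k t := kob (c t) (velocity c t).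
have k0 t : (0 <= (k t)%:E)%E by rewrite lee_fin; exact: kobayashi_metric_ge0.
pose J (b : R) := (\int[mu]_(t in `[0%R, b]) (k t)%:E)%E.
rewrite /kobayashi_length -/(J 1) -ls.
suff main (a : R) : 0 <= a -> ((h a - h 0)%:E <= J a)%E -> path <%R a s ->
    last a s <= 1 -> (forall i, (i < size s)%N ->
    C1_on (toR \o c) (nth 0 (a :: s) i) (nth 0 s i)) ->
    ((h (last a s) - h 0)%:E <= J (last a s))%E.
  apply: main => //; last by rewrite ls.
  by rewrite subrr /J; apply: integral_ge0 => t _; exact: k0.
elim: s a {ps ls hs} => [//|b s IHs] a a0 Ja /= /andP[ab pbs] lbs hs.
have b0 : 0 <= b by rewrite (le_trans a0)// ltW.
have b1 : b <= 1.
  apply: le_trans lbs; move: pbs; elim: (s) b {IHs ab hs b0} => //= b' s' IH b /andP[bb /IH].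
  by apply: le_trans; exact: ltW.
apply: IHs => //; last by move=> i si; exact: (hs i.+1).
have [c' [cc' dc]] := hs 0%N (ltn0Sn _); rewrite /= in cc' dc.
have [f [cf hf]] := key _ _ _ a0 ab b1 cc' dc.
rewrite /J (lower_integral_step k0 a0 ab).
have -> : h b - h 0 = (h a - h 0) + (h b - h a) by ring.
rewrite EFinD; apply: leeD; first exact: Ja.
apply: (@primitive_le_lower_integral _ k f) => //.
- exact: within_continuous_sub ch.
- by move=> t /hf[].
move=> t tab; rewrite kobayashi_metric_ge0 /= /k (velocityE (dc _ tab)).
by have [] := hf _ tab.
Qed.

Lemma kobayashi_metricZ_le x v (r B : R) : 0 < r -> kob x v <= B ->
  kob x (r%:C%C *: v) <= r * B.
Proof.
move=> r0 kB.
have r0c : r%:C%C != 0 :> R[i] by rewrite eq_complex /= eqxx andbT gt_eqF.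
have h w (s : R) : 0 < s -> forall xi : R[i],
    (exists f, [/\ holomorphic_disk Omega f, f 0 = x & 'd f 0 xi = w]) ->
    exists f, [/\ holomorphic_disk Omega f, f 0 = x & 'd f 0 (s%:C%C * xi) = s%:C%C *: w].
  move=> s0 xi [f [hf f0 fw]]; exists f; split => //.
  by rewrite diff_scale1 -scalerA -diff_scale1 fw.
have [[xi xiS]|no] := pselect (exists xi : R[i],
    exists f, [/\ holomorphic_disk Omega f, f 0 = x & 'd f 0 xi = v]).
  apply: le_trans (_ : r * kob x v <= _); last by rewrite ler_wpM2l// ltW.
  rewrite mulrC -ler_pdivrMr//; apply: lb_le_inf; first by exists (normc xi), xi.
  move=> _ [xi' /= hxi' <-]; rewrite ler_pdivrMr// mulrC.
  have [f [hf f0 fw]] := h _ _ r0 _ hxi'.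
  apply: le_trans (kobayashi_metric_le hf f0 fw) _.
  by rewrite normcM normc_real ger0_norm// ltW.
(* If no disk is tangent to v, the infimum is over the empty set, hence 0, for v and for its
   positive multiples alike. *)
have e0 (w : Cd) : (forall xi : R[i],
    ~ exists f, [/\ holomorphic_disk Omega f, f 0 = x & 'd f 0 xi = w]) -> kob x w = 0.
  move=> now; rewrite /kobayashi_metric (_ : [set _ | _ in _] = set0) ?inf0//.
  by apply/seteqP; split => // _ [xi /= hxi _]; exact: (now xi).
rewrite (e0 v) in kB; last by move=> xi hxi; apply: no; exists xi.
rewrite e0; first by rewrite mulr_ge0// ltW.
move=> xi hxi; apply: no; exists (r^-1%:C%C * xi).
have := h _ r^-1 _ _ hxi; rewrite scalerA -rmorphM /= mulVf ?gt_eqF// scale1r; apply.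
by rewrite invr_gt0.
Qed.

(* The metric along the segment is bounded by a continuous function phi with primitive
   Phi, so that its measurability plays no role. *)
Definition seg_bound z w (L : R) := exists Phi phi : R -> R,
  [/\ forall s : R, 0 <= s <= 1 -> {for s, continuous phi},
      forall s : R, 0 <= s <= 1 -> is_derive s 1 Phi (phi s),
      forall s : R, 0 <= s <= 1 -> Omega (z + s%:C%C *: (w - z)) /\
        kob (z + s%:C%C *: (w - z)) (w - z) <= phi s &
      Phi 1 - Phi 0 <= L].

Lemma seg_bound_sym z w L : seg_bound z w L -> seg_bound w z L.
Proof.
move=> [Phi [phi [cphi dPhi hk hL]]].
exists (fun s : R => - Phi (1 - s)), (fun s : R => phi (1 - s)); split.
- move=> s s01; apply: (@continuous_comp _ _ _ (fun s : R => 1 - s) phi); last by apply: cphi; lra.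
  by apply: continuousB; [exact: cvg_cst|exact: cvg_id].
- move=> s s01; have h : is_derive (1 - s) 1 Phi (phi (1 - s)) by apply: dPhi; lra.
  have h' : is_derive s 1 (fun s : R => 1 - s) (- 1).
    by apply: is_derive_eq; ring.
  have := @is_derive1_comp _ Phi (fun s : R => 1 - s) s _ _ h h' => hc.
  by apply: is_derive_eq; rewrite mulrN1 opprK.
- move=> s s01; have -> : w + s%:C%C *: (z - w) = z + (1 - s)%:C%C *: (w - z).
    by rewrite rmorphB rmorph1 scalerBl scale1r addrA (addrC z) subrK -scalerN opprB.
  have [|h1 h2] := hk (1 - s); first by lra.
  by split => //; rewrite -[z - w]opprB kobayashi_metricN.
by rewrite subrr subr0 opprK addrC.
Qed.


(* The vertices z 0, z 1, z 2, z 3 of a polygonal path are reached at the times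
   0, 1/3, 2/3, 1. *)
Let clamp (x : R) : R := Num.min 1 (Num.max 0 x).

Let polygon (z : nat -> Cd) (t : R) : Cd :=
  z 0%N + (clamp (3 * t))%:C%C *: (z 1%N - z 0%N) +
  (clamp (3 * t - 1))%:C%C *: (z 2%N - z 1%N) + (clamp (3 * t - 2))%:C%C *: (z 3%N - z 2%N).

Let clamp_continuous (a b : R) : continuous (fun t => clamp (a * t - b)).
Proof.
have h : continuous (fun t : R => a * t - b).
  move=> t; apply: continuousB; last exact: cvg_cst.
  by apply: continuousM; [exact: cvg_cst|exact: cvg_id].
move=> t; apply: (@continuous_min _ _ (fun=> 1) (fun t => Num.max 0 (a * t - b))).
  exact: cvg_cst.
by apply: (@continuous_max _ _ (fun=> 0) (fun t => a * t - b)); [exact: cvg_cst|exact: h].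
Qed.

Let clamp0 (x : R) : x <= 0 -> clamp x = 0.
Proof. by move=> x0; rewrite /clamp max_l// min_r. Qed.

Let clamp1 (x : R) : 1 <= x -> clamp x = 1.
Proof. by move=> x1; rewrite /clamp max_r ?(le_trans ler01)// min_l. Qed.

Let clampid (x : R) : 0 <= x <= 1 -> clamp x = x.
Proof. by move=> /andP[x0 x1]; rewrite /clamp max_r// min_r. Qed.

Let polygonE (z : nat -> Cd) (i : nat) (t : R) : (i < 3)%N -> i%:R <= 3 * t <= i.+1%:R ->
  polygon z t = z i + (3 * t - i%:R)%:C%C *: (z i.+1 - z i).
Proof.
rewrite /polygon; case: i => [|[|[|i]]] hi /andP[h1 h2]; last by exfalso; rewrite !ltnS ltn0 in hi.
- rewrite [clamp (3 * t)]clampid; last by rewrite h1 h2.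
  by rewrite !clamp0; [rewrite !scale0r !addr0 subr0|lra|lra].
- rewrite [clamp (3 * t)]clamp1; last by lra.
  rewrite [clamp (3 * t - 1)]clampid; last by lra.
  by rewrite clamp0; [rewrite scale0r addr0 scale1r [z 0%N + _]addrC subrK|lra].
- rewrite [clamp (3 * t)]clamp1; last by lra.
  rewrite [clamp (3 * t - 1)]clamp1; last by lra.
  rewrite [clamp (3 * t - 2)]clampid; last by lra.
  by rewrite !scale1r [z 0%N + _]addrC subrK [z 1%N + _]addrC subrK.
Qed.

Let polygon_derive (z : nat -> Cd) (i : nat) (t : R) : (i < 3)%N -> i%:R < 3 * t < i.+1%:R ->
  is_derive t 1 (toR \o polygon z) (3 *: toR (z i.+1 - z i)).
Proof.
move=> i3 /andP[h1 h2].
pose g (t : R) := toR (z i) + (3 * t - i%:R) *: toR (z i.+1 - z i).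
have hg : is_derive t 1 g (3 *: toR (z i.+1 - z i)).
  apply: (@is_derive_affine_line _ _ (fun t : R => 3 * t - i%:R)).
  by apply: is_derive_eq; rewrite /GRing.scale /=; ring.
apply: (near_eq_is_derive _ hg).
pose e := Num.min (t - i%:R / 3) (i.+1%:R / 3 - t).
have e0 : 0 < e by rewrite lt_min !subr_gt0 ltr_pdivrMr// ltr_pdivlMr// ![t * _]mulrC h1 h2.
apply/nbhs_ballP; exists e => //= t'; rewrite -ball_normE /= lt_min !ltr_norml.
move=> /andP[/andP[k1 k2] /andP[k3 k4]].
rewrite /g /= (@polygonE z i)//; first by rewrite [RHS]toRD toRZ.
by apply/andP; split; lra.
Qed.

Let polygon_continuous (z : nat -> Cd) : continuous (toR \o polygon z).
Proof.
pose f (b : R) (u : 'rV[R]_(d + d)) (t : R) := clamp (3 * t - b) *: u.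
have fc (b : R) (u : 'rV[R]_(d + d)) : continuous (f b u).
  move=> t; apply: (@continuous_comp _ _ _ (fun t : R => clamp (3 * t - b)) ( *:%R^~ u)).
    exact: clamp_continuous.
  exact: scalel_continuous.
have -> : toR \o polygon z = cst (toR (z 0%N)) + f 0 (toR (z 1%N - z 0%N))
    + f 1 (toR (z 2%N - z 1%N)) + f 2 (toR (z 3%N - z 2%N)).
  by apply/funext => t /=; rewrite /polygon /f !fctE !(toRD, toRZ) subr0.
move=> t; apply: continuousD; last exact: fc.
apply: continuousD; last exact: fc.
by apply: continuousD; [exact: cvg_cst|exact: fc].
Qed.

(** Three legs suffice everywhere: away from the boundary, across, and to the target. Each leg is
    run at speed 3, which the change of variable takes back by homogeneity of the metric. *)
Lemma polygon_length_le (z : nat -> Cd) (L : nat -> R) :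
  (forall i, (i < 3)%N -> seg_bound (z i) (z i.+1) (L i)) ->
  exists2 c, curve_between Omega (z 0%N) (z 3%N) c &
    (kobayashi_length Omega c <= (L 0%N + L 1%N + L 2%N)%:E)%E.
Proof.
move=> hL; exists (polygon z).
  split.
  - split; first exact/continuous_subspaceT/polygon_continuous.
    exists [:: 1 / 3; 2 / 3; 1]; split => //=; first by apply/and3P; split => //; lra.
    move=> i i3; exists (fun=> 3 *: toR (z i.+1 - z i)); split.
      by apply: continuous_subspaceT => t; exact: cvg_cst.
    move=> t ht; apply: polygon_derive => //.
    by case: i i3 ht => [|[|[|//]]] _ /= ht; lra.
  - move=> t t01.
    have [i i3 hi] : exists2 i, (i < 3)%N & i%:R <= 3 * t <= i.+1%:R.
      have [h1|h1] := leP (3 * t) 1; first by exists 0%N => //; lra.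
      have [h2|h2] := leP (3 * t) 2; first by exists 1%N => //; lra.
      by exists 2%N => //; lra.
    have [Phi [phi [_ _ hO _]]] := hL _ i3.
    rewrite (polygonE z i3 hi); apply: (hO _ _).1; move: hi.
    by have e : i.+1%:R = i%:R + 1 :> R := esym (natr1 _); rewrite e; lra.
  - by rewrite (@polygonE z 0%N)//; [rewrite mulr0 subr0 scale0r addr0|rewrite mulr0; lra].
  by rewrite (@polygonE z 2%N)//; [rewrite mulr1 (_ : 3 - 2%:R = 1)
    ?scale1r ?[z 2%N + _]addrC ?subrK//; ring|lra].
pose k t := kob (polygon z t) (velocity (polygon z) t).
have k0 t : (0 <= (k t)%:E)%E by rewrite lee_fin; exact: kobayashi_metric_ge0.
rewrite /kobayashi_length -/(k _).
have step (i : nat) : (i < 3)%N ->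
    (\int[mu]_(t in `[0%R, (i.+1%:R / 3)%R]) (k t)%:E <=
     \int[mu]_(t in `[0%R, (i%:R / 3)%R]) (k t)%:E + (L i)%:E)%E.
  move=> i3; have i0 : 0 <= i%:R / 3 :> R by rewrite divr_ge0.
  have ii : i%:R / 3 < i.+1%:R / 3 :> R by rewrite ltr_pM2r ?invr_gt0// ltr_nat.
  rewrite (lower_integral_step k0 i0 ii); apply: leeD; first exact: lexx.
  have [Phi [phi [cphi dPhi hk hLi]]] := hL _ i3.
  have h01 (t : R) : i%:R / 3 <= t <= i.+1%:R / 3 -> 0 <= 3 * t - i%:R <= 1.
    by have e : i.+1%:R = i%:R + 1 :> R := esym (natr1 _); rewrite e; lra.
  have daff (t : R) : is_derive t 1 (fun t : R => 3 * t - i%:R) 3.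
    by apply: is_derive_eq; rewrite /GRing.scale /=; ring.
  have dF (t : R) : i%:R / 3 <= t <= i.+1%:R / 3 ->
      is_derive t 1 (fun t : R => Phi (3 * t - i%:R)) (3 * phi (3 * t - i%:R)).
    move=> ht; have h := dPhi _ (h01 _ ht).
    have h' := @is_derive1_comp _ Phi (fun t : R => 3 * t - i%:R) t _ _ h (daff t).
    by apply: is_derive_eq; rewrite mulrC.
  apply: le_trans (@lower_integral_le_primitive _ k (fun t => 3 * phi (3 * t - i%:R))
    (fun t => Phi (3 * t - i%:R)) _ _ ii _ _ _ _) _.
  - apply: continuous_in_subspaceT => t; rewrite inE /= in_itv /= => ht.
    apply: (@continuousM _ _ (fun=> 3) (fun t : R => phi (3 * t - i%:R))); first exact: cvg_cst.
    apply: (@continuous_comp _ _ _ (fun t : R => 3 * t - i%:R) phi).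
      apply: continuousB; last exact: cvg_cst.
      by apply: continuousM; [exact: cvg_cst|exact: cvg_id].
    exact/cphi/h01.
  - exact: derive_within_continuous dF.
  - by move=> t ht; apply: dF; lra.
  - move=> t ht; rewrite kobayashi_metric_ge0 /= /k.
    have ht3 : i%:R < 3 * t < i.+1%:R by lra.
    rewrite (velocityE (polygon_derive z i3 ht3)) toCZ toRK.
    rewrite (@polygonE z i)//; last by lra.
    by apply: kobayashi_metricZ_le => //; apply: (hk _ _).2; apply: h01; lra.
  rewrite lee_fin; apply: le_trans hLi.
  have e : i.+1%:R = i%:R + 1 :> R := esym (natr1 _).
  by rewrite le_eqVlt e; apply/orP; left; apply/eqP; congr (Phi _ - Phi _); field.
have := step 2%N isT; have := step 1%N isT; have := step 0%N isT.
rewrite divff// mul0r set_itv1 integral_set1 add0e => s0 s1 s2.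
apply: le_trans s2 _; rewrite !EFinD; apply: leeD; last exact: lexx.
by apply: le_trans s1 _; apply: leeD; last exact: lexx.
Qed.

End Length.

(** * Cutoff logarithms *)

Section Cutoff.
Context {R : realType}.
Implicit Types (x h s a : R).

(** Squaring the positive part makes it C^1, so that the cutoff logarithm has a continuous
    derivative. *)
Let sqpos x : R := Num.max 0 x ^+ 2.

Let sqpos_taylor x h : `|sqpos (x + h) - sqpos x - 2 * Num.max 0 x * h| <= h ^+ 2.
Proof.
rewrite /sqpos; have [x0|x0] := leP 0 x; have [xh0|xh0] := leP 0 (x + h);
  by rewrite ler_norml; apply/andP; split; nra.
Qed.

Let is_derive_sqpos x : is_derive x 1 sqpos (2 * Num.max 0 x).
Proof.
have key : h^-1 *: (sqpos (h *: 1 + x) - sqpos x) @[h --> 0^'] --> 2 * Num.max 0 x.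
  apply/cvgrPdist_le => e e0; apply/nbhs_ballP; exists e => // h.
  rewrite -ball_normE /= sub0r normrN => he h0.
  have h0' : 0 < `|h| by rewrite normr_gt0.
  rewrite [h *: 1]mulr1 /GRing.scale /= [h + x]addrC -normrN opprB.
  have -> : h^-1 * (sqpos (x + h) - sqpos x) - 2 * Num.max 0 x =
     h^-1 * (sqpos (x + h) - sqpos x - 2 * Num.max 0 x * h) by field.
  rewrite normrM normfV ler_pdivrMl//; apply: le_trans (sqpos_taylor _ _) _.
  by rewrite -real_normK ?num_real// expr2 ler_wpM2l ?(ltW h0')// ltW.
by apply: DeriveDef; [apply/cvg_ex; exists (2 * Num.max 0 x)|exact: cvg_lim key].
Qed.

(* A C^1 function behaving like ln s near 0, constant for s >= a, and with
   s * cutoff' s <= 1. *)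
Definition cutoff a s : R := ln (1 - sqpos (1 - s / a)).

Definition cutoff' a s : R :=
  2 * Num.max 0 (1 - s / a) / (a * (1 - Num.max 0 (1 - s / a) ^+ 2)).

Let cutoff_den a s : 0 < a -> 0 < s -> 0 < 1 - Num.max 0 (1 - s / a) ^+ 2.
Proof.
move=> a0 s0; have sa : 0 < s / a by rewrite divr_gt0.
by have [h|h] := leP 0 (1 - s / a); nra.
Qed.

Lemma is_derive_cutoff a s : 0 < a -> 0 < s -> is_derive s 1 (cutoff a) (cutoff' a s).
Proof.
move=> a0 s0; have den := cutoff_den a0 s0.
have h1 : is_derive s 1 (fun s => 1 - s / a) (- a^-1).
  by apply: is_derive_eq; rewrite /GRing.scale /=; ring.
have h2 := @is_derive1_comp _ sqpos (fun s => 1 - s / a) s _ _ (is_derive_sqpos _) h1.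
have h3 : is_derive s 1 (fun s => 1 - sqpos (1 - s / a))
    (2 * Num.max 0 (1 - s / a) / a).
  by apply: is_derive_eq; rewrite /=; ring.
have h4 := @is_derive1_comp _ (@ln R) (fun s => 1 - sqpos (1 - s / a)) s _ _
  (is_derive1_ln den) h3.
apply: is_derive_eq; rewrite /cutoff' /sqpos; field.
by rewrite !gt_eqF.
Qed.

Lemma cutoff'_continuous a s : 0 < a -> 0 < s -> {for s, continuous (cutoff' a)}.
Proof.
move=> a0 s0; have den := cutoff_den a0 s0.
have c1 : {for s, continuous (fun s => Num.max 0 (1 - s / a))}.
  apply: (@continuous_max _ _ (fun=> 0) (fun s => 1 - s / a)); first exact: cvg_cst.
  apply: continuousB; first exact: cvg_cst.
  by apply: continuousM; [exact: cvg_id|exact: cvg_cst].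
apply: (@continuousM _ _ (fun s => 2 * Num.max 0 (1 - s / a))
  (fun s => (a * (1 - Num.max 0 (1 - s / a) ^+ 2))^-1)).
  by apply: continuousM; [exact: cvg_cst|exact: c1].
apply: (@continuousV _ _ (fun s => a * (1 - Num.max 0 (1 - s / a) ^+ 2))).
  by rewrite mulf_neq0 ?gt_eqF.
apply: continuousM; first exact: cvg_cst.
apply: continuousB; first exact: cvg_cst.
by apply: (@continuousM _ _ (fun s => Num.max 0 (1 - s / a))); exact: c1.
Qed.

Lemma cutoff_ge a s : 0 < a -> a <= s -> cutoff a s = 0.
Proof.
move=> a0 as_; rewrite /cutoff /sqpos max_l ?expr0n ?subr0 ?ln1//.
by rewrite subr_le0 ler_pdivlMr// mul1r.
Qed.

Lemma cutoff'_ge a s : 0 < a -> a <= s -> cutoff' a s = 0.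
Proof.
move=> a0 as_; rewrite /cutoff' max_l ?mulr0 ?mul0r//.
by rewrite subr_le0 ler_pdivlMr// mul1r.
Qed.

(** With u = s / a < 1 one has 1 - (1 - u)^2 = u (2 - u), so that s times the derivative is 2 (1 -
    u) / (2 - u) <= 1. *)
Lemma cutoff'_bound a s : 0 < a -> 0 < s -> 0 <= cutoff' a s /\ s * cutoff' a s <= 1.
Proof.
move=> a0 s0; have den := cutoff_den a0 s0.
have M0 : 0 <= Num.max 0 (1 - s / a) by rewrite le_max lexx.
split.
  by apply: divr_ge0; [exact: mulr_ge0|exact/mulr_ge0/ltW/den/ltW].
rewrite /cutoff' mulrA ler_pdivrMr ?mulr_gt0// mul1r.
have [h|h] := leP 0 (1 - s / a); last by rewrite mulr0 mulr0 expr0n subr0 mulr1 ltW.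
have -> : s = s / a * a by rewrite divfK ?gt_eqF.
set u := s / a; have u0 : 0 < u by rewrite divr_gt0.
have -> : u * a / a = u by field; rewrite gt_eqF.
rewrite -subr_ge0; have -> : a * (1 - (1 - u) ^+ 2) - u * a * (2 * (1 - u)) = a * u ^+ 2 by ring.
by rewrite mulr_ge0 ?exprn_ge0// ltW.
Qed.

Lemma cutoff_le a s : 0 < a -> 0 < s -> cutoff a s <= ln (2 * s / a).
Proof.
move=> a0 s0; have den := cutoff_den a0 s0; rewrite /cutoff ler_ln ?posrE ?divr_gt0 ?mulr_gt0//.
rewrite /sqpos; have := divr_gt0 s0 a0; rewrite -mulrA; move: (s / a) => u u0.
by have [h|h] := leP 0 (1 - u); nra.
Qed.

End Cutoff.

Lemma rlinear_continuous {R : realType} {n : nat} (A : 'rV[R]_n -> R) :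
  rlinear A -> continuous A.
Proof.
move=> rA u; have [K K0 AK] := rlinear_bound rA; have [AD AZ] := rA.
have K1 : 0 < K + 1 by rewrite ltr_wpDl.
apply/(@cvgrPdist_le _ _ _ _ (nbhs_filter u)) => e e0.
apply/nbhs_ballP; exists (e / (K + 1)); first by rewrite /= divr_gt0.
move=> v; rewrite -ball_normE /= => /ltW uv.
have -> : A u - A v = A (u - v) by rewrite AD -[- v]scaleN1r AZ mulN1r.
apply: le_trans (AK _) _; apply: le_trans (ler_wpM2l K0 uv) _.
rewrite mulrCA ler_piMr ?(ltW e0)// ler_pdivrMr// mul1r; lra.
Qed.

Lemma is_derive_rlinear {R : realType} {n : nat} (A : 'rV[R]_n -> R)
    (c : R -> 'rV[R]_n) (v : 'rV[R]_n) (t : R) :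
  rlinear A -> is_derive t 1 c v -> is_derive t 1 (A \o c) (A v).
Proof.
move=> rA [dc cv]; have [AD AZ] := rA.
have AB u w : A (u - w) = A u - A w by rewrite AD -[- w]scaleN1r AZ mulN1r.
have key : h^-1 *: ((A \o c) (h *: 1 + t) - (A \o c) t) @[h --> 0^'] --> A v.
  have -> : (fun h => h^-1 *: ((A \o c) (h *: 1 + t) - (A \o c) t)) =
      A \o (fun h => h^-1 *: (c (h *: 1 + t) - c t)).
    by apply/funext => h /=; rewrite AZ AB.
  apply: continuous_cvg; first exact: rlinear_continuous.
  by rewrite -cv; exact: dc.
by apply: DeriveDef; [apply/cvg_ex; exists (A v)|exact: cvg_lim key].
Qed.

Lemma continuous_addr {R : realType} {T : topologicalType} (f : T -> R) (x : R) :
  continuous f -> continuous (fun t => f t + x).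
Proof. by move=> cf t; exact: cvgD (cf t) (cvg_cst _). Qed.

Lemma continuous_sqrD {R : realType} {T : topologicalType} (f g : T -> R) :
  continuous f -> continuous g -> continuous (fun t => f t ^+ 2 + g t ^+ 2).
Proof.
move=> cf cg.
have -> : (fun t => f t ^+ 2 + g t ^+ 2) = fun t => f t * f t + g t * g t.
  by apply/funext => t; rewrite !expr2.
by move=> t; exact: cvgD (cvgM (cf t) (cf t)) (cvgM (cg t) (cg t)).
Qed.

Section WithinContinuous.
Context {R : realType}.
Implicit Types (A : set R) (f g : R -> R).

Lemma within_continuousD A f g : {within A, continuous f} -> {within A, continuous g} ->
  {within A, continuous (fun t => f t + g t)}.
Proof. by move=> cf cg t; exact: cvgD (cf t) (cg t). Qed.

Lemma within_continuousM A f g : {within A, continuous f} -> {within A, continuous g} ->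
  {within A, continuous (fun t => f t * g t)}.
Proof. by move=> cf cg t; exact: cvgM (cf t) (cg t). Qed.

Lemma within_continuous_cst A (x : R) : {within A, continuous (fun=> x)}.
Proof. by move=> t; exact: cvg_cst. Qed.

Lemma within_continuous_comp A (T U : topologicalType) (h : T -> U) (f : R -> T) :
  {within A, continuous f} -> (forall t, A t -> {for f t, continuous h}) ->
  {within A, continuous (h \o f)}.
Proof.
move=> cf ch; apply/subspace_continuousP => t At.
apply: continuous_cvg; first exact: ch.
by move/subspace_continuousP : cf; apply.
Qed.

End WithinContinuous.

(** * Bounds for the Kobayashi distance of a convex domain *)

Section KobayashiDistance.
Context {R : realType} {d : nat}.
Local Notation Cd := 'rV[R[i]]_d.
Variable Omega : set Cd.
Implicit Types (z w : Cd) (l : Cd -> R[i]) (k : R[i]) (a : R).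
Local Notation kob := (kobayashi_metric Omega).

(** The square is a polynomial in the real coordinates; the factor 4^-1 in front of its logarithm
    below stands for 1/2 times the logarithm of the modulus. *)
Definition sqmod l k z : R := normc (l z + k) ^+ 2.

Lemma clinear_Re l (K : R) : clinear l K -> rlinear (fun u => Re (l (toC u))).
Proof.
move=> [lD lZ _ _]; split => [u v|r u]; first by rewrite toCD lD ReDc.
by rewrite toCZ lZ ReMc /= mul0r subr0.
Qed.

Lemma clinear_Im l (K : R) : clinear l K -> rlinear (fun u => Im (l (toC u))).
Proof.
move=> [lD lZ _ _]; split => [u v|r u]; first by rewrite toCD lD ImDc.
by rewrite toCZ lZ ImMc /= mul0r addr0.
Qed.

Let sqmodE l k z : sqmod l k z =
  (Re (l (toC (toR z))) + Re k) ^+ 2 + (Im (l (toC (toR z))) + Im k) ^+ 2.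
Proof. by rewrite toRK /sqmod normc_sqrE ReDc ImDc. Qed.

Lemma sqmod_continuous l (K : R) k : clinear l K -> continuous (sqmod l k \o toC).
Proof.
move=> lK; have -> : sqmod l k \o toC = fun u =>
    (Re (l (toC u)) + Re k) ^+ 2 + (Im (l (toC u)) + Im k) ^+ 2.
  by apply/funext => u /=; rewrite sqmodE toCK.
apply: continuous_sqrD; apply: continuous_addr; apply: rlinear_continuous.
  exact: clinear_Re lK.
exact: clinear_Im lK.
Qed.

Lemma sqmod_curve l (K : R) k (c : R -> Cd) (c' : R -> 'rV[R]_(d + d)) (a b : R) :
  clinear l K ->
  {within `[a, b], continuous (toR \o c)} -> {within `[a, b], continuous c'} ->
  (forall t, a < t < b -> is_derive t 1 (toR \o c) (c' t)) ->
  {within `[a, b], continuous (fun t => sqmod l k (c t))} /\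
  exists s', [/\ {within `[a, b], continuous s'},
    forall t, a < t < b -> is_derive t 1 (fun t => sqmod l k (c t)) (s' t) &
    forall t, `|s' t| <= 2 * normc (l (c t) + k) * normc (l (toC (c' t)))].
Proof.
move=> lK cc cc' dc; have rlR := clinear_Re lK; have rlI := clinear_Im lK.
pose P (u : 'rV[R]_(d + d)) := Re (l (toC u)) + Re k.
pose Q (u : 'rV[R]_(d + d)) := Im (l (toC u)) + Im k.
have cP : continuous P.
  by apply: continuous_addr; exact: rlinear_continuous rlR.
have cQ : continuous Q.
  by apply: continuous_addr; exact: rlinear_continuous rlI.
have wc (S : 'rV[R]_(d + d) -> R) (g : R -> 'rV[R]_(d + d)) :
    continuous S -> {within `[a, b], continuous g} -> {within `[a, b], continuous (S \o g)}.
  by move=> cS cg; apply: within_continuous_comp => // t _; exact: cS.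
have sE : (fun t => sqmod l k (c t)) =
    (fun t => (P \o (toR \o c)) t * (P \o (toR \o c)) t + (Q \o (toR \o c)) t * (Q \o (toR \o c)) t).
  by apply/funext => t; rewrite sqmodE /P /Q /= !expr2.
split.
  have -> : (fun t => sqmod l k (c t)) = (sqmod l k \o toC) \o (toR \o c).
    by apply/funext => t /=; rewrite toRK.
  by apply: wc => //; exact: sqmod_continuous lK.
exists (fun t => 2 * ((P \o (toR \o c)) t * ((fun u => Re (l (toC u))) \o c') t
   + (Q \o (toR \o c)) t * ((fun u => Im (l (toC u))) \o c') t)); split.
- apply: within_continuousM; first exact: within_continuous_cst.
  apply: within_continuousD; apply: within_continuousM;
    by [exact: wc|apply: wc => //; exact: rlinear_continuous].
- move=> t tab; have dt := dc _ tab.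
  have d1 := is_derive_rlinear rlR dt; have d2 := is_derive_rlinear rlI dt.
  have d1' : is_derive t 1 (P \o (toR \o c)) (Re (l (toC (c' t)))).
    rewrite -[Re _]addr0; exact: is_deriveD.
  have d2' : is_derive t 1 (Q \o (toR \o c)) (Im (l (toC (c' t)))).
    rewrite -[Im _]addr0; exact: is_deriveD.
  by rewrite sE; apply: is_derive_eq; rewrite /GRing.scale /=; ring.
move=> t; rewrite /P /Q /= toRK.
set u := l (c t) + k; set v := l (toC (c' t)).
rewrite -ReDc -ImDc -/u.
have -> : Re u * Re v + Im u * Im v = Re (u * conjc v).
  by rewrite ReMc; case: (v) => v1 v2 /=; ring.
rewrite normrM ger0_norm// -mulrA ler_wpM2l//.
apply: le_trans (normc_Re _) _; rewrite normcM.
have -> // : normc (conjc v) = normc v.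
by case: (v) => v1 v2 /=; rewrite sqrrN.
Qed.

(** With s = |L|^2, |s'| <= 2 |L| |dL| and s * cutoff' s <= 1 give a derivative of at most |dL| / (2
    |L|) in modulus, and |L| >= Re L places this below the metric. *)
Let cutoff_curve l (K : R) k (c : R -> Cd) (c' : R -> 'rV[R]_(d + d)) (a b m : R) :
  0 < m -> open Omega -> clinear l K -> (forall z, Omega z -> 0 < Re (l z + k)) ->
  a < b -> (forall t, a <= t <= b -> Omega (c t)) ->
  {within `[a, b], continuous (toR \o c)} -> {within `[a, b], continuous c'} ->
  (forall t, a < t < b -> is_derive t 1 (toR \o c) (c' t)) ->
  exists f : R -> R, [/\ {within `[a, b], continuous f},
    forall t, a < t < b -> is_derive t 1 (fun t => 4^-1 * cutoff m (sqmod l k (c t))) (f t),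
    forall t, a < t < b -> `|f t| <= kob (c t) (toC (c' t)) &
    forall t, a < t < b -> m <= sqmod l k (c t) -> f t = 0].
Proof.
move=> m0 oO lK lpos ab Oc cc cc' dc.
have [cs [s' [cs' ds' bs']]] := sqmod_curve k lK cc cc' dc.
have s0 t : a <= t <= b -> 0 < sqmod l k (c t).
  move=> /Oc /lpos h; rewrite exprn_gt0// (lt_le_trans h)//.
  by rewrite (le_trans (ler_norm _))// normc_Re.
exists (fun t => 4^-1 * (cutoff' m (sqmod l k (c t)) * s' t)); split.
- apply: within_continuousM; first exact: within_continuous_cst.
  apply: within_continuousM => //.
  apply: (within_continuous_comp (h := cutoff' m) (f := fun t => sqmod l k (c t))) => // t.
  by rewrite /= in_itv /= => /s0; exact: cutoff'_continuous.
- move=> t tab; have tab' : a <= t <= b by lra.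
  have h := @is_derive1_comp _ (cutoff m) (fun t => sqmod l k (c t)) t _ _
    (is_derive_cutoff m0 (s0 _ tab')) (ds' _ tab).
  by apply: is_derive_eq.
- move=> t tab; have tab' : a <= t <= b by lra.
  have [e0 e1] := cutoff'_bound m0 (s0 _ tab').
  have Lp := lpos _ (Oc _ tab').
  have Ln : Re (l (c t) + k) <= normc (l (c t) + k).
    by rewrite (le_trans (ler_norm _))// normc_Re.
  have N0 : 0 < normc (l (c t) + k) by exact: lt_le_trans Ln.
  apply: le_trans (kobayashi_metric_ge (toC (c' t)) oO lK (fun z Oz => ltW (lpos z Oz)) (Oc _ tab') Lp).
  rewrite normrM [X in _ * X <= _]normrM (ger0_norm e0) ger0_norm ?invr_ge0//.
  apply: le_trans (_ : normc (l (toC (c' t))) / (2 * normc (l (c t) + k)) <= _); last first.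
    by rewrite ler_wpM2l ?normc_ge0// lef_pV2 ?posrE ?mulr_gt0// ler_pM2l.
  rewrite ler_pdivlMr ?mulr_gt0//.
  apply: le_trans (_ : 4^-1 * (cutoff' m (sqmod l k (c t)) *
     (2 * normc (l (c t) + k) * normc (l (toC (c' t))))) * (2 * normc (l (c t) + k)) <= _).
    apply: ler_wpM2r; first by rewrite mulr_ge0// ltW.
    by rewrite ler_pM2l ?invr_gt0// ler_wpM2l.
  rewrite [leLHS](_ : _ = (sqmod l k (c t) * cutoff' m (sqmod l k (c t))) *
     normc (l (toC (c' t)))); last by rewrite {2}/sqmod; field.
  by rewrite ler_piMl ?normc_ge0.
by move=> t tab mt; rewrite cutoff'_ge// mul0r mulr0.
Qed.

Lemma nrm_segment_ball z w (r : R) : convex_set Omega ->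
  (forall z', nrm (z' - z) < r -> Omega z') -> (forall w', nrm (w' - w) < r -> Omega w') ->
  forall (s : R) u, 0 <= s <= 1 -> nrm (u - (z + s%:C%C *: (w - z))) < r -> Omega u.
Proof.
move=> cO Oz Ow s u s01 hu; set h := u - _ in hu.
have -> : u = (z + h) + s%:C%C *: ((w + h) - (z + h)).
  by rewrite /h; apply/rowP => j; rewrite !mxE; ring.
by apply: convex_segment => //; [apply: Oz|apply: Ow]; rewrite addrAC subrr add0r.
Qed.

Lemma seg_bound_ball z w (r : R) : convex_set Omega -> 0 < r ->
  (forall z', nrm (z' - z) < r -> Omega z') -> (forall w', nrm (w' - w) < r -> Omega w') ->
  seg_bound Omega z w (2 * nrm (w - z) / r).
Proof.
move=> cO r0 Oz Ow; set L := 2 * _ / r.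
exists (fun s => L * s), (fun=> L); split.
- by move=> s _; exact: cvg_cst.
- by move=> s _; apply: is_derive_eq; rewrite /GRing.scale /= ?mulr1 ?mul0r ?addr0; ring.
- move=> s s01.
  have hO u := @nrm_segment_ball z w r cO Oz Ow s u s01.
  by split; [apply: hO; rewrite subrr nrm0|exact: kobayashi_metric_ball].
by rewrite mulr1 mulr0 subr0.
Qed.

Lemma seg_bound_refl z : open Omega -> convex_set Omega -> Omega z -> seg_bound Omega z z 0.
Proof.
move=> oO cO Oz.
have [r r0 zr] : exists2 r : R, 0 < r & forall w, nrm (w - z) < r -> Omega w.
  by apply/nbhs_nrm; exact: open_nbhs_nbhs.
by have := seg_bound_ball cO r0 zr zr; rewrite subrr nrm0 mulr0 mul0r.
Qed.

Lemma seg_bound_exists z w : open Omega -> convex_set Omega -> Omega z -> Omega w ->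
  exists L, seg_bound Omega z w L.
Proof.
move=> oO cO Oz Ow.
have nb u : Omega u -> exists2 r : R, 0 < r & forall w, nrm (w - u) < r -> Omega w.
  by move=> Ou; apply/nbhs_nrm; exact: open_nbhs_nbhs.
have [r r0 zr] := nb _ Oz; have [r' r'0 wr] := nb _ Ow.
exists (2 * nrm (w - z) / Num.min r r'); apply: seg_bound_ball => //.
- by rewrite lt_min r0.
- by move=> u; rewrite lt_min => /andP[? _]; exact: zr.
- by move=> u; rewrite lt_min => /andP[_ ?]; exact: wr.
Qed.

Let length_ge0 c : (0 <= kobayashi_length Omega c)%E.
Proof. by apply: integral_ge0 => t _; rewrite lee_fin; exact: kobayashi_metric_ge0. Qed.

Lemma kobayashi_dist_le (z : nat -> Cd) (L : nat -> R) :
  (forall i, (i < 3)%N -> seg_bound Omega (z i) (z i.+1) (L i)) ->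
  kobayashi_dist Omega (z 0%N) (z 3%N) <= L 0%N + L 1%N + L 2%N.
Proof.
move=> hL; have [c cc cL] := polygon_length_le hL.
rewrite -lee_fin /kobayashi_dist fineK; last first.
  rewrite ge0_fin_numE; last by apply: le_ereal_inf_tmp => _ [c' _ <-]; exact: length_ge0.
  by apply: le_lt_trans (ltry (L 0%N + L 1%N + L 2%N)); apply: le_trans cL;
    apply: ereal_inf_lbound; exists c.
by apply: le_trans cL; apply: ereal_inf_lbound; exists c.
Qed.

(** [fine] sends +oo to 0, so a bound on all lengths passes to the distance only once some curve of
    finite length is exhibited: here a segment followed by two degenerate legs. *)
Lemma le_kobayashi_dist z w (B : R) : open Omega -> convex_set Omega -> Omega z -> Omega w ->
  (forall c, curve_between Omega z w c -> (B%:E <= kobayashi_length Omega c)%E) ->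
  B <= kobayashi_dist Omega z w.
Proof.
move=> oO cO Oz Ow hB; have [L hL] := seg_bound_exists oO cO Oz Ow.
pose v i := if i is 0%N then z else w; pose M i := if i is 0%N then L else 0 : R.
have [|c cc cL] := @polygon_length_le _ _ Omega v M.
  by move=> [|i] _ //=; exact: seg_bound_refl.
rewrite -lee_fin /kobayashi_dist fineK.
  by apply: le_ereal_inf_tmp => _ [c' hc' <-]; exact: hB.
rewrite ge0_fin_numE; last by apply: le_ereal_inf_tmp => _ [c' _ <-]; exact: length_ge0.
apply: le_lt_trans (ltry (M 0%N + M 1%N + M 2%N)); apply: le_trans cL.
by apply: ereal_inf_lbound; exists c.
Qed.

(* Near the zero set of L1 = l1 + k1 (resp. L2) the metric is bounded below by the
   derivative of the first (resp. second) cutoff logarithm. *)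
Lemma kobayashi_dist_ge l1 l2 (K1 K2 : R) (k1 k2 : R[i]) (m : R) z w :
  open Omega -> convex_set Omega -> 0 < m -> clinear l1 K1 -> clinear l2 K2 ->
  (forall z, Omega z -> 0 < Re (l1 z + k1)) -> (forall z, Omega z -> 0 < Re (l2 z + k2)) ->
  (forall z, Omega z -> m <= sqmod l1 k1 z \/ m <= sqmod l2 k2 z) ->
  Omega z -> Omega w ->
  4^-1 * (cutoff m (sqmod l1 k1 w) - cutoff m (sqmod l1 k1 z)
    - (cutoff m (sqmod l2 k2 w) - cutoff m (sqmod l2 k2 z))) <= kobayashi_dist Omega z w.
Proof.
move=> oO cO m0 hl1 hl2 pos1 pos2 sep Oz Ow.
apply: le_kobayashi_dist => // c [pc Oc c0 c1].
pose h1 t := 4^-1 * cutoff m (sqmod l1 k1 (c t)).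
pose h2 t := 4^-1 * cutoff m (sqmod l2 k2 (c t)).
have := @le_kobayashi_length _ _ Omega c (fun t => h1 t + (- 1) * h2 t) pc.
rewrite /h1 /h2 c0 c1 -/h1 -/h2.
set X := (X in (X%:E <= _)%E) => H; set Y := (X in (X%:E <= _)%E).
have -> : Y = X by rewrite /X /Y; ring.
apply: H => [|a b c' a0 ab b1 cc' dc].
  have ch l (K : R) k : clinear l K -> (forall z, Omega z -> 0 < Re (l z + k)) ->
      {within `[0, 1], continuous (fun t => 4^-1 * cutoff m (sqmod l k (c t)))}.
    move=> hl pos; apply: within_continuousM; first exact: within_continuous_cst.
    apply: (within_continuous_comp (h := cutoff m) (f := fun t => sqmod l k (c t))).
      have cs := @sqmod_continuous l K k hl.
      have -> : (fun t => sqmod l k (c t)) = (sqmod l k \o toC) \o (toR \o c).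
        by apply/funext => t /=; rewrite toRK.
      by apply: within_continuous_comp; [exact: pc.1|move=> t _; exact: cs].
    move=> t; rewrite /= in_itv /= => /Oc /pos ht.
    have s0 : 0 < sqmod l k (c t).
      rewrite exprn_gt0// (lt_le_trans ht)//.
      by rewrite (le_trans (ler_norm _))// normc_Re.
    apply/differentiable_continuous/derivable1_diffP.
    by have [] := is_derive_cutoff m0 s0.
  apply: within_continuousD; first exact: ch hl1 pos1.
  by apply: within_continuousM; [exact: within_continuous_cst|exact: ch hl2 pos2].
have Oc' t : a <= t <= b -> Omega (c t) by move=> tab; apply: Oc; lra.
have cc : {within `[a, b], continuous (toR \o c)}.
  exact: within_continuous_sub pc.1.
have [f1 [cf1 df1 bf1 zf1]] := cutoff_curve m0 oO hl1 pos1 ab Oc' cc cc' dc.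
have [f2 [cf2 df2 bf2 zf2]] := cutoff_curve m0 oO hl2 pos2 ab Oc' cc cc' dc.
exists (fun t => f1 t + (- 1) * f2 t); split.
  apply: within_continuousD => //.
  by apply: within_continuousM; [exact: within_continuous_cst|].
move=> t tab; split.
  have d1 := df1 _ tab; have d2 := df2 _ tab.
  by apply: is_derive_eq; rewrite /GRing.scale /=; ring.
have tab' : a <= t <= b by lra.
have := bf1 _ tab; have := bf2 _ tab; rewrite !ler_norml => /andP[b2 b2'] /andP[b1' b1''].
(* One of the two derivatives vanishes at each time, so their difference is dominated by the metric
   itself and not by twice the metric. *)
have [/(zf1 _ tab) ->|/(zf2 _ tab) ->] := sep _ (Oc' _ tab'); lra.
Qed.

End KobayashiDistance.

(** * Defining functions of convex domains *)

Lemma nbhs_rV_norm {R : realType} {n : nat} (u : 'rV[R]_n) (A : set 'rV[R]_n) :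
  nbhs u A -> exists2 e : R, 0 < e & forall v, `|v - u| < e -> A v.
Proof.
move=> /nbhs_ballP[e /= e0 uA]; exists e => // v uv; apply: uA.
by rewrite -ball_normE /= distrC.
Qed.

Section DefiningFunction.
Context {R : realType} {d : nat}.
Local Notation Cd := 'rV[R[i]]_d.
Local Notation V := 'rV[R]_(d + d).
Variables (Omega : set Cd) (U : set V) (rho : V -> R).
Hypothesis oO : open Omega.
Hypothesis cO : convex_set Omega.
Hypothesis hdef : C1_defining Omega U rho.
Implicit Types (u v h : V) (z w : Cd).

Let openU u : U u -> exists2 e : R, 0 < e & forall v, `|v - u| < e -> U v.
Proof. by move=> Uu; apply: nbhs_rV_norm; case: hdef => oU *; exact: open_nbhs_nbhs. Qed.

Let diff_rho u : U u -> differentiable rho u.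
Proof. by case: hdef => _ + _ _ _; apply. Qed.

Let rho_lt0 u : U u -> Omega (toC u) <-> rho u < 0.
Proof. by case: hdef => _ _ _ _; apply. Qed.

Lemma diff_rlinear u : rlinear ('d rho u).
Proof. by split => [v w|x v]; rewrite ?linearD ?linearZ. Qed.

Let rho_cont u : U u -> forall e : R, 0 < e -> exists2 dl : R, 0 < dl &
  forall v, `|v - u| < dl -> `|rho v - rho u| < e.
Proof.
move=> Uu e e0; have := differentiable_continuous (diff_rho Uu).
move/(@cvgrPdist_lt _ _ _ _ (nbhs_filter u)) => /(_ _ e0)/nbhs_rV_norm[dl dl0 h].
by exists dl => // v /h; rewrite distrC.
Qed.

Let rho_line u h : U u -> forall e : R, 0 < e -> exists2 dl : R, 0 < dl &
  forall s : R, `|s| < dl -> `|rho (u + s *: h) - rho u - s * 'd rho u h| <= e * `|s|.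
Proof.
move=> Uu e e0; have drho := diff_rho Uu.
have : s^-1 *: (rho (s *: h + u) - rho u) @[s --> 0^'] --> 'd rho u h.
  by rewrite -deriveE//; exact: diff_derivable.
move/cvgrPdist_le => /(_ _ e0)/nbhs_ballP[dl /= dl0 hd].
exists dl => // s hs; have [->|s0] := eqVneq s 0.
  by rewrite scale0r addr0 subrr mul0r subr0 normr0 mulr0.
have := hd s; rewrite -ball_normE /= sub0r normrN => /(_ hs s0).
rewrite /GRing.scale /= [s *: h + u]addrC => {}hd.
have -> : rho (u + s *: h) - rho u - s * 'd rho u h =
   - (('d rho u h - s^-1 * (rho (u + s *: h) - rho u)) * s) by field.
by rewrite normrN normrM ler_wpM2r.
Qed.

Lemma diff_neg u : U u -> exists h, 'd rho u h = - 1.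
Proof.
case: hdef => _ _ _ nz _ Uu; have [h h0] := nz _ Uu.
exists ((- ('d rho u h)^-1) *: h).
by rewrite (diff_rlinear u).2 mulNr mulVf.
Qed.

Lemma defining_descent u h : U u -> rho u = 0 -> 'd rho u h < 0 ->
  exists2 dl : R, 0 < dl & forall s : R, 0 < s < dl -> Omega (toC (u + s *: h)).
Proof.
move=> Uu u0 dh; have [e e0 eU] := openU Uu.
have e2 : 0 < - 'd rho u h / 2 by rewrite divr_gt0// oppr_gt0.
have [dl dl0 hs] := rho_line h Uu e2.
exists (Num.min dl (e / (`|h| + 1))).
  by rewrite lt_min dl0 divr_gt0// ltr_wpDl.
move=> s /andP[s0]; rewrite lt_min => /andP[sdl]; rewrite ltr_pdivlMr ?ltr_wpDl// => sh.
have sE : `|s| = s by rewrite gtr0_norm.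
have Us : U (u + s *: h).
  apply: eU; rewrite addrAC subrr add0r normrZ sE; apply: le_lt_trans sh.
  by rewrite ler_wpM2l ?(ltW s0)// lerDl.
apply/(rho_lt0 Us); have := hs s; rewrite sE => /(_ sdl).
rewrite u0 subr0 ler_norml => /andP[_ h1].
apply: le_lt_trans (_ : s * 'd rho u h + - 'd rho u h / 2 * s < 0); first by lra.
by have -> : s * 'd rho u h + - 'd rho u h / 2 * s = s * ('d rho u h / 2);
  [field|rewrite pmulr_rlt0//; lra].
Qed.

Let zero_closure u : U u -> rho u = 0 -> forall e : R, 0 < e ->
  exists2 z, Omega z & `|toR z - u| < e.
Proof.
move=> Uu u0 e e0; have [h hn] := diff_neg Uu.
have [|dl dl0 hdl] := defining_descent Uu u0 (h := h); first by rewrite hn ltrN10.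
pose s := Num.min (dl / 2) (e / (2 * (`|h| + 1))).
have h1 : 0 < `|h| + 1 by rewrite ltr_wpDl.
have s0 : 0 < s by rewrite lt_min !divr_gt0// mulr_gt0.
have sdl : s < dl by apply: le_lt_trans (_ : dl / 2 < dl); [rewrite ge_min lexx|lra].
exists (toC (u + s *: h)); first by apply: hdl; rewrite s0.
rewrite toCK addrAC subrr add0r normrZ gtr0_norm//.
apply: le_lt_trans (_ : e / (2 * (`|h| + 1)) * (`|h| + 1) < e).
  by apply: ler_pM; rewrite ?(ltW s0)// ?lerDl// ge_min lexx orbT.
by have -> : e / (2 * (`|h| + 1)) * (`|h| + 1) = e / 2; [field; rewrite gt_eqF|lra].
Qed.

(** Were the differential positive on v = z - u, then rho would be positive near u + s v for a small
    s. By convexity Omega has points there, on the segment to z from a point of Omega close to u. *)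
Let support_le u : U u -> rho u = 0 -> forall z, Omega z -> 'd rho u (toR z - u) <= 0.
Proof.
move=> Uu u0 z Oz; rewrite leNgt; apply/negP => Av.
set v := toR z - u in Av.
have e2 : 0 < 'd rho u v / 2 by rewrite divr_gt0.
have [dl dl0 hs] := rho_line v Uu e2; have [e e0 eU] := openU Uu.
have v1 : 0 < `|v| + 1 by rewrite ltr_wpDl.
pose s := Num.min (Num.min (1 / 2) (dl / 2)) (e / (2 * (`|v| + 1))).
have s0 : 0 < s by rewrite !lt_min !divr_gt0// mulr_gt0.
have s1 : s <= 1 / 2 by rewrite !ge_min lexx.
have sdl : s < dl by apply: le_lt_trans (_ : dl / 2 < dl); [rewrite !ge_min lexx !orbT|lra].
have sE : `|s| = s by rewrite gtr0_norm.
have Us : U (u + s *: v).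
  apply: eU; rewrite addrAC subrr add0r normrZ sE.
  apply: le_lt_trans (_ : e / (2 * (`|v| + 1)) * (`|v| + 1) < e).
    by apply: ler_pM; rewrite ?(ltW s0)// ?lerDl// ge_min lexx orbT.
  by have -> : e / (2 * (`|v| + 1)) * (`|v| + 1) = e / 2; [field; rewrite gt_eqF|lra].
have rpos : 0 < rho (u + s *: v).
  have := hs s; rewrite sE u0 subr0 => /(_ sdl); rewrite ler_norml => /andP[h1 _].
  apply: lt_le_trans (_ : s * ('d rho u v / 2) <= _); first by rewrite mulr_gt0.
  by lra.
have [e1 e10 he1] := openU Us; have [e3 e30 he3] := rho_cont Us rpos.
have [|y Oy yu] := @zero_closure u Uu u0 (Num.min e1 e3); first by rewrite lt_min e10.
(* The counterpart of u + s v on the segment from y to z; the two differ by (1 - s) (y - u). *)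
pose w := y + s%:C%C *: (z - y).
have Ow : Omega w by apply: convex_segment => //; apply/andP; split; lra.
have wE : toR w - (u + s *: v) = (1 - s) *: (toR y - u).
  rewrite /w /v toRD toRZ toRB; apply/rowP => j; rewrite !mxE; ring.
have wlt : `|toR w - (u + s *: v)| < Num.min e1 e3.
  apply: le_lt_trans yu; rewrite wE normrZ ler_piMl//.
  by rewrite ger0_norm; lra.
move: wlt; rewrite lt_min => /andP[/he1 Uw /he3].
have : rho (toR w) < 0 by apply/(rho_lt0 Uw); rewrite toRK.
by move=> r0; rewrite ltr_norml => /andP[h1 _]; lra.
Qed.

(** Strictness comes from openness: z - s h is still in Omega, and passing to it raises the
    differential by s. *)
Lemma defining_support u : U u -> rho u = 0 -> forall z, Omega z -> 'd rho u (toR z - u) < 0.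
Proof.
move=> Uu u0 z Oz; have [h hn] := diff_neg Uu.
have [r r0 zr] : exists2 r : R, 0 < r & forall w, nrm (w - z) < r -> Omega w.
  by apply/nbhs_nrm; exact: open_nbhs_nbhs.
pose s := r / (2 * (`|h| + 1)).
have h1 : 0 < `|h| + 1 by rewrite ltr_wpDl.
have s0 : 0 < s by rewrite divr_gt0// mulr_gt0.
have Ow : Omega (z - s%:C%C *: toC h).
  apply: zr; rewrite addrAC subrr add0r nrmN nrmZr gtr0_norm// /nrm toCK.
  apply: le_lt_trans (_ : s * (`|h| + 1) < r); first by rewrite ler_wpM2l ?(ltW s0)// lerDl.
  by have -> : s * (`|h| + 1) = r / 2; [rewrite /s; field; rewrite gt_eqF|lra].
have := support_le Uu u0 Ow.
have [AD AZ] := diff_rlinear u.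
by rewrite toRB toRZ toCK addrAC [X in X <= 0 -> _]AD -[- (s *: h)]scaleN1r !AZ hn; lra.
Qed.

(** Omega contains a short segment from u in each direction where the differential of rho is
    negative. So B <= 0 on an open half-space, then on its bounding hyperplane by a limit, and
    vanishes there by symmetry. This makes tangent spaces independent of the defining function. *)
Lemma support_unique u (B : V -> R) : U u -> rho u = 0 -> rlinear B ->
  (forall z, Omega z -> B (toR z - u) <= 0) -> exists lam : R, forall h, B h = lam * 'd rho u h.
Proof.
move=> Uu u0 [BD BZ] Bs.
have neg h : 'd rho u h < 0 -> B h <= 0.
  move=> dh; have [dl dl0 hdl] := defining_descent Uu u0 dh.
  have := Bs _ (hdl (dl / 2) _); rewrite toCK addrAC subrr add0r BZ pmulr_rle0 ?divr_gt0//.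
  by apply; apply/andP; split; lra.
have BN h : B (- h) = - B h by rewrite -scaleN1r BZ mulN1r.
have [e he] := diff_neg Uu.
have ker h : 'd rho u h = 0 -> B h <= 0.
  move=> h0; apply/ler_addgt0Pr => eps eps0; rewrite add0r.
  pose s := eps / (`|B e| + 1); have b1 : 0 < `|B e| + 1 by rewrite ltr_wpDl.
  have s0 : 0 < s by rewrite divr_gt0.
  have := neg (h + s *: e); rewrite (diff_rlinear u).1 (diff_rlinear u).2 h0 he add0r mulrN1.
  rewrite oppr_lt0 => /(_ s0); rewrite BD BZ => hB.
  have : - (s * B e) <= eps.
    apply: le_trans (ler_norm _) _; rewrite normrN normrM gtr0_norm//.
    apply: le_trans (_ : s * (`|B e| + 1) <= _); first by rewrite ler_wpM2l ?(ltW s0)// lerDl.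
    by rewrite /s divfK// gt_eqF.
  by lra.
have ker0 h : 'd rho u h = 0 -> B h = 0.
  move=> h0; apply/eqP; rewrite eq_le ker// -oppr_le0 -BN ker// linearN h0 oppr0//.
exists (- B e) => h.
have := ker0 (h + 'd rho u h *: e); rewrite (diff_rlinear u).1 (diff_rlinear u).2 he mulrN1 subrr.
by move=> /(_ erefl); rewrite BD BZ => /eqP; rewrite addr_eq0 mulrC mulNr => /eqP.
Qed.

Lemma bdry_zero x : U (toR x) -> bdry Omega x -> rho (toR x) = 0.
Proof.
move=> Ux [clx nix]; apply/eqP; rewrite eq_le; apply/andP; split; rewrite leNgt; apply/negP.
  move=> rx; have [e e0 he] := openU Ux; have [e' e'0 he'] := rho_cont Ux rx.
  have [|z Oz] := (closure_nrm Omega x).1 clx (Num.min e e'); first by rewrite lt_min e0.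
  rewrite /nrm toRB lt_min => /andP[/he Uz /he'].
  have : rho (toR z) < 0 by apply/(rho_lt0 Uz); rewrite toRK.
  by move=> ?; rewrite ltr_norml => /andP[? _]; lra.
move=> rx; apply: nix.
have Ox : Omega x by rewrite -(toRK x); apply/(rho_lt0 Ux).
exact: open_nbhs_nbhs.
Qed.

End DefiningFunction.

(** * Model disks in the half-plane *)

Section Powers.
Context {R : realType}.
Variable alpha : R.
Hypothesis halpha : 0 < alpha <= 1.

Lemma powR_mono (x y : R) : 0 <= x -> x <= y -> x `^ alpha <= y `^ alpha.
Proof.
move=> x0 xy; have /andP[a0 _] := halpha.
by apply: ge0_ler_powR; rewrite ?nnegrE ?(ltW a0) ?(le_trans x0).
Qed.

Lemma powR_small (c : R) : 0 < c -> exists2 r : R, 0 < r &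
  forall y, 0 <= y -> y <= r -> y `^ alpha <= c.
Proof.
move=> c0; have /andP[a0 _] := halpha.
exists (c `^ alpha^-1); first by rewrite powR_gt0.
move=> y y0 yr; apply: le_trans (powR_mono y0 yr) _.
by rewrite -powRrM mulVf ?gt_eqF// powRr1// ltW.
Qed.

Lemma powR_leD1 (y : R) : 0 <= y -> y `^ alpha <= y + 1.
Proof.
move=> y0; have /andP[_ a1] := halpha.
have [y1|y1] := leP 1 y; first by rewrite (le_trans (ler1_powR y1 a1))// lerDl.
apply: le_trans (powR_mono y0 (ltW y1)) _.
by rewrite powR1 lerDr.
Qed.

(* With a radius defect 1 - b = 32 C1 s^alpha the disk of the next lemmas stays
   inside the region Re W > M0 (N |W - dl|)^(1 + alpha). *)
Lemma holder_disk_real (s D q b C1 M0 N : R) :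
  0 < s -> s <= 1 -> 0 < D -> D <= 2 -> 0 <= q -> q <= 4 * s / D ->
  0 < M0 -> 0 < N -> M0 * N * (4 * N + 1) <= C1 -> 0 < C1 -> 0 <= b ->
  1 - b = 32 * C1 * s `^ alpha -> 1 - b <= D ->
  N * q <= N / (8 * C1) /\
  M0 * (N * q) `^ alpha * (N * q) < s * (1 - b ^+ 2) / D ^+ 2.
Proof.
move=> s0 s1 D0 D2 q0 qs M00 N0 C1M C10 b0 bE bD.
have /andP[a0 a1] := halpha.
set P := s `^ alpha in bE.
have P0 : 0 < P by rewrite powR_gt0.
have sP : s <= P by rewrite ger1_powR ?s0.
have CP : 0 < 32 * C1 * P by rewrite mulr_gt0// mulr_gt0.
split.
  rewrite ler_wpM2l ?(ltW N0)//; apply: le_trans qs _.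
  rewrite ler_pdivrMr// -ler_pdivrMl ?invr_gt0 ?mulr_gt0// invrK.
  apply: le_trans bD; rewrite bE; have := ler_wpM2l (ltW C10) sP; lra.
have NqD : N * q <= 4 * N / D * s.
  by apply: le_trans (ler_wpM2l (ltW N0) qs) _; rewrite le_eqVlt; apply/orP; left; apply/eqP; ring.
have ND0 : 0 <= 4 * N / D by rewrite divr_ge0 ?mulr_ge0 ?(ltW N0) ?(ltW D0).
have Nq0 : 0 <= N * q by rewrite mulr_ge0 ?(ltW N0).
(* Bounding y^alpha by y + 1 replaces the power of 1 / D by a linear term, so that the product below
   has the denominator D^2 of the right-hand side. *)
have k1 : (N * q) `^ alpha <= (4 * N / D + 1) * P.
  apply: le_trans (powR_mono Nq0 NqD) _.
  by rewrite powRM ?(ltW s0)// ler_wpM2r ?(ltW P0)// powR_leD1.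
apply: le_lt_trans (_ : M0 * ((4 * N / D + 1) * P) * (4 * N / D * s) < _).
  by apply: ler_pM => //; [rewrite mulr_ge0 ?powR_ge0 ?(ltW M00)|rewrite ler_wpM2l ?(ltW M00)].
have -> : M0 * ((4 * N / D + 1) * P) * (4 * N / D * s) =
   (4 * (M0 * N) * (4 * N + D) * P) * s / D ^+ 2 by field; rewrite gt_eqF.
rewrite ltr_pM2r ?invr_gt0 ?exprn_gt0// [s * _]mulrC ltr_pM2r//.
have -> : 1 - b ^+ 2 = (1 - b) * (1 + b) by ring.
rewrite bE; apply: lt_le_trans (_ : 32 * C1 * P * 1 <= _); last by rewrite ler_wpM2l ?(ltW CP)// lerDl.
rewrite mulr1 ltr_pM2r//.
apply: le_lt_trans (_ : 8 * C1 < _); last by lra.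
have MN : 0 <= M0 * N by rewrite mulr_ge0 ?(ltW M00) ?(ltW N0).
have : M0 * N * (4 * N + D) <= M0 * N * (2 * (4 * N + 1)) by apply: ler_wpM2l => //; lra.
by lra.
Qed.

End Powers.

Section Moebius.
Context {R : realType}.

(** For s > 0 and 0 < b < 1 the unit disk is sent onto a disk whose closure is in the open right
    half-plane; its centre goes to s. *)
Lemma moebius_derive {K : numFieldType} (s b z : K) : 1 - b * z != 0 ->
  derivable (fun z => s * ((1 + b * z) * (1 - b * z)^-1)) z 1 /\
  (z = 0 -> derive1 (fun z => s * ((1 + b * z) * (1 - b * z)^-1)) z = 2 * s * b).
Proof.
move=> nz.
have d1 : is_derive z 1 (fun z => 1 + b * z) b.
  by apply: is_derive_eq; rewrite /GRing.scale /=; ring.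
have d2 : is_derive z 1 (fun z => 1 - b * z) (- b).
  by apply: is_derive_eq; rewrite /GRing.scale /=; ring.
have d3 : is_derive z 1 (fun z => (1 - b * z)^-1) (- (1 - b * z) ^- 2 *: - b).
  apply: DeriveDef; first exact: derivableV.
  by rewrite deriveV// derive_val.
have h : is_derive z 1 (fun z => s * ((1 + b * z) * (1 - b * z)^-1))
   (s * ((1 + b * z) * (- (1 - b * z) ^- 2 * - b) + (1 - b * z)^-1 * b)).
  by apply: is_derive_eq; rewrite /GRing.scale /=; ring.
split => // z0; rewrite derive1E derive_val z0 mulr0 addr0 subr0 invr1 expr1n invr1; ring.
Qed.

Let omb (b : R) (z : R[i]) := 1 - b%:C%C * z.

(** Re F = s (1 - b^2 |z|^2) / D^2, whereas F - dl is only O(s / D). As 1 + alpha <= 2, the real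
    part can therefore dominate |F - dl|^(1 + alpha) near the pole, where D is small. *)
Lemma moebius_bounds (s b dl : R) (z : R[i]) :
  0 < dl -> dl <= s -> 0 <= b -> b < 1 -> normc z < 1 ->
  let D := normc (omb b z) in
  let F := s%:C%C * ((1 + b%:C%C * z) * (omb b z)^-1) in
  [/\ 0 < D, D <= 2, 1 - b <= D, normc (F - dl%:C%C) <= 4 * s / D &
      s * (1 - b ^+ 2) / D ^+ 2 <= Re F].
Proof.
move=> dl0 dls b0 b1 z1 D F.
have s0 : 0 < s by exact: lt_le_trans dls.
have bz : normc (b%:C%C * z) <= b.
  by rewrite normcM normc_real ger0_norm// ler_piMr// ltW.
have n1 : normc (1 : R[i]) = 1 by rewrite normc1.
have D1 : 1 - b <= D.
  have := le_normcD (omb b z) (b%:C%C * z); rewrite /omb subrK n1 -/(omb b z) -/D; lra.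
have D0 : 0 < D by lra.
have D2 : D <= 2 by apply: le_trans (normcB _ _) _; rewrite n1; lra.
have E2 : normc (1 + b%:C%C * z) <= 2 by apply: le_trans (le_normcD _ _) _; rewrite n1; lra.
have nz : omb b z != 0 by rewrite -normc_gt0.
split => //.
  apply: le_trans (normcB _ _) _; rewrite !normcM normcV !normc_real !ger0_norm ?(ltW s0) ?(ltW dl0)//.
  rewrite -/D; have k : s * (normc (1 + b%:C%C * z) / D) <= s * (2 / D).
    by rewrite ler_wpM2l ?(ltW s0)// ler_wpM2r ?invr_ge0 ?(ltW D0).
  have k2 : dl <= s * (2 / D).
    by apply: le_trans dls _; rewrite ler_peMr ?(ltW s0)// ler_pdivlMr// mul1r.
  by rewrite (_ : 4 * s / D = s * (2 / D) + s * (2 / D)); [lra|field; rewrite gt_eqF].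
have FE : Re F * D ^+ 2 = s * (1 - b ^+ 2 * normc z ^+ 2).
  have h1 : F * (omb b z * conjc (omb b z)) =
      s%:C%C * ((1 + b%:C%C * z) * conjc (omb b z)).
    by rewrite /F; field.
  have h2 : omb b z * conjc (omb b z) = (D ^+ 2)%:C%C.
    rewrite /D normc_sqrE; apply/eqP; rewrite eq_complex ReMc ImMc.
    by case: (omb b z) => x y /=; apply/andP; split; apply/eqP; ring.
  rewrite h2 in h1.
  have := congr1 (fun w : R[i] => Re w) h1; rewrite ReMc /= mulr0 subr0 => ->.
  rewrite ReMc /= mul0r subr0; congr (s * _).
  rewrite normc_sqrE /omb; case: (z) => x y /=.
by ring.
rewrite ler_pdivrMr ?exprn_gt0// FE ler_wpM2l ?(ltW s0)// lerD2l lerN2 ler_piMr ?sqr_ge0//.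
by rewrite expr_le1// ?normc_ge0// ltW.
Qed.

End Moebius.

(** * Estimates near a boundary point of class C^(1,alpha) *)

Lemma clinear_sub_shift {R : realType} {d : nat} (f g : 'rV[R[i]]_d -> R[i]) (Kf Kg : R)
    (z c x : 'rV[R[i]]_d) : clinear f Kf -> clinear g Kg ->
  f z - f c - (g z - g x) = (f (z - c) - g (z - c)) - g (c - x).
Proof.
by move=> fK gK; rewrite (clinearB z c fK) (clinearB z c gK) (clinearB c x gK); ring.
Qed.

Section Hoelder.
Context {R : realType} {d : nat}.
Local Notation Cd := 'rV[R[i]]_d.
Local Notation V := 'rV[R]_(d + d).
Variables (Omega : set Cd) (U : set V) (rho : V -> R) (alpha M : R) (x : Cd).
Hypothesis halpha : 0 < alpha <= 1.
Hypothesis oO : open Omega.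
Hypothesis cO : convex_set Omega.
Hypothesis hdef : C1_defining Omega U rho.
Hypothesis hM : forall u u' h, U u -> U u' ->
  `|'d rho u h - 'd rho u' h| <= M * `|u - u'| `^ alpha * `|h|.
Hypothesis Ux : U (toR x).
Hypothesis rhox : rho (toR x) = 0.
Implicit Types (u v h : V) (z w p : Cd).

Let M0 := `|M| + 1.
Let M00 : 0 < M0. Proof. by rewrite ltr_wpDl. Qed.

Let openU u : U u -> exists2 e : R, 0 < e & forall v, `|v - u| < e -> U v.
Proof. by move=> Uu; apply: nbhs_rV_norm; case: hdef => oU *; exact: open_nbhs_nbhs. Qed.

Let diff_rho u : U u -> differentiable rho u.
Proof. by case: hdef => _ + _ _ _; apply. Qed.

Let rho_lt0 u : U u -> Omega (toC u) <-> rho u < 0.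
Proof. by case: hdef => _ _ _ _; apply. Qed.

Let diff_hoelder u u' h : U u -> U u' ->
  `|'d rho u h - 'd rho u' h| <= M0 * `|u - u'| `^ alpha * `|h|.
Proof.
move=> Uu Uu'; apply: le_trans (hM h Uu Uu') _.
by rewrite !ler_wpM2r ?powR_ge0// (le_trans (ler_norm _))// lerDl.
Qed.

Let rho_taylor u h : (forall s : R, 0 <= s <= 1 -> U (u + s *: h)) ->
  `|rho (u + h) - rho u - 'd rho u h| <= M0 * `|h| `^ alpha * `|h|.
Proof.
move=> Us; have U0 : U u by have := Us 0; rewrite scale0r addr0; apply; rewrite lexx ler01.
have := @derive_bound _ (fun s => rho (u + s *: h) - s * 'd rho u h)
  (fun s => 'd rho (u + s *: h) h - 'd rho u h) 0 1 (M0 * `|h| `^ alpha * `|h|) ler01.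
rewrite subr0 mulr1 scale1r mul1r scale0r addr0 mul0r subr0 addrAC; apply.
- move=> s s01; have ds := diff_rho (Us _ s01).
  have h1 : is_derive s 1 (fun s => rho (u + s *: h)) ('d rho (u + s *: h) h).
    have hl : is_derive s 1 (fun t : R => u + t *: h) (1 *: h).
      exact: (@is_derive_affine_line _ _ id).
    have [dl lE] := hl.
    have dl' : differentiable (fun t : R => u + t *: h) s by apply/derivable1_diffP.
    apply: DeriveDef.
      by apply/derivable1_diffP; exact: (differentiable_comp dl' ds).
    rewrite deriveE; last exact: (differentiable_comp dl' ds).
    rewrite (diff_comp dl' ds) /=; congr ('d rho _ _).
    by rewrite -[RHS]scale1r -lE deriveE.
  have h2 : is_derive s 1 (fun s : R => s * 'd rho u h) ('d rho u h).
    by apply: is_derive_eq; rewrite /GRing.scale /= ?mulr1 ?mulr0 ?addr0 ?add0r.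
  exact: (is_deriveB h1 h2).
move=> s s01; have /andP[s0 s1] := s01.
apply: le_trans (diff_hoelder h (Us _ s01) U0) _.
rewrite ler_wpM2r// ler_wpM2l ?(ltW M00)//; apply: powR_mono => //.
by rewrite addrAC subrr add0r normrZ ger0_norm// ler_piMl.
Qed.

Let l u := @clin R d ('d rho u).

Let l_clinear u : exists K, clinear (l u) K.
Proof.
have [K K0 hK] := rlinear_bound (diff_rlinear rho u).
by exists (3 * K); exact: clin_clinear (diff_rlinear rho u) K0 hK.
Qed.

Let lE u z : Re (l u z) = 'd rho u (toR z).
Proof. by []. Qed.

Let nrmi z : nrm ('i%C *: z) <= 2 * nrm z.
Proof.
apply: le_trans (nrmZ _ _) _.
by rewrite /= expr0n expr1n /= add0r sqrtr1 mulr1.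
Qed.

Let l_hoelder u u' z : U u -> U u' ->
  normc (l u z - l u' z) <= 3 * M0 * `|u - u'| `^ alpha * nrm z.
Proof.
move=> Uu Uu'; apply: le_trans (normc_le_ReIm _) _.
rewrite ReDc ImDc ReNc ImNc /l /clin /= -opprD normrN.
have h1 := diff_hoelder (toR z) Uu Uu'.
have h2 := diff_hoelder (toR ('i%C *: z)) Uu Uu'.
rewrite -!/(nrm _) in h1 h2.
have c0 : 0 <= M0 * `|u - u'| `^ alpha by rewrite mulr_ge0 ?powR_ge0// ltW.
have := ler_wpM2l c0 (nrmi z); lra.
Qed.

(** [diff_neg] normalises the real part only. Dividing by the complex value of the form makes the
    differential of rho at x on W nx equal to - Re W, so that to first order the domain cuts a
    half-plane out of this complex line. *)
Let dir_exists : exists nx, l (toR x) nx = - 1.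
Proof.
have [h hn] := diff_neg hdef Ux; have [K [_ lZ _ _]] := l_clinear (toR x).
have l0 : l (toR x) (toC h) != 0.
  apply/eqP => l0; have := lE (toR x) (toC h); rewrite toCK hn l0 /= => /eqP.
  by rewrite eq_sym oppr_eq0 oner_eq0.
exists ((- (l (toR x) (toC h))^-1) *: toC h).
by rewrite lZ mulNr mulVf.
Qed.

Let nx : Cd := projT1 (cid dir_exists).
Let lnx : l (toR x) nx = - 1. Proof. exact: (projT2 (cid dir_exists)). Qed.

(* A multiple of nx on which the complex differential at p takes the value -1. *)
Let dir p : Cd := (- (l (toR p) nx)^-1) *: nx.

Let dirx : dir x = nx.
Proof. by rewrite /dir lnx invrN invr1 opprK scale1r. Qed.

Let near_l (e : R) : 0 < e -> exists2 r : R, 0 < r & forall p, nrm (p - x) < r ->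
  U (toR p) /\ normc (l (toR p) nx + 1) <= e.
Proof.
move=> e0; have [r0 r00 hU] := openU Ux.
have K0 : 0 < 3 * M0 * (nrm nx + 1) by rewrite !mulr_gt0// ltr_wpDl// nrm_ge0.
have [r r1 hr] := powR_small halpha (divr_gt0 e0 K0).
exists (Num.min r0 r); first by rewrite lt_min r00.
move=> p; rewrite lt_min => /andP[p0 pr].
have Up : U (toR p) by apply: hU; rewrite -toRB.
split => //; have := l_hoelder nx Up Ux; rewrite lnx opprK -toRB => h.
apply: le_trans h _; have := hr _ (nrm_ge0 (p - x)) (ltW pr); rewrite ler_pdivlMr// -/(nrm _).
move=> h; apply: le_trans h; set P := nrm (p - x) `^ alpha.
rewrite [P * _]mulrC -!mulrA -subr_ge0.
have -> : 3 * (M0 * ((nrm nx + 1) * P)) - 3 * (M0 * (P * nrm nx)) = 3 * (M0 * P) by ring.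
by rewrite !mulr_ge0 ?powR_ge0// ltW.
Qed.

Let near_dir : exists r N : R, [/\ 0 < r, 0 < N & forall p, nrm (p - x) < r ->
  [/\ forall v, `|v - toR p| < r -> U v, l (toR p) (dir p) = - 1 & nrm (dir p) <= N]].
Proof.
have h2 : 0 < 1 / 2 :> R by rewrite divr_gt0.
have [r1 r10 h1] := near_l h2; have [r0 r00 hU] := openU Ux.
exists (Num.min r1 (r0 / 2)), (4 * nrm nx + 1); split.
- by rewrite lt_min r10 divr_gt0.
- by rewrite ltr_wpDl// mulr_ge0// nrm_ge0.
move=> p; rewrite lt_min => /andP[pr1 pr0].
have [Up lp] := h1 _ pr1; have [K [_ lZ _ _]] := l_clinear (toR p).
have lp1 : 1 / 2 <= normc (l (toR p) nx).
  have := normcB (l (toR p) nx + 1) (l (toR p) nx); rewrite addrAC subrr add0r normc1; lra.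
have lp0 : l (toR p) nx != 0 by rewrite -normc_gt0; lra.
split.
- move=> v; rewrite lt_min => /andP[_ vp]; apply: hU.
  have -> : v - toR x = (v - toR p) + toR (p - x) by rewrite toRB; apply/rowP => j; rewrite !mxE; ring.
  apply: le_lt_trans (ler_normD _ _) _; rewrite -/(nrm _); lra.
- by rewrite /dir lZ mulNr mulVf.
apply: le_trans (nrmZ _ _) _; rewrite normcN normcV.
have : (normc (l (toR p) nx))^-1 <= 2.
  by rewrite -[leRHS]invrK lef_pV2 ?posrE; lra.
move=> h; have := nrm_ge0 nx => h0; have := ler_wpM2r h0 h; lra.
Qed.

(** Makes the points p + t dir p gather at the single interior point x + t nx as p tends to x. *)
Let dir_continuous (e : R) : 0 < e -> exists2 r : R, 0 < r &
  forall p, nrm (p - x) < r -> nrm (dir p - nx) < e.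
Proof.
move=> e0; have K0 : 0 < 4 * (nrm nx + 1) by rewrite mulr_gt0// ltr_wpDl// nrm_ge0.
have e1 : 0 < Num.min (1 / 2) (e / (4 * (nrm nx + 1))) by rewrite lt_min !divr_gt0.
have [r r0 h] := near_l e1; exists r => // p /h[Up]; rewrite le_min => /andP[lp le].
have lp1 : 1 / 2 <= normc (l (toR p) nx).
  have := normcB (l (toR p) nx + 1) (l (toR p) nx); rewrite addrAC subrr add0r normc1; lra.
have lp0 : l (toR p) nx != 0 by rewrite -normc_gt0; lra.
have -> : dir p - nx = (- ((l (toR p) nx)^-1 * (l (toR p) nx + 1))) *: nx.
  by rewrite /dir mulrDr mulVf// mulr1 opprD addrC scalerDl scaleN1r addrC; congr (_ + _); rewrite addrC.
apply: le_lt_trans (nrmZ _ _) _; rewrite normcN normcM normcV.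
have l2 : (normc (l (toR p) nx))^-1 <= 2 by rewrite -[leRHS]invrK lef_pV2 ?posrE; lra.
have l3 : (normc (l (toR p) nx))^-1 * normc (l (toR p) nx + 1) <= 2 * (e / (4 * (nrm nx + 1))).
  by apply: ler_pM; rewrite ?invr_ge0 ?normc_ge0.
apply: le_lt_trans (_ : 2 * (2 * (e / (4 * (nrm nx + 1)))) * nrm nx < e).
  by rewrite ler_wpM2r ?nrm_ge0// ler_wpM2l.
have -> : 2 * (2 * (e / (4 * (nrm nx + 1)))) * nrm nx = e * (nrm nx / (nrm nx + 1)).
  by have := nrm_ge0 nx => ?; field; lra.
by rewrite gtr_pMr// ltr_pdivrMr ?mul1r ?ltrDl// ltr_wpDl// nrm_ge0.
Qed.

Lemma defining_small (e : R) : 0 < e -> exists2 r : R, 0 < r &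
  forall p, Omega p -> nrm (p - x) < r -> 0 < - rho (toR p) < e.
Proof.
move=> e0; have [r0 r00 hU] := openU Ux.
have := differentiable_continuous (diff_rho Ux).
move/(@cvgrPdist_lt _ _ _ _ (nbhs_filter _)) => /(_ _ e0)/nbhs_rV_norm[dl dl0 h].
exists (Num.min r0 dl); first by rewrite lt_min r00.
move=> p Op; rewrite lt_min -/(nrm _) {1 2}/nrm toRB => /andP[/hU Up /h].
have : rho (toR p) < 0 by apply/(rho_lt0 Up); rewrite toRK.
rewrite rhox sub0r normrN => ?; rewrite ltr_norml; lra.
Qed.

(* The key disk: near p the domain contains the part of the complex line
   p + C (dir p) where Re W > M0 |W - dl|^(1 + alpha) up to constants, W being the
   complex parameter shifted by dl = - rho p. *)
Let vertical_metric (p : Cd) (r N C1 s t : R) : Omega p ->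
  (forall v, `|v - toR p| < r -> U v) -> l (toR p) (dir p) = - 1 -> 0 < r -> 0 < N ->
  nrm (dir p) <= N -> M0 * (2 * N) * (4 * (2 * N) + 1) <= C1 -> 0 < C1 ->
  2 * N / (8 * C1) < r -> - rho (toR p) <= s -> s <= 1 ->
  32 * C1 * s `^ alpha <= 1 / 2 -> 0 < t ->
  let z := p + (s + rho (toR p))%:C%C *: dir p in
  Omega z /\ kobayashi_metric Omega z (t%:C%C *: dir p) <=
    t * (1 / (2 * s) + 32 * C1 * (s `^ alpha / s)).
Proof.
move=> Op hU lp r0 N0 dN C1M C10 C1r dls s1 sC t0 z.
have Up : U (toR p) by apply: hU; rewrite subrr normr0.
pose dl := - rho (toR p).
have dl0 : 0 < dl by rewrite oppr_gt0; apply/(rho_lt0 Up); rewrite toRK.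
have s0 : 0 < s by exact: lt_le_trans dls.
pose b := 1 - 32 * C1 * s `^ alpha.
have P0 : 0 < 32 * C1 * s `^ alpha by rewrite !mulr_gt0// powR_gt0.
have b0 : 1 / 2 <= b by rewrite /b; lra.
have b1 : b < 1 by rewrite /b; lra.
pose k (ze : R[i]) := s%:C%C * ((1 + b%:C%C * ze) * (1 - b%:C%C * ze)^-1).
have nzk ze : normc ze < 1 -> 1 - b%:C%C * ze != 0.
  move=> z1; rewrite -normc_gt0.
  by have [] := moebius_bounds dl0 dls (le_trans (divr_ge0 ler01 (ler0n _ 2)) b0) b1 z1.
have [K [lD lZ _ _]] := l_clinear (toR p).
have Ok ze : normc ze < 1 -> Omega (p - dl%:C%C *: dir p + k ze *: dir p).
  move=> z1; have [D0 D2 bD qb Rb] := moebius_bounds dl0 dls (le_trans (divr_ge0 ler01 (ler0n _ 2)) b0) b1 z1.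
  set D := normc (_ - _) in D0 D2 bD qb Rb; rewrite -/(k ze) in qb Rb.
  set q := normc (k ze - dl%:C%C) in qb.
  have N20 : 0 < 2 * N by rewrite mulr_gt0.
  have bE : 1 - b = 32 * C1 * s `^ alpha by rewrite /b; ring.
  have [Nq hlt] := @holder_disk_real _ _ halpha s D q b C1 M0 (2 * N) s0 s1 D0 D2 (normc_ge0 _) qb
    M00 N20 C1M C10 (le_trans (divr_ge0 ler01 (ler0n _ 2)) b0) bE bD.
  pose g := (k ze - dl%:C%C) *: dir p.
  have -> : p - dl%:C%C *: dir p + k ze *: dir p = p + g.
    by rewrite /g scalerBl addrAC addrA.
  have gN : nrm g <= 2 * N * q.
    apply: le_trans (nrmZ _ _) _; rewrite -/q [2 * N * q]mulrAC.
    by rewrite ler_wpM2l// mulr_ge0// normc_ge0.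
  have Us (sg : R) : 0 <= sg <= 1 -> U (toR p + sg *: toR g).
    move=> /andP[sg0 sg1]; apply: hU; rewrite addrAC subrr add0r normrZ ger0_norm//.
    apply: le_lt_trans C1r; apply: le_trans Nq; apply: le_trans gN.
    by rewrite ler_piMl// nrm_ge0.
  have Ug : U (toR (p + g)) by have := Us 1; rewrite scale1r toRD; apply; rewrite ler01 lexx.
  rewrite -[p + g]toRK; apply/(rho_lt0 Ug).
  have := rho_taylor Us; rewrite -toRD.
  have -> : 'd rho (toR p) (toR g) = - (Re (k ze) - dl).
    by rewrite -lE /g lZ lp mulrN1 ReNc ReDc ReNc.
  rewrite -/(nrm g) => ht.
  have : M0 * nrm g `^ alpha * nrm g <= M0 * (2 * N * q) `^ alpha * (2 * N * q).
    apply: ler_pM; rewrite ?nrm_ge0 ?mulr_ge0 ?powR_ge0 ?(ltW M00)//.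
    by rewrite ler_wpM2l ?(ltW M00)// powR_mono// nrm_ge0.
  move: ht; rewrite ler_norml => /andP[_ ht]; rewrite /dl in ht; lra.
have k0 : k 0 = s%:C%C by rewrite /k mulr0 addr0 subr0 invr1 !mulr1.
have zE : z = p - dl%:C%C *: dir p + k 0 *: dir p.
  by rewrite k0 /z /dl rmorphD rmorphN scaleNr opprK scalerDl addrAC addrA.
have n0 : normc (0 : R[i]) < 1 by rewrite normc0.
split; first by rewrite zE; exact: Ok.
have dk ze : normc ze < 1 -> derivable k ze 1.
  by move=> /nzk nz; have [] := moebius_derive s%:C%C nz.
(* The model disk has velocity 2 s b at its centre, so this multiple realises t dir p. *)
have := kobayashi_metric_disk (t / (2 * s * b))%:C%C dk Ok.
rewrite -zE (moebius_derive s%:C%C (nzk _ n0)).2//.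
have -> : (t / (2 * s * b))%:C%C * (2 * s%:C%C * b%:C%C) = t%:C%C.
  have -> : 2 * s%:C%C * b%:C%C = (2 * s * b)%:C%C by rewrite !rmorphM rmorphMn /=.
  by rewrite -rmorphM /= divfK// !mulf_neq0// gt_eqF//; lra.
move=> h; apply: le_trans h _; rewrite normc_real ger0_norm; last first.
  by rewrite divr_ge0 ?(ltW t0)// !mulr_ge0 ?(ltW s0)//; lra.
have b0' : 0 < b by lra.
have -> : t / (2 * s * b) = t / (2 * s) * b^-1 by field; rewrite !gt_eqF.
have binv : b^-1 <= 1 + 2 * (32 * C1 * s `^ alpha).
  rewrite -[b^-1]mul1r ler_pdivrMr//.
  have -> : 32 * C1 * s `^ alpha = 1 - b by rewrite /b; ring.
  nra.
apply: le_trans (ler_wpM2l _ binv) _; first by rewrite divr_ge0 ?mulr_ge0 ?(ltW t0) ?(ltW s0).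
by rewrite le_eqVlt; apply/orP; left; apply/eqP; field; rewrite gt_eqF.
Qed.

(** The height s = dl + sg t runs from dl to dl + t, and 1 / (2 s) + O(s^(alpha - 1)) is integrated
    over it. The error contributes at most 1 / (2 alpha), whatever p and t. *)
Lemma defining_upper : exists (n : Cd -> Cd) (t0 C r : R),
  [/\ 0 < t0, 0 < r,
    forall p, Omega p -> nrm (p - x) < r -> forall t, 0 < t -> t <= t0 -> - rho (toR p) <= t ->
      seg_bound Omega p (p + t%:C%C *: n p) (1 / 2 * ln (2 * t / - rho (toR p)) + C),
    forall t, 0 < t -> t <= t0 -> Omega (x + t%:C%C *: n x) &
    forall e : R, 0 < e -> exists2 r' : R, 0 < r' &
      forall p, nrm (p - x) < r' -> nrm (n p - n x) < e].
Proof.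
have /andP[a0 a1] := halpha.
have [r [N [r0 N0 hr]]] := near_dir.
have [r1 r10 hs] := defining_small ltr01.
(* The first summand is the requirement of [holder_disk_real] for 2 N, the 2 being that of [nrmZ];
   the second keeps the disk within r of p. *)
pose C1 := M0 * (2 * N) * (4 * (2 * N) + 1) + 2 * N / (8 * r) + 1.
have MN0 : 0 < M0 * (2 * N) * (4 * (2 * N) + 1) by rewrite !mulr_gt0//; lra.
have Nr0 : 0 < 2 * N / (8 * r) by rewrite divr_gt0 ?mulr_gt0.
have C10 : 0 < C1 by rewrite /C1; lra.
have C1M : M0 * (2 * N) * (4 * (2 * N) + 1) <= C1 by rewrite /C1; lra.
have C1r : 2 * N / (8 * C1) < r.
  rewrite ltr_pdivrMr ?mulr_gt0//.
  have : 2 * N / (8 * r) * (8 * r) < C1 * (8 * r) by rewrite ltr_pM2r ?mulr_gt0//; rewrite /C1; lra.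
  by rewrite divfK ?gt_eqF ?mulr_gt0//; lra.
have c640 : 0 < 1 / (64 * C1) by rewrite divr_gt0// mulr_gt0.
have [r2 r20 h2] := powR_small halpha c640.
(* Makes the Taylor remainder at x + t dir x at most t / 2. *)
have c3 : 0 < 1 / (2 * (M0 * N)) by rewrite divr_gt0// !mulr_gt0.
have [r3 r30 h3] := powR_small halpha c3.
(* Heights reach 2 t, which the first two bounds keep below 1 and r2. The last two serve the Taylor
   estimate at x + t dir x. *)
pose t0 := Num.min (Num.min (1 / 2) (r2 / 2)) (Num.min (r3 / N) (r / (2 * N))).
have t00 : 0 < t0 by rewrite !lt_min !divr_gt0// mulr_gt0.
exists dir, t0, (1 / (2 * alpha)), (Num.min r r1); split => //.
- by rewrite lt_min r0.
- move=> p Op; rewrite lt_min => /andP[pr pr1] t t0' tt0 dt.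
  have [hU lp dN] := hr _ pr; have /andP[dl0 _] := hs _ Op pr1.
  have : t <= t0 := tt0; rewrite !le_min => /andP[/andP[t1 t2] _].
  set dl := - rho (toR p) in dl0 dt *.
  have sp (sg : R) : 0 <= sg <= 1 -> [/\ 0 < dl + sg * t, dl <= dl + sg * t,
      dl + sg * t <= 1, dl + sg * t <= r2 & dl + sg * t <= 2 * t].
    move=> /andP[sg0 sg1]; have k1 : 0 <= sg * t by rewrite mulr_ge0// ltW.
    have k2 : sg * t <= t by rewrite ler_piMl// ltW.
    have le2 : dl + sg * t <= 2 * t by rewrite mulr2n mulrDl mul1r lerD.
    split=> //; first exact: ltr_wpDr.
    - by rewrite lerDl.
    - by apply: le_trans le2 _; rewrite mulrC -ler_pdivlMr.
    by apply: le_trans le2 _; rewrite mulrC -ler_pdivlMr.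
  have sa (sg : R) : 0 <= sg <= 1 -> (dl + sg * t) `^ alpha <= 1 / (64 * C1).
    by move=> /sp[h _ _ ? _]; apply: h2 => //; exact: ltW.
  pose phi (sg : R) := t * (1 / 2 * (dl + sg * t)^-1 +
     32 * C1 * ((dl + sg * t) `^ alpha * (dl + sg * t)^-1)).
  pose Phi (sg : R) := 1 / 2 * ln (dl + sg * t) + 32 * C1 / alpha * (dl + sg * t) `^ alpha.
  have daff (sg : R) : is_derive sg 1 (fun sg : R => dl + sg * t) t.
    by apply: is_derive_eq; rewrite /GRing.scale /=; ring.
  have dpow (sg : R) : 0 <= sg <= 1 -> is_derive sg 1 (fun sg : R => (dl + sg * t) `^ alpha)
      (alpha * (dl + sg * t) `^ (alpha - 1) * t).
    move=> /sp[h _ _ _ _].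
    have H := @is_derive1_comp _ (fun y : R => y `^ alpha) (fun sg : R => dl + sg * t) sg _ _
      (@is_derive1_powR _ alpha _ h) (daff sg).
    by apply: (is_derive_eq H); ring.
  exists Phi, phi; split.
  + move=> sg /[dup] sg01 /sp[h _ _ _ _].
    have ca : {for sg, continuous (fun sg : R => dl + sg * t)}.
      by apply/differentiable_continuous/derivable1_diffP; have [] := daff sg.
    have cp : {for sg, continuous (fun sg : R => (dl + sg * t) `^ alpha)}.
      by apply/differentiable_continuous/derivable1_diffP; have [] := dpow sg sg01.
    have ci : {for sg, continuous (fun sg : R => (dl + sg * t)^-1)}.
      by apply: (@continuousV _ _ (fun sg : R => dl + sg * t)) => //; rewrite gt_eqF.
    apply: (cvgM (cvg_cst _)); apply: cvgD; apply: (cvgM (cvg_cst _)) => //.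
    exact: cvgM cp ci.
  + move=> sg /[dup] sg01 /sp[h _ _ _ _].
    have d1 := @is_derive1_comp _ (@ln R) (fun sg : R => dl + sg * t) sg _ _
      (is_derive1_ln h) (daff sg).
    have d2 := dpow sg sg01.
    apply: is_derive_eq; rewrite /phi /GRing.scale /=.
    rewrite -(mulr_powRB1 (ltW h) a0); field.
    by rewrite !gt_eqF.
  + move=> sg /[dup] sg01 /sp[h k1 k2 k3 k4].
    rewrite addrAC subrr add0r.
    have sC : 32 * C1 * (dl + sg * t) `^ alpha <= 1 / 2.
      have := sa _ sg01; rewrite ler_pdivlMr ?mulr_gt0//; lra.
    have [] := @vertical_metric p r N C1 (dl + sg * t) t Op hU lp r0 N0 dN C1M C10 C1r k1 k2 sC t0'.
    have -> : dl + sg * t + rho (toR p) = sg * t by rewrite /dl; ring.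
    rewrite rmorphM /= -scalerA => H1 H2; split => //.
    by apply: le_trans H2 _; rewrite /phi invfM !mul1r.
  rewrite /Phi mul0r addr0 !mul1r.
  have h01 : 0 <= (1 : R) <= 1 by rewrite lexx ler01.
  have [h _ _ _ k4] := sp _ h01; rewrite mul1r in h k4.
  have k5 := sa _ h01; rewrite mul1r in k5.
  rewrite ln_div ?posrE ?mulr_gt0//.
  have k6 : ln (dl + t) <= ln (2 * t) by rewrite ler_ln ?posrE// mulr_gt0.
  have k7 : 0 <= 32 * C1 / alpha * dl `^ alpha by rewrite mulr_ge0 ?powR_ge0// divr_ge0 ?mulr_ge0// ltW.
  have k8 : 32 * C1 / alpha * (dl + t) `^ alpha <= 1 / (2 * alpha).
    have -> : 1 / (2 * alpha) = 32 * C1 / alpha * (1 / (64 * C1)) by field; rewrite !gt_eqF.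
    by rewrite ler_wpM2l// divr_ge0 ?mulr_ge0// ltW.
  by lra.
- move=> t tt tt0.
  have xx : nrm (x - x) < r by rewrite subrr nrm0.
  have [hU lx dN] := hr _ xx.
  have : t <= t0 := tt0; rewrite !le_min => /andP[_ /andP[t3 t4]].
  rewrite ler_pdivlMr// in t3; rewrite ler_pdivlMr ?mulr_gt0// in t4.
  pose g := t%:C%C *: dir x.
  have gE : nrm g = t * nrm (dir x) by rewrite nrmZr gtr0_norm.
  have gN : nrm g <= t * N by rewrite gE ler_wpM2l// ltW.
  have Us (sg : R) : 0 <= sg <= 1 -> U (toR x + sg *: toR g).
    move=> /andP[sg0 sg1]; apply: hU; rewrite addrAC subrr add0r normrZ ger0_norm//.
    apply: le_lt_trans (_ : nrm g < r); first by rewrite ler_piMl// nrm_ge0.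
    by apply: le_lt_trans gN _; lra.
  have Ug : U (toR (x + g)) by have := Us 1; rewrite scale1r toRD; apply; rewrite ler01 lexx.
  rewrite -[x + _]toRK; apply/(rho_lt0 Ug).
  have := rho_taylor Us; rewrite -toRD -/(nrm g) rhox subr0.
  have [K [_ lZ _ _]] := l_clinear (toR x).
  have -> : 'd rho (toR x) (toR g) = - t.
    by rewrite -lE /g lZ lx mulrN1 ReNc.
  rewrite ler_norml => /andP[_ ht].
  have tN0 : 0 <= t * N by rewrite mulr_ge0 ?(ltW tt) ?(ltW N0).
  have k1 : nrm g `^ alpha <= 1 / (2 * (M0 * N)).
    by apply: le_trans (powR_mono halpha (nrm_ge0 _) gN) _; exact: h3.
  have : M0 * nrm g `^ alpha * nrm g <= M0 * (1 / (2 * (M0 * N))) * (t * N).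
    apply: ler_pM; rewrite ?nrm_ge0 ?mulr_ge0 ?powR_ge0 ?(ltW M00)//.
    by rewrite ler_wpM2l ?(ltW M00).
  have -> : M0 * (1 / (2 * (M0 * N))) * (t * N) = t / 2 by field; rewrite !gt_eqF.
  by lra.
by move=> e e0; rewrite dirx; exact: dir_continuous.
Qed.

(** The sign makes its real part positive on Omega once its value at the boundary point u is
    subtracted. Its kernel is the complex tangent direction. *)
Definition tangent_form (u : V) (z : Cd) : R[i] := - clin ('d rho u) z.

Lemma tangent_form_clinear u : exists K, clinear (tangent_form u) K.
Proof.
have [K lK] := l_clinear u; have [lD lZ K0 lb] := lK; exists K; split => //.
- by move=> z w; rewrite /tangent_form -/(l u _) lD opprD.
- by move=> c z; rewrite /tangent_form -/(l u _) lZ mulrN.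
- by move=> z; rewrite normcN; exact: lb.
Qed.

(* The functional of the supporting complex hyperplane at a boundary point x' with
   |x' - p| = O(- rho p). *)
Lemma defining_lower (B e : R) : (forall z, Omega z -> nrm (z - x) <= B) -> 0 < e ->
  exists2 r : R, 0 < r & forall p, Omega p -> nrm (p - x) < r ->
    exists lp kp K, [/\ clinear lp K, forall z, Omega z -> 0 < Re (lp z + kp),
      normc (lp p + kp) <= 4 * - rho (toR p) &
      forall z, Omega z ->
        normc ((lp z + kp) - (tangent_form (toR x) z - tangent_form (toR x) x)) <= e].
Proof.
move=> hB e0; have /andP[a0 a1] := halpha.
have [r [N [r0 N0 hr]]] := near_dir.
have [Kx Kxl] := tangent_form_clinear (toR x); have [lxD lxZ Kx0 lxb] := Kxl.
have B0 : 0 <= `|B| := normr_ge0 _.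
(* Serves twice: the Taylor remainder at p - 2 dl dir p is at most 2/3 dl, and on dir p the forms at
   p and at the boundary point differ by at most 1. *)
have c1 : 0 < 1 / (3 * M0 * N) by rewrite divr_gt0// !mulr_gt0.
have [r1 r10 h1] := powR_small halpha c1.
have c2 : 0 < e / 2 / (3 * M0 * (`|B| + 1)) by rewrite !divr_gt0// !mulr_gt0// ltr_wpDl.
have [r2 r20 h2] := powR_small halpha c2.
have Kx1 : 0 < 2 * (Kx + 1) by lra.
(* m bounds the distance from x to the boundary point [u']. The entries r2 and e / (2 (Kx + 1))
   yield the two halves of e: the change of the form and the change of its base point. *)
pose m := Num.min (Num.min r r1) (Num.min (Num.min 1 r2) (e / (2 * (Kx + 1)))).
have m0 : 0 < m by rewrite !lt_min r0 r10 r20 ltr01 divr_gt0.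
have e3 : 0 < m / (8 * N) by rewrite divr_gt0// mulr_gt0.
have [r3 r30 h3] := defining_small e3.
exists (Num.min r3 (m / 4)); first by rewrite lt_min r30 divr_gt0.
move=> p Op; rewrite lt_min => /andP[/(h3 _ Op)/andP[dl0 dle] pm].
have mle : [/\ m <= r, m <= r1, m <= 1, m <= r2 & m <= e / (2 * (Kx + 1))].
  by split; rewrite !ge_min lexx ?orbT.
have [mr mr1 m1 mr2 me] := mle.
have pr : nrm (p - x) < r by lra.
have [hU lp dN] := hr _ pr.
set dl := - rho (toR p) in dl0 dle *.
have dlN : 2 * dl * N <= m / 4.
  by rewrite ltr_pdivlMr ?mulr_gt0// in dle; lra.
have Up : U (toR p) by apply: hU; rewrite subrr normr0.
have near tau : 0 <= tau <= 2 * dl -> `|toR p - tau *: toR (dir p) - toR p| <= 2 * dl * N.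
  move=> /andP[tau0 tau1]; rewrite addrAC subrr add0r normrN normrZ ger0_norm//.
  by apply: ler_pM.
have Utau tau : 0 <= tau <= 2 * dl -> U (toR p - tau *: toR (dir p)).
  by move=> /near h; apply: hU; lra.
(* Backing off from p by 2 dl dir p raises rho from - dl by at least 2 dl - 2/3 dl, hence past 0;
   the intermediate value theorem gives the boundary point. *)
have [tau tau01 rtau] : exists2 tau, 0 <= tau <= 2 * dl & rho (toR p - tau *: toR (dir p)) = 0.
  have cr : {within `[0, 2 * dl], continuous (fun tau => rho (toR p - tau *: toR (dir p)))}.
    apply: continuous_in_subspaceT => tau; rewrite inE /= in_itv /= => ht.
    apply: (@continuous_comp _ _ _ (fun tau : R => toR p - tau *: toR (dir p)) rho).
      by apply: continuousB; [exact: cvg_cst|exact: scalel_continuous].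
    exact/differentiable_continuous/diff_rho/Utau.
  have dl20 : 0 <= 2 * dl by rewrite mulr_ge0// ltW.
  have rp : rho (toR p) = - dl by rewrite /dl opprK.
  have end_ : 0 <= rho (toR p - (2 * dl) *: toR (dir p)).
    pose h := - ((2 * dl) *: toR (dir p)).
    have Us (sg : R) : 0 <= sg <= 1 -> U (toR p + sg *: h).
      move=> /andP[sg0 sg1]; rewrite /h scalerN scalerA; apply: Utau.
      by rewrite mulr_ge0//= ler_piMl.
    have := rho_taylor Us; rewrite /h rp.
    have -> : 'd rho (toR p) (- ((2 * dl) *: toR (dir p))) = 2 * dl.
      have [AD AZ] := diff_rlinear rho (toR p).
      by rewrite -[- _]scaleN1r !AZ -lE lp /=; ring.
    set H := `|- _|; have HN : H <= 2 * dl * N.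
      by rewrite /H normrN normrZ ger0_norm//; apply: ler_wpM2l.
    have H0 : 0 <= H by exact: normr_ge0.
    have k1 : H `^ alpha <= 1 / (3 * M0 * N) by apply: h1 => //; lra.
    have : M0 * H `^ alpha * H <= M0 * (1 / (3 * M0 * N)) * (2 * dl * N).
      apply: ler_pM; rewrite ?mulr_ge0 ?powR_ge0 ?(ltW M00)//.
      by rewrite ler_wpM2l ?(ltW M00).
    have -> : M0 * (1 / (3 * M0 * N)) * (2 * dl * N) = 2 / 3 * dl by field; rewrite !gt_eqF.
    by rewrite ler_norml => k2 /andP[k3 _]; lra.
  have [|c] := @IVT R (fun tau => rho (toR p - tau *: toR (dir p))) 0 (2 * dl) 0 dl20 cr.
    rewrite scale0r subr0 rp; apply/andP; split.
      by rewrite ge_min; apply/orP; left; lra.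
    by rewrite le_max end_ orbT.
  by rewrite in_itv /= => hc ec; exists c.
pose u' := toR p - tau *: toR (dir p).
have Uu : U u' := Utau _ tau01.
have up : `|u' - toR p| <= 2 * dl * N := near _ tau01.
have ux : `|u' - toR x| <= m.
  have -> : u' - toR x = (u' - toR p) + toR (p - x) by rewrite toRB addrA subrK.
  by apply: le_trans (ler_normD _ _) _; rewrite -/(nrm _); lra.
have [K lK] := tangent_form_clinear u'; have [lD lZ K0 lb] := lK.
exists (tangent_form u'), (- tangent_form u' (toC u')), K; split => //.
- move=> z Oz; rewrite -(clinearB z (toC u') lK) /tangent_form ReNc clinE ?toRB ?toCK.
    by rewrite oppr_gt0; exact: (defining_support oO cO hdef Uu rtau Oz).
  exact: diff_rlinear.
- rewrite -(clinearB p (toC u') lK).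
  have -> : p - toC u' = tau%:C%C *: dir p.
    by rewrite /u' toCB toCZ !toRK opprB addrCA subrr addr0.
  rewrite lZ normcM normc_real ger0_norm; last by case/andP: tau01.
  (* With tau <= 2 dl this is where the factor 4 comes from. *)
  have k1 : normc (tangent_form u' (dir p)) <= 2.
    have := l_hoelder (dir p) Uu Up; rewrite lp opprK => k1.
    have k2 : `|u' - toR p| `^ alpha <= 1 / (3 * M0 * N) by apply: h1 => //; lra.
    have k3 : 3 * M0 * `|u' - toR p| `^ alpha * nrm (dir p) <= 3 * M0 * (1 / (3 * M0 * N)) * N.
      apply: ler_pM; rewrite ?nrm_ge0 ?mulr_ge0 ?powR_ge0 ?(ltW M00)//.
      by rewrite ler_wpM2l// mulr_ge0// ltW.
    have k4 : 3 * M0 * (1 / (3 * M0 * N)) * N = 1 by field; rewrite !gt_eqF.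
    rewrite /tangent_form normcN.
    have := normcB (l u' (dir p) + 1) 1; rewrite addrK normc1 /l; rewrite /l in k1; lra.
  have /andP[tau0 tau1] := tau01.
  apply: le_trans (_ : 2 * dl * 2 <= _); last by lra.
  by apply: ler_pM => //; exact: normc_ge0.
move=> z Oz.
have -> : tangent_form u' z - tangent_form u' (toC u')
     - (tangent_form (toR x) z - tangent_form (toR x) x) =
   (tangent_form u' (z - toC u') - tangent_form (toR x) (z - toC u'))
   - tangent_form (toR x) (toC u' - x).
  exact: clinear_sub_shift lK Kxl.
apply: le_trans (normcB _ _) _.
have nu : nrm (toC u' - x) <= m by rewrite /nrm toRB toCK.
have k1 : normc (tangent_form u' (z - toC u') - tangent_form (toR x) (z - toC u')) <= e / 2.
  have := l_hoelder (z - toC u') Uu Ux; rewrite /l => k1.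
  rewrite /tangent_form -opprB opprK normcN addrC; apply: le_trans k1 _.
  have k2 : `|u' - toR x| `^ alpha <= e / 2 / (3 * M0 * (`|B| + 1)) by apply: h2 => //; lra.
  have k3 : nrm (z - toC u') <= `|B| + 1.
    have -> : z - toC u' = (z - x) - (toC u' - x) by rewrite opprB addrA subrK.
    apply: le_trans (nrmB _ _) _; have := hB _ Oz; have := ler_norm B; lra.
  apply: le_trans (_ : 3 * M0 * (e / 2 / (3 * M0 * (`|B| + 1))) * (`|B| + 1) <= _).
    apply: ler_pM; rewrite ?nrm_ge0 ?mulr_ge0 ?powR_ge0 ?(ltW M00)//.
    by rewrite ler_wpM2l// mulr_ge0// ltW.
  rewrite le_eqVlt; apply/orP; left; apply/eqP; field.
  by rewrite !gt_eqF// ltr_wpDl.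
have k2 : normc (tangent_form (toR x) (toC u' - x)) <= e / 2.
  apply: le_trans (lxb _) _.
  apply: le_trans (_ : (Kx + 1) * (e / (2 * (Kx + 1))) <= _).
    by apply: ler_pM; rewrite ?nrm_ge0 ?lerDl ?(le_trans nu).
  by rewrite le_eqVlt; apply/orP; left; apply/eqP; field; lra.
by lra.
Qed.

End Hoelder.

(** * Tangent hyperplanes and the Gromov product *)

(** 32 is the 2 of [cutoff_le] times 4^2. The coefficient 2 of ln delta becomes 1/2 after
    multiplication by 4^-1. *)
Lemma cutoff_log {R : realType} {d : nat} (l : 'rV[R[i]]_d -> R[i]) (k : R[i]) (z : 'rV[R[i]]_d)
    (m delta : R) : 0 < m -> 0 < delta -> 0 < Re (l z + k) -> normc (l z + k) <= 4 * delta ->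
  cutoff m (sqmod l k z) <= 2 * ln delta + ln (32 / m).
Proof.
move=> m0 d0 pos le.
have n0 : 0 < normc (l z + k).
  by apply: lt_le_trans pos _; apply: le_trans (normc_Re _); rewrite ler_norm.
have s0 : 0 < sqmod l k z by rewrite /sqmod exprn_gt0.
apply: le_trans (cutoff_le m0 s0) _.
have -> : 2 * ln delta + ln (32 / m) = ln (delta ^+ 2 * (32 / m)).
  by rewrite lnM ?posrE ?exprn_gt0 ?divr_gt0// lnXn// mulr_natl.
rewrite ler_ln ?posrE ?mulr_gt0 ?exprn_gt0 ?divr_gt0 ?invr_gt0 //.
have le2 : sqmod l k z <= 16 * delta ^+ 2.
  have -> : 16 * delta ^+ 2 = (4 * delta) ^+ 2 by ring.
  by rewrite /sqmod lerXn2r ?nnegrE ?(ltW n0) ?mulr_ge0 ?(ltW d0).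
have -> : delta ^+ 2 * (32 / m) = 2 * (16 * delta ^+ 2) / m by field; rewrite gt_eqF.
by rewrite ler_pM2r ?invr_gt0// ler_pM2l.
Qed.

Section Tangent.
Context {R : realType} {d : nat}.
Implicit Types (Omega : set 'rV[R[i]]_d) (x z : 'rV[R[i]]_d).

Lemma tangent_form_eq0 (rho : 'rV[R]_(d + d) -> R) u z :
  tangent_form rho u z = 0 <-> 'd rho u (toR z) = 0 /\ 'd rho u (toR ('i%C *: z)) = 0.
Proof.
rewrite /tangent_form /clin; split.
  by move/eqP; rewrite oppr_eq0 => /eqP[-> /eqP]; rewrite oppr_eq0 => /eqP ->.
by move=> [-> ->]; rewrite oppr0; apply/eqP; rewrite oppr_eq0.
Qed.

(** The definition quantifies existentially over defining functions; the differentials of two of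
    them both support Omega at x, so [support_unique] makes one a multiple of the other. *)
Lemma real_tangentE Omega x (U : set 'rV[R]_(d + d)) (rho : 'rV[R]_(d + d) -> R) :
  open Omega -> convex_set Omega -> bdry Omega x -> U (toR x) -> C1_defining Omega U rho ->
  forall v, real_tangent Omega x v <-> 'd rho (toR x) (toR v) = 0.
Proof.
move=> oO cO bx Ux hdef v; split; last by move=> e; exists U, rho.
move=> [U' [rho' [Ux' hdef' e]]].
have [lam ->] := support_unique hdef' Ux' (bdry_zero oO hdef' Ux' bx) (diff_rlinear rho (toR x))
  (fun z hz => ltW (defining_support oO cO hdef Ux (bdry_zero oO hdef Ux bx) hz)).
by rewrite e mulr0.
Qed.

Lemma complex_tangentE Omega x (U : set 'rV[R]_(d + d)) (rho : 'rV[R]_(d + d) -> R) :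
  open Omega -> convex_set Omega -> bdry Omega x -> U (toR x) -> C1_defining Omega U rho ->
  complex_tangent Omega x = [set z | tangent_form rho (toR x) (z - x) = 0].
Proof.
move=> oO cO bx Ux hdef; apply/seteqP.
have E := real_tangentE oO cO bx Ux hdef.
by split=> z; rewrite /complex_tangent /= tangent_form_eq0 !E.
Qed.

Lemma tangent_form_Re (rho : 'rV[R]_(d + d) -> R) u z :
  Re (tangent_form rho u z) = - 'd rho u (toR z).
Proof. by []. Qed.

Lemma clin_scale (A B : 'rV[R]_(d + d) -> R) (lam : R) :
  (forall h, A h = lam * B h) -> forall z, clin A z = lam%:C%C * clin B z.
Proof.
move=> h z; rewrite /clin; rewrite (h (toR z)) (h (toR ('i%C *: z))).
by rewrite /real_complex_def; apply/eqP; rewrite eq_complex /=; apply/andP; split; apply/eqP; ring.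
Qed.

Lemma tangent_formZ (rho rho' : 'rV[R]_(d + d) -> R) u u' (lam : R) :
  (forall h, 'd rho u h = lam * 'd rho' u' h) ->
  forall z, tangent_form rho u z = lam%:C%C * tangent_form rho' u' z.
Proof.
move=> h z.
exact: etrans (congr1 -%R (@clin_scale ('d rho u) ('d rho' u') lam h z)) (esym (mulrN _ _)).
Qed.

End Tangent.

Section Separation.
Context {R : realType} {d : nat}.
Local Notation Cd := 'rV[R[i]]_d.
Implicit Types (Omega : set Cd) (x z w : Cd).

Lemma bounded_nrm Omega : bounded_set Omega ->
  exists B : R, forall z, Omega z -> nrm z <= B.
Proof.
move=> [M [Mr hM]]; exists (normc M + 1) => z hz; apply: nrm_le_cnorm; apply: hM hz.
by apply: le_lt_trans (real_ler_norm Mr) _; rewrite normr_normc ltcR ltrDl ltr01.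
Qed.

(** The differential at x vanishes on w - x, hence supports Omega at w as well. By uniqueness of the
    support at w it is a nonzero multiple of the differential there, and the complex forms inherit
    the factor. *)
Lemma complex_tangent_eq Omega (alpha : R) x w
    (U : set 'rV[R]_(d + d)) (rho : 'rV[R]_(d + d) -> R) :
  open Omega -> convex_set Omega -> C1alpha_boundary alpha Omega ->
  bdry Omega x -> U (toR x) -> C1_defining Omega U rho -> closure Omega w ->
  tangent_form rho (toR x) (w - x) = 0 ->
  bdry Omega w /\ complex_tangent Omega x = complex_tangent Omega w.
Proof.
move=> oO cO hO bx Ux hdef cw tw.
have ww : 'd rho (toR x) (toR w - toR x) = 0.
  by rewrite -toRB; have [] := (tangent_form_eq0 rho (toR x) (w - x)).1 tw.
have sup := defining_support oO cO hdef Ux (bdry_zero oO hdef Ux bx).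
have bw : bdry Omega w.
  by split=> // /interior_subset /sup; rewrite ww ltxx.
split; first exact: bw.
have [U' [rho' [M [Uw hdef' _]]]] := hO w bw.
have [AD AZ] := diff_rlinear rho (toR x).
have [lam hlam] : exists lam, forall h, 'd rho (toR x) h = lam * 'd rho' (toR w) h.
  apply: (support_unique hdef' Uw (bdry_zero oO hdef' Uw bw) (diff_rlinear rho (toR x))) => z hz.
  have -> : toR z - toR w = (toR z - toR x) + (-1) *: (toR w - toR x).
    by rewrite scaleN1r opprB addrA subrK.
  have -> := AD (toR z - toR x) (-1 *: (toR w - toR x)).
  have -> := AZ (-1) (toR w - toR x).
  by rewrite ww mulr0 addr0; apply: ltW; exact: sup.
have lam0 : lam != 0.
  apply/eqP => l0; have [h] := diff_neg hdef Ux; have -> := hlam h.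
  by rewrite l0 mul0r => /eqP; rewrite eq_sym oppr_eq0 oner_eq0.
rewrite (complex_tangentE oO cO bx Ux hdef) (complex_tangentE oO cO bw Uw hdef').
have [K [lD _ _ _]] := tangent_form_clinear rho (toR x).
have E z : tangent_form rho (toR x) (z - x) = lam%:C%C * tangent_form rho' (toR w) (z - w).
  rewrite -(tangent_formZ hlam); have -> : z - x = (z - w) + (w - x) by rewrite addrA subrK.
  by have -> := lD (z - w) (w - x); rewrite tw addr0.
have lC0 : lam%:C%C != 0 :> R[i] by rewrite fmorph_eq0.
apply/seteqP; split => z /=; rewrite E; last by move=> ->; rewrite mulr0.
by move/eqP; rewrite mulf_eq0 (negPf lC0) => /eqP.
Qed.

(** The sum of the squared moduli has no zero on the closure of Omega, which is compact when read in
    R^(2d); c is its minimum there. *)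
Lemma sqmod_separation Omega (B K1 K2 : R) (l1 l2 : Cd -> R[i]) k1 k2 :
  (forall z, Omega z -> nrm z <= B) -> Omega !=set0 -> clinear l1 K1 -> clinear l2 K2 ->
  (forall w, closure Omega w -> l1 w + k1 = 0 -> l2 w + k2 <> 0) ->
  exists2 c : R, 0 < c & forall z, Omega z -> c <= sqmod l1 k1 z + sqmod l2 k2 z.
Proof.
move=> hB [z0 z0O] l1K l2K h.
pose S : set 'rV[R]_(d + d) := closure [set u | Omega (toC u)].
have near_S u (e : R) : S u -> 0 < e -> exists2 v, Omega (toC v) & `|v - u| < e.
  move=> Su e0; have [v [/= vO]] := Su _ (nbhsx_ballx u e e0).
  by rewrite -ball_normE /= distrC => ?; exists v.
have Sb : bounded_set S.
  exists (B + 1); split; first exact: num_real.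
  move=> M BM u Su; have [v vO vu] := near_S u 1 Su ltr01.
  have -> : u = v - (v - u) by rewrite subKr.
  apply: le_trans (ler_normB _ _) _; apply: le_trans (ltW BM).
  by apply: lerD (ltW vu); have := hB _ vO; rewrite /nrm toCK.
have Sc : compact S by apply: bounded_closed_compact => //; exact: closed_closure.
have SO z : Omega z -> S (toR z).
  by move=> zO; apply: subset_closure; rewrite /= toRK.
pose f := (fun u => (sqmod l1 k1 \o toC) u + (sqmod l2 k2 \o toC) u) : 'rV[R]_(d + d) -> R.
have fc : {within S, continuous f}.
  apply: continuous_subspaceT => u.
  apply: continuousD; first exact: (@sqmod_continuous _ _ l1 K1 k1 l1K u).
  exact: (@sqmod_continuous _ _ l2 K2 k2 l2K u).
have [u uS hu] := EVT_min_rV (ex_intro _ (toR z0) (SO _ z0O)) Sc fc.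
have cu : closure Omega (toC u).
  apply/closure_nrm => e e0; rewrite inE in uS; have [v vO vu] := near_S u e uS e0.
  by exists (toC v) => //; rewrite /nrm toRB !toCK.
exists (f u).
  have : 0 <= f u by rewrite /f /sqmod /= addr_ge0 ?sqr_ge0.
  rewrite le_eqVlt => /orP[/eqP/esym|//].
  rewrite /f /sqmod /= => /eqP; rewrite paddr_eq0 ?sqr_ge0// !sqrf_eq0 => /andP[/eqP a0 /eqP b0].
  by case: (h _ cu (eq0_normc a0) (eq0_normc b0)).
move=> z zO; have := hu (toR z); rewrite inE => /(_ (SO _ zO)).
by rewrite {2}/f /= toRK.
Qed.

End Separation.

(** * Distance estimates near boundary points *)

Section Estimates.
Context {R : realType} {d : nat} {Omega : set 'rV[R[i]]_d} {alpha B : R}.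
Hypotheses (halpha : 0 < alpha <= 1) (oO : open Omega) (cO : convex_set Omega).
Hypotheses (hO : C1alpha_boundary alpha Omega) (hB : forall z, Omega z -> nrm z <= B).

Local Notation Kd := (kobayashi_dist Omega).

(** With a constant added, it fills the second place of [kobayashi_dist_ge] when a single boundary
    point is concerned. *)
Lemma clinear_cst0 : clinear (fun _ : 'rV[R[i]]_d => 0 : R[i]) (0 : R).
Proof.
by split=> // [z w|c z|z]; rewrite ?addr0 ?mulr0 ?mul0r ?normc0.
Qed.

Section Chart.
Context {U : set 'rV[R]_(d + d)} {rho : 'rV[R]_(d + d) -> R} {M : R} {x : 'rV[R[i]]_d}.
Hypotheses (hdef : C1_defining Omega U rho) (Ux : U (toR x)) (bx : bdry Omega x).
Hypothesis hM : forall u u' h, U u -> U u' ->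
  `|'d rho u h - 'd rho u' h| <= M * `|u - u'| `^ alpha * `|h|.

Let rhox : rho (toR x) = 0 := bdry_zero oO hdef Ux bx.

Let hBx z : Omega z -> nrm (z - x) <= B + nrm x.
Proof. by move=> /hB h; apply: le_trans (nrmB _ _) _; rewrite lerD2r. Qed.

(** The functional depends on p but stays within e of the one at x, whose value at o has real part 2
    e. Its modulus at o is thus at least e, and the cutoff at level e^2 vanishes at o for all p.
    Both orders of the arguments are treated instead of proving symmetry of the distance. *)
Lemma kobayashi_dist_point_ge o : Omega o -> exists (C r : R), 0 < r /\
  forall p, Omega p -> nrm (p - x) < r ->
    - (2^-1 * ln (- rho (toR p))) - C <= Kd p o /\ - (2^-1 * ln (- rho (toR p))) - C <= Kd o p.
Proof.
move=> oo; have [K tK] := tangent_form_clinear rho (toR x).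
have k0 : 0 < Re (tangent_form rho (toR x) o - tangent_form rho (toR x) x).
  rewrite -(clinearB o x tK) tangent_form_Re oppr_gt0 toRB.
  exact: (defining_support oO cO hdef Ux rhox oo).
set D := tangent_form rho (toR x) o - _ in k0; pose e := Re D / 2.
have e0 : 0 < e by rewrite divr_gt0.
have m0 : 0 < e ^+ 2 by rewrite exprn_gt0.
have [r r0 hr] := defining_lower halpha oO cO hdef hM Ux rhox hBx e0.
have [r1 r10 hr1] := defining_small hdef Ux rhox ltr01.
exists (4^-1 * ln (32 / e ^+ 2)), (Num.min r r1); rewrite lt_min r0 r10; split=> // p pO.
rewrite lt_min => /andP[pr /(hr1 _ pO)/andP[d0 _]].
have [lp [kp [Kp [lK pos pp close]]]] := hr p pO pr.
have cutp := cutoff_log m0 d0 (pos p pO) pp.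
have cst (z : 'rV[R[i]]_d) : e ^+ 2 <= sqmod (fun _ => 0) e%:C%C z.
  by rewrite /sqmod add0r normc_real gtr0_norm.
have cut0 (z : 'rV[R[i]]_d) : cutoff (e ^+ 2) (sqmod (fun _ => 0) e%:C%C z) = 0 by apply: cutoff_ge.
have cuto : cutoff (e ^+ 2) (sqmod lp kp o) = 0.
  apply: cutoff_ge => //; rewrite /sqmod lerXn2r ?nnegrE ?normc_ge0 ?(ltW e0)//.
  apply: le_trans (normc_Re _); apply: le_trans (ler_norm _).
  have := close o oo; rewrite -/D -normcN opprB => c.
  have := le_trans (ler_norm _) (le_trans (normc_Re _) c); rewrite ReDc ReNc /e; lra.
have posc z : Omega z -> 0 < Re (0 + e%:C%C) by rewrite add0r.
split.
- have := kobayashi_dist_ge (k1 := kp) (k2 := e%:C%C) oO cO m0 lK clinear_cst0 pos posc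
    (fun z _ => or_intror (cst z)) pO oo.
  by apply: le_trans; rewrite !cut0 cuto; lra.
have := kobayashi_dist_ge (k2 := kp) (k1 := e%:C%C) oO cO m0 clinear_cst0 lK posc pos
    (fun z _ => or_introl (cst z)) oo pO.
by apply: le_trans; rewrite !cut0 cuto; lra.
Qed.

(** All p close to x are led into one fixed ball about c = x + t n x. The radii s and r depend on t,
    but C does not, which is what allows t to tend to 0 afterwards. *)
Lemma push_inside : exists (t0 C : R), 0 < t0 /\ forall t, 0 < t -> t <= t0 ->
  exists c (s r : R), [/\ Omega c, 0 < s, 0 < r, forall w, nrm (w - c) < s -> Omega w &
    forall p, Omega p -> nrm (p - x) < r -> 0 < - rho (toR p) /\
      exists p1, [/\ seg_bound Omega p p1 (2^-1 * ln (2 * t) - 2^-1 * ln (- rho (toR p)) + C),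
        nrm (p1 - c) < s / 2 & forall w, nrm (w - p1) < s / 2 -> Omega w]].
Proof.
have [n [t0 [C [r [t00 r0 hseg hc hn]]]]] := defining_upper halpha hdef hM Ux rhox.
exists t0, C; split=> // t tpos tt0.
have [s s0 hs] := (nbhs_nrm _ _).1 (open_nbhs_nbhs (conj oO (hc t tpos tt0))).
have es0 : 0 < s / 4 / t by rewrite !divr_gt0.
have [r1 r10 hr1] := hn _ es0.
have [r2 r20 hr2] := defining_small hdef Ux rhox tpos.
exists (x + t%:C%C *: n x), s, (Num.min (Num.min r r1) (Num.min r2 (s / 4))).
split=> //; first exact: hc.
  by rewrite !lt_min r0 r10 r20 divr_gt0.
move=> p pO; rewrite !lt_min => /andP[/andP[pr pr1] /andP[pr2 ps]].
have /andP[d0 dt] := hr2 p pO pr2; split=> //.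
exists (p + t%:C%C *: n p).
have close : nrm (p + t%:C%C *: n p - (x + t%:C%C *: n x)) < s / 2.
  rewrite opprD addrACA -scalerBr; apply: le_lt_trans (nrmD _ _) _; rewrite nrmZr (gtr0_norm tpos).
  have : t * nrm (n p - n x) < s / 4 by rewrite mulrC -ltr_pdivlMr //; exact: hr1.
  by lra.
split=> //.
- have := hseg p pO pr t tpos tt0 (ltW dt).
  have -> : ln (2 * t / - rho (toR p)) = ln (2 * t) - ln (- rho (toR p)).
    by rewrite ln_div ?posrE ?mulr_gt0.
  by congr seg_bound; field.
move=> w hw; apply: hs; rewrite -(subrKA (p + t%:C%C *: n p)).
apply: le_lt_trans (nrmD _ _) _; rewrite [ltRHS]splitr; exact: ltrD hw close.
Qed.

(** A fixed t is enough here: on the path p, p1, c, o only the first leg has a cost that is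
    unbounded in p. *)
Lemma kobayashi_dist_point_le o : Omega o -> exists (C r : R), 0 < r /\
  forall p, Omega p -> nrm (p - x) < r ->
    Kd p o <= - (2^-1 * ln (- rho (toR p))) + C /\ Kd o p <= - (2^-1 * ln (- rho (toR p))) + C.
Proof.
move=> oo; have [t0 [C [t00 h]]] := push_inside.
have [c [s [r [cc s0 r0 hs hr]]]] := h t0 t00 (lexx _).
have [L hL] := seg_bound_exists oO cO cc oo.
exists (2^-1 * ln (2 * t0) + C + 2 + L), r; split=> // p pO pr.
have [d0 [p1 [sb p1c hp1]]] := hr p pO pr.
have s20 : 0 < s / 2 by rewrite divr_gt0.
have hc w : nrm (w - c) < s / 2 -> Omega w by move=> ?; apply: hs; lra.
have sb2 := seg_bound_ball cO s20 hp1 hc.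
have le2 : 2 * nrm (c - p1) / (s / 2) <= 2.
  by rewrite ler_pdivrMr// nrm_distC; lra.
split.
- pose z (i : nat) := nth o [:: p; p1; c] i.
  pose l (i : nat) := nth L
    [:: 2^-1 * ln (2 * t0) - 2^-1 * ln (- rho (toR p)) + C; 2 * nrm (c - p1) / (s / 2)] i.
  have : forall i, (i < 3)%N -> seg_bound Omega (z i) (z i.+1) (l i) by move=> [|[|[|]]].
  by move=> /kobayashi_dist_le H; apply: le_trans H _; rewrite /l /=; lra.
pose z (i : nat) := nth p [:: o; c; p1] i.
pose l (i : nat) := nth (2^-1 * ln (2 * t0) - 2^-1 * ln (- rho (toR p)) + C)
  [:: L; 2 * nrm (c - p1) / (s / 2)] i.
have : forall i, (i < 3)%N -> seg_bound Omega (z i) (z i.+1) (l i).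
  by move=> [|[|[|]]] // _; exact: seg_bound_sym.
by move=> /kobayashi_dist_le H; apply: le_trans H _; rewrite /l /=; lra.
Qed.

(** Crossing from p1 to q1 costs at most 4 for every t, since both points have balls of radius s / 2
    in Omega and are less than s apart. The term ln (2 t) is the sum of the halves from the two
    outer legs. *)
Lemma kobayashi_dist_pair_le : exists (t0 C : R), 0 < t0 /\ forall t, 0 < t -> t <= t0 ->
  exists2 r : R, 0 < r & forall p q, Omega p -> Omega q -> nrm (p - x) < r -> nrm (q - x) < r ->
    Kd p q <= - (2^-1 * ln (- rho (toR p))) - 2^-1 * ln (- rho (toR q)) + ln (2 * t) + C.
Proof.
have [t0 [C [t00 h]]] := push_inside.
exists t0, (2 * C + 4); split=> // t tpos tt0.
have [c [s [r [cc s0 r0 hs hr]]]] := h t tpos tt0.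
exists r => // p q pO qO pr qr.
have [_ [p1 [sbp p1c hp1]]] := hr p pO pr.
have [_ [q1 [sbq q1c hq1]]] := hr q qO qr.
have s20 : 0 < s / 2 by rewrite divr_gt0.
have sb2 := seg_bound_ball cO s20 hp1 hq1.
have le2 : 2 * nrm (q1 - p1) / (s / 2) <= 4.
  rewrite ler_pdivrMr//; have : nrm (q1 - p1) <= nrm (q1 - c) + nrm (c - p1).
    by rewrite -(subrKA c); exact: nrmD.
  by rewrite (nrm_distC c); lra.
pose z (i : nat) := nth q [:: p; p1; q1] i.
pose l (i : nat) := nth (2^-1 * ln (2 * t) - 2^-1 * ln (- rho (toR q)) + C)
  [:: 2^-1 * ln (2 * t) - 2^-1 * ln (- rho (toR p)) + C; 2 * nrm (q1 - p1) / (s / 2)] i.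
have : forall i, (i < 3)%N -> seg_bound Omega (z i) (z i.+1) (l i).
  by move=> [|[|[|]]] // _; exact: seg_bound_sym.
by move=> /kobayashi_dist_le H; apply: le_trans H _; rewrite /l /=; lra.
Qed.

End Chart.

End Estimates.

Lemma tangent_separation {R : realType} {d : nat} (Omega : set 'rV[R[i]]_d) (alpha B : R)
    (U U' : set 'rV[R]_(d + d)) (rho rho' : 'rV[R]_(d + d) -> R) (x y : 'rV[R[i]]_d) :
  open Omega -> Omega !=set0 -> convex_set Omega -> C1alpha_boundary alpha Omega ->
  (forall z, Omega z -> nrm z <= B) ->
  C1_defining Omega U rho -> U (toR x) -> bdry Omega x ->
  C1_defining Omega U' rho' -> U' (toR y) -> bdry Omega y ->
  complex_tangent Omega x <> complex_tangent Omega y ->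
  exists2 c : R, 0 < c & forall z, Omega z ->
    c <= sqmod (tangent_form rho (toR x)) (- tangent_form rho (toR x) x) z +
      sqmod (tangent_form rho' (toR y)) (- tangent_form rho' (toR y) y) z.
Proof.
move=> oO O0 cO hO hB hdef Ux bx hdef' Uy by_ neq.
have [K tK] := tangent_form_clinear rho (toR x).
have [K' tK'] := tangent_form_clinear rho' (toR y).
apply: (sqmod_separation hB O0 tK tK') => w cw zx zy; apply: neq.
have [_ ->] := complex_tangent_eq oO cO hO bx Ux hdef cw (etrans (clinearB w x tK) zx).
by have [_ ->] := complex_tangent_eq oO cO hO by_ Uy hdef' cw (etrans (clinearB w y tK') zy).
Qed.

Lemma kobayashi_dist_apart {R : realType} {d : nat} (Omega : set 'rV[R[i]]_d) (alpha B M M' c : R)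
    (U U' : set 'rV[R]_(d + d)) (rho rho' : 'rV[R]_(d + d) -> R) (x y : 'rV[R[i]]_d) :
  0 < alpha <= 1 -> open Omega -> convex_set Omega ->
  (forall z, Omega z -> nrm z <= B) ->
  C1_defining Omega U rho -> U (toR x) -> bdry Omega x ->
  (forall u u' h, U u -> U u' ->
     `|'d rho u h - 'd rho u' h| <= M * `|u - u'| `^ alpha * `|h|) ->
  C1_defining Omega U' rho' -> U' (toR y) -> bdry Omega y ->
  (forall u u' h, U' u -> U' u' ->
     `|'d rho' u h - 'd rho' u' h| <= M' * `|u - u'| `^ alpha * `|h|) ->
  0 < c -> (forall z, Omega z ->
    c <= sqmod (tangent_form rho (toR x)) (- tangent_form rho (toR x) x) z +
    sqmod (tangent_form rho' (toR y)) (- tangent_form rho' (toR y) y) z) ->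
  exists (C r : R), 0 < r /\ forall p q, Omega p -> Omega q -> nrm (p - x) < r -> nrm (q - y) < r ->
    - (2^-1 * ln (- rho (toR p))) - 2^-1 * ln (- rho' (toR q)) - C <= kobayashi_dist Omega p q.
Proof.
move=> halpha oO cO hB hdef Ux bx hM hdef' Uy by_ hM' c0 sep.
have rhox := bdry_zero oO hdef Ux bx; have rhoy := bdry_zero oO hdef' Uy by_.
have hBx a z : Omega z -> nrm (z - a) <= B + nrm a.
  by move=> /hB h; apply: le_trans (nrmB _ _) _; rewrite lerD2r.
(* If both moving functionals were below e in modulus at a point, both limit functionals would be
   below 2 e, and the squares would add up to less than 8 e^2 = c. *)
pose e := Num.sqrt (c / 8).
have e0 : 0 < e by rewrite sqrtr_gt0 divr_gt0.
have e2 : e ^+ 2 = c / 8 by rewrite sqr_sqrtr// divr_ge0// ltW.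
have m0 : 0 < e ^+ 2 by rewrite exprn_gt0.
(* Then 4 delta p < e, so p lies where the first functional is small and the cutoff of the second
   one vanishes; likewise for q with the functionals exchanged. *)
have e80 : 0 < e / 8 by rewrite divr_gt0.
have [r1 r10 hr1] := defining_lower halpha oO cO hdef hM Ux rhox (hBx x) e0.
have [r2 r20 hr2] := defining_lower halpha oO cO hdef' hM' Uy rhoy (hBx y) e0.
have [r3 r30 hr3] := defining_small hdef Ux rhox e80.
have [r4 r40 hr4] := defining_small hdef' Uy rhoy e80.
exists (2^-1 * ln (32 / e ^+ 2)), (Num.min (Num.min r1 r2) (Num.min r3 r4)).
rewrite !lt_min r10 r20 r30 r40; split=> // p q pO qO.
rewrite !lt_min => /andP[/andP[p1 _] /andP[p3 _]] /andP[/andP[_ q2] /andP[_ q4]].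
have [lp [kp [Kp [lpK posp pp closep]]]] := hr1 p pO p1.
have [lq [kq [Kq [lqK posq qq closeq]]]] := hr2 q qO q2.
have /andP[dp0 dpe] := hr3 p pO p3; have /andP[dq0 dqe] := hr4 q qO q4.
have cutp := cutoff_log m0 dp0 (posp p pO) pp.
have cutq := cutoff_log m0 dq0 (posq q qO) qq.
have small (l : 'rV[R[i]]_d -> R[i]) k z : normc (l z + k) < e -> sqmod l k z < e ^+ 2.
  by move=> h; rewrite /sqmod ltrXn2r ?nnegrE ?normc_ge0 ?(ltW e0).
have near_form (l l' : 'rV[R[i]]_d -> R[i]) k k' z : normc (l z + k - (l' z + k')) <= e ->
    sqmod l k z < e ^+ 2 -> sqmod l' k' z < 4 * e ^+ 2.
  move=> h; rewrite /sqmod ltr_pXn2r ?nnegrE ?normc_ge0 ?(ltW e0)// => h2.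
  have -> : 4 * e ^+ 2 = (2 * e) ^+ 2 by ring.
  rewrite ltr_pXn2r ?nnegrE ?normc_ge0 ?mulr_ge0 ?(ltW e0)//.
  rewrite -[l' z + k'](subKr (l z + k)); apply: le_lt_trans (normcB _ _) _.
  by rewrite mulr2n mulrDl mul1r; exact: ltr_leD.
have dicho z : Omega z -> e ^+ 2 <= sqmod lp kp z \/ e ^+ 2 <= sqmod lq kq z.
  move=> zO; have [?|hp] := leP (e ^+ 2) (sqmod lp kp z); first by left.
  have [?|hq] := leP (e ^+ 2) (sqmod lq kq z); first by right.
  have := sep z zO; have := near_form _ _ _ _ _ (closep z zO) hp.
  have := near_form _ _ _ _ _ (closeq z zO) hq; rewrite e2; lra.
have sp : sqmod lp kp p < e ^+ 2 by apply: small; apply: le_lt_trans pp _; lra.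
have sq : sqmod lq kq q < e ^+ 2 by apply: small; apply: le_lt_trans qq _; lra.
have cutp0 : cutoff (e ^+ 2) (sqmod lq kq p) = 0.
  by apply: cutoff_ge => //; case: (dicho p pO) => //; rewrite leNgt sp.
have cutq0 : cutoff (e ^+ 2) (sqmod lp kp q) = 0.
  by apply: cutoff_ge => //; case: (dicho q qO) => //; rewrite leNgt sq.
have := kobayashi_dist_ge oO cO m0 lpK lqK posp posq dicho pO qO.
by apply: le_trans; rewrite cutp0 cutq0; lra.
Qed.

Lemma filter_prod_near {R : realType} {d : nat} (p q : nat -> 'rV[R[i]]_d)
    (x y : 'rV[R[i]]_d) (r : R) :
  p n @[n --> \oo] --> x -> q m @[m --> \oo] --> y -> 0 < r ->
  filter_prod \oo \oo [set nm : nat * nat | nrm (p nm.1 - x) < r /\ nrm (q nm.2 - y) < r].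
Proof.
move=> hp hq r0.
exists ([set n | nrm (p n - x) < r], [set m | nrm (q m - y) < r]).
  by split; [exact: cvg_nrm hp _ r0 | exact: cvg_nrm hq _ r0].
by move=> [n m].
Qed.

Theorem theorem2p11 (R : realType) (d : nat) (alpha : R)
    (Omega : set 'rV[R[i]]_d) (o x y : 'rV[R[i]]_d)
    (p q : nat -> 'rV[R[i]]_d)
    (halpha : 0 < alpha <= 1)
    (hdomain : domain Omega)
    (hbounded : bounded_set Omega)
    (hconvex : convex_set Omega)
    (hboundary : C1alpha_boundary alpha Omega)
    (ho : Omega o)
    (hp : forall n, Omega (p n))
    (hq : forall m, Omega (q m))
    (hx : bdry Omega x)
    (hy : bdry Omega y)
    (hpx : p n @[n --> \oo] --> x)
    (hqy : q m @[m --> \oo] --> y) :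
  (x = y ->
    gromov_product Omega o (p nm.1) (q nm.2) @[nm --> filter_prod \oo \oo] --> +oo) /\
  (limf_esup (fun nm : nat * nat =>
      (gromov_product Omega o (p nm.1) (q nm.2))%:E) (filter_prod \oo \oo) = +oo%E ->
    complex_tangent Omega x = complex_tangent Omega y).
Proof.
have [oO O0 _] := hdomain; have [B hB] := bounded_nrm hbounded.
have [U [rho [M [Ux hdef hM]]]] := hboundary x hx.
split=> [xy|].
  subst y; apply/cvgryPge => A.
  have [C [r1 [r10 lower]]] := kobayashi_dist_point_ge halpha oO hconvex hB hdef Ux hx hM ho.
  have [t0 [C' [t00 upper]]] := kobayashi_dist_pair_le halpha oO hconvex hdef Ux hx hM.
  (* The logarithms of rho cancel in the Gromov product, leaving half of - ln (2 t) - 2 C - C' as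
     lower bound, which has to reach A. *)
  pose t := Num.min t0 (expR (- (2 * A + 2 * C + C')) / 2).
  have tpos : 0 < t by rewrite lt_min t00 divr_gt0 ?expR_gt0.
  have lnt : ln (2 * t) <= - (2 * A + 2 * C + C').
    rewrite -[leRHS]expRK ler_ln ?posrE ?expR_gt0 ?mulr_gt0//.
    have : t <= expR (- (2 * A + 2 * C + C')) / 2 by rewrite ge_min lexx orbT.
    by rewrite ler_pdivlMr// mulrC.
  have [|r2 r20 hr2] := upper t tpos; first by rewrite ge_min lexx.
  have r0 : 0 < Num.min r1 r2 by rewrite lt_min r10 r20.
  apply: filterS (filter_prod_near hpx hqy r0) => -[n m] /=.
  rewrite !lt_min => -[/andP[n1 n2] /andP[m1 m2]].
  have [l1 _] := lower _ (hp n) n1; have [_ l2] := lower _ (hq m) m1.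
  have := hr2 _ _ (hp n) (hq m) n2 m2; rewrite /gromov_product; lra.
move=> sup; apply: contrapT => neq.
have [U' [rho' [M' [Uy hdef' hM']]]] := hboundary y hy.
have {neq}[c c0 sep] := tangent_separation oO O0 hconvex hboundary hB hdef Ux hx hdef' Uy hy neq.
have [C [r [r0 apart]]] := kobayashi_dist_apart halpha oO hconvex hB
  hdef Ux hx hM hdef' Uy hy hM' c0 sep.
have [C1 [r1 [r10 up1]]] := kobayashi_dist_point_le halpha oO hconvex hdef Ux hx hM ho.
have [C2 [r2 [r20 up2]]] := kobayashi_dist_point_le halpha oO hconvex hdef' Uy hy hM' ho.
have s0 : 0 < Num.min r (Num.min r1 r2) by rewrite !lt_min r0 r10 r20.
have F := filter_prod_near hpx hqy s0.
(* The upper limit is an infimum over the filter, so a finite bound on one of its sets is enough for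
   a contradiction. *)
suff : (+oo <= (2^-1 * (C1 + C2 + C))%:E)%E by rewrite leye_eq.
rewrite -sup; apply: le_trans (ereal_inf_lbound (imageP _ F)) _.
apply: ge_ereal_sup => _ [[n m] /= [hn hm] <-].
move: hn hm; rewrite !lt_min => /and3P[n0 n1 _] /and3P[m0 _ m2]; rewrite lee_fin.
have [l1 _] := up1 _ (hp n) n1; have [_ l2] := up2 _ (hq m) m2.
have := apart _ _ (hp n) (hq m) n0 m0; rewrite /gromov_product; lra.
Qed.
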